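(* Let $\mathcal{F}$ be a family of transcendental entire functions such that $J(\mathcal{F})$ contains at least three points. Then for any $w_0\in J(\mathcal{F})$ and any $f\in\mathcal{F}$ with $\Theta(w_0,f)<\frac12$, there exist a sequence $\{w_n\}$ in $\mathbb{C}$ with $w_n\to w_0$ and a sequence $\{f_n\}\subset\mathcal{F}$ such that, for every $n$, $w_n$ is a repelling fixed point of $f\circ f_n$.
   Context: A family $\mathcal{F}$ of entire functions is normal on an open set $G\subseteq\mathbb{C}$ if every sequence in $\mathcal{F}$ contains a subsequence that converges locally uniformly on $G$, where the limit is either a holomorphic function or identically $\infty$ (locally uniform convergence to $\infty$ is allowed). $\mathcal{F}$ is normal at a point $z_0\in\mathbb{C}$ if it is normal in some neighborhood of $z_0$. $F(\mathcal{F})$ is the set of points of $\mathbb{C}$ at which $\mathcal{F}$ is normal, and $J(\mathcal{F}):=\mathbb{C}\setminus F(\mathcal{F})$. A point $w\in\mathbb{C}$ is a repelling fixed point of an entire function $g$ if $g(w)=w$ and $|g'(w)|>1$. For an entire function $f$ and $a\in\mathbb{C}$, the truncated defect is $$\Theta(a,f)=1-\limsup_{r\to\infty}\frac{\overline{N}(r,a,f)}{T(r,f)},$$ where $T(r,f)=\frac{1}{2\pi}\int_0^{2\pi}\log^+|f(re^{i\phi})|\,d\phi$ is the Nevanlinna characteristic of the entire function $f$, and $\overline{N}(r,a,f)=\int_0^r\frac{\overline{n}(t,a)-\overline{n}(0,a)}{t}\,dt+\overline{n}(0,a)\log r$ is the counting function of the distinct $a$-points of $f$, with $\overline{n}(t,a)$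 the number of distinct solutions (ignoring multiplicities) of $f(z)=a$ in $|z|\le t$. *)

(* Defs.v *)
From HB Require Import structures.
From mathcomp Require Import all_boot all_order all_algebra.
From mathcomp Require Import complex.
From mathcomp Require Import finmap.
From mathcomp Require Import all_classical all_reals all_analysis.

Set Implicit Arguments.
Unset Strict Implicit.
Unset Printing Implicit Defensive.
Import Order.TTheory GRing.Theory Num.Theory.
Import numFieldNormedType.Exports.

Local Open Scope classical_set_scope.
Local Open Scope complex_scope.
Local Open Scope ring_scope.

(* R[i] has no topological structure of its own; seen as a numFieldType it
   gets the normed structure of a field over itself, so that [derivable f z 1]
   is complex differentiability and [derive1 f] the complex derivative. *)
Definition cplx (R : realType) : numFieldType := R[i].

(* [`|z|] is a nonnegative real seen in [cplx R]; [cmod z] lies in [R]. *)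
Definition cmod (R : realType) (z : cplx R) : R := Normc.normc z.

Definition polar (R : realType) (r phi : R) : cplx R :=
  (r * cos phi) +i* (r * sin phi).

Definition holomorphic_on (R : realType) (G : set (cplx R))
    (f : cplx R -> cplx R) : Prop :=
  forall z, G z -> derivable f z 1.

Definition entire (R : realType) (f : cplx R -> cplx R) : Prop :=
  holomorphic_on setT f.

Definition transcendental_entire (R : realType) (f : cplx R -> cplx R) : Prop :=
  entire f /\ ~ exists p : {poly cplx R}, forall z, f z = p.[z].

Definition loc_unif_cvg (R : realType) (G : set (cplx R))
    (h : nat -> cplx R -> cplx R) (g : cplx R -> cplx R) : Prop :=
  forall z, G z -> exists2 U, nbhs z U & {uniform U, h @ \oo --> g}.

Definition loc_unif_cvg_infty (R : realType) (G : set (cplx R))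
    (h : nat -> cplx R -> cplx R) : Prop :=
  forall z, G z -> exists2 U, nbhs z U &
    forall M : R, \forall n \near \oo, forall x, U x -> M < cmod (h n x).

Definition normal_on (R : realType) (F : set (cplx R -> cplx R))
    (G : set (cplx R)) : Prop :=
  forall h : nat -> cplx R -> cplx R, (forall n, F (h n)) ->
  exists2 s : nat -> nat, {homo s : m n / (m < n)%N} &
    (exists2 g, holomorphic_on G g & loc_unif_cvg G (fun n => h (s n)) g) \/
    loc_unif_cvg_infty G (fun n => h (s n)).

Definition normal_at (R : realType) (F : set (cplx R -> cplx R))
    (z : cplx R) : Prop :=
  exists2 G, open_nbhs z G & normal_on F G.

Definition fatou_set (R : realType) (F : set (cplx R -> cplx R)) :
    set (cplx R) :=
  [set z | normal_at F z].

Definition julia_set (R : realType) (F : set (cplx R -> cplx R)) :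
    set (cplx R) :=
  ~` fatou_set F.

Definition repelling_fixed_point (R : realType) (g : cplx R -> cplx R)
    (w : cplx R) : Prop :=
  g w = w /\ 1 < `|derive1 g w|.

(* [ln 0 = 0] in the library, so [log_plus 0 = 0] as it should be. *)
Definition log_plus (R : realType) (x : R) : R := Num.max 0 (ln x).

Definition nevanlinna_T (R : realType) (r : R) (f : cplx R -> cplx R) : R :=
  (2 * pi)^-1 *
  \int[lebesgue_measure]_(phi in `[0, 2 * pi]) log_plus (cmod (f (polar r phi))).

(* [fset_set] sends infinite sets to the empty one; the set below is finite
   unless the entire function [f] is constant. *)
Definition nbar (R : realType) (t : R) (a : cplx R) (f : cplx R -> cplx R) :
    nat :=
  #|` fset_set [set z : cplx R | cmod z <= t /\ f z = a]|.

Definition Nbar (R : realType) (r : R) (a : cplx R) (f : cplx R -> cplx R) : R :=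
  \int[lebesgue_measure]_(t in `[0, r])
     (((nbar t a f)%:R - (nbar 0 a f)%:R) / t)
  + (nbar 0 a f)%:R * ln r.

Definition truncated_defect (R : realType) (a : cplx R)
    (f : cplx R -> cplx R) : \bar R :=
  (1 - limf_esup (fun r : R => (Nbar r a f / nevanlinna_T r f)%:E) +oo_R)%E.

(* Main.v *)
(* If f had at most four simple w0-points, then counting every other w0-point twice in
   Jensen's inequality, and using T(r, f) / log r -> oo for the transcendental f, would give
   Nbar <= (1/2 + o(1)) T. Hence Theta(w0, f) < 1/2 provides five distinct simple w0-points
   a_j of f. As F is not normal at w0, Zalcman's rescaling gives phi_n in F, p_n -> w0 and
   rho_n -> 0 such that phi_n(p_n + rho_n x) converges to a nonconstant entire function g
   of bounded spherical derivative. Such a g cannot have only multiple a_j-points for all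
   five j: the quotient g'^2 / prod_j (g - a_j) would be entire, bounded, and small where g
   is large, which forces it to vanish. So g takes some a_j with nonzero derivative, and
   since f(a_j) = w0 and f'(a_j) <> 0, Hurwitz's argument solves
   f(phi_n(p_n + rho_n x)) = p_n + rho_n x near that point; the derivative of f o phi_n
   there is of order f'(a_j) g'(x) / rho_n, so these fixed points are repelling. They tend
   to w0.

   The function theory is built from Goursat's lemma, written in logarithmic polar
   coordinates so that integrating over rectangles yields the mean value property;
   compactness is expressed by limits along a fixed free ultrafilter [ultra] on nat. *)

Require Import Defs.
From HB Require Import structures.
From mathcomp Require Import all_boot all_order all_algebra.
From mathcomp Require Import complex finmap ring lra.
From mathcomp Require Import all_classical all_reals all_analysis.

Set Implicit Arguments.
Unset Strict Implicit.
Unset Printing Implicit Defensive.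
Import Order.TTheory GRing.Theory Num.Theory.
Import numFieldNormedType.Exports.
Local Open Scope classical_set_scope.
Local Open Scope ring_scope.

Arguments cmod : simpl never.

(** * Complex differentiability *)

Section Modulus.
Variable R : realType.
Local Notation C := (cplx R).
Local Notation N := (@cmod R).
Implicit Types (z w d : C) (f g : C -> C) (x y r e M : R).

(** The number five comes from a degree count. The spherical bound gives |g'|^2 <= 16 (1 + |g|)^4,
    so a denominator of degree 5 makes the quotient decay like 1/(1 + |g|), and Liouville's theorem
    alone finishes; the sharper count of totally ramified values is usually drawn from Nevanlinna's
    second main theorem. Asking for five is free on the other side: every simple point left out of
    the double counting costs O(log r), which is o(T). Both ends rest on one quantitative lemma,
    [simple_zero], proved by the minimum modulus principle instead of the argument principle. Its
    contrapositive [ramified_bound] keeps g'^2 / (g - a_j) bounded near the a_j-points. Applied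
    directly, it produces the fixed points, and its lower bound for the derivative at the zero found
    makes them repelling. Over circles only continuous functions are integrated: Jensen's inequality
    is stated with log+, and zeros are removed by reflection, so the singularities of log |f| never
    appear. *)

Lemma norm_cmod z : `|z| = (N z)%:C%C.
Proof. by []. Qed.

Lemma cmodM z w : N (z * w) = N z * N w.
Proof. exact: Normc.normcM. Qed.

Lemma cmodV z : N z^-1 = (N z)^-1.
Proof. exact: Normc.normcV. Qed.

Lemma cmodD z w : N (z + w) <= N z + N w.
Proof. exact: le_normcD. Qed.

Lemma cmodN z : N (- z) = N z.
Proof. exact: normcN. Qed.

Lemma cmod0 : N 0 = 0.
Proof. exact: Normc.normc0. Qed.

Lemma cmod1 : N 1 = 1.
Proof. exact: Normc.normc1. Qed.

Lemma cmodX z n : N (z ^+ n) = N z ^+ n.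
Proof. by elim: n => [|n IH]; rewrite ?expr0 ?cmod1// !exprS cmodM IH. Qed.

Lemma cmod_ge0 z : 0 <= N z.
Proof. by case: z => a b; rewrite /cmod /= sqrtr_ge0. Qed.

Lemma cmod_eq0 z : (N z == 0) = (z == 0).
Proof.
apply/eqP/eqP => [/Normc.eq0_normc //|->]; exact: cmod0.
Qed.

Lemma cmod_gt0 z : (0 < N z) = (z != 0).
Proof. by rewrite lt_def cmod_eq0 cmod_ge0 andbT. Qed.

Lemma cmodB z w : N (z - w) <= N z + N w.
Proof. by rewrite -(cmodN w) cmodD. Qed.

Lemma cmodBC z w : N (z - w) = N (w - z).
Proof. by rewrite -cmodN opprB. Qed.

Lemma cmod_leB z w : N z - N w <= N (z - w).
Proof. by rewrite lerBlDr -{1}(subrK w z) cmodD. Qed.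

Lemma cmodB_tri u z w : N (z - w) <= N (z - u) + N (u - w).
Proof. by rewrite -{1}(subrK u z) -addrA cmodD. Qed.

Lemma cmod_real x : N (x%:C)%C = `|x|.
Proof. by rewrite /cmod /= expr0n /= addr0 sqrtr_sqr. Qed.

Lemma cmod_ge_Re z : `|complex.Re z| <= N z.
Proof.
case: z => a b; rewrite /cmod /= -sqrtr_sqr ler_wsqrtr// lerDl sqr_ge0//.
Qed.

Lemma cmod_ge_Im z : `|complex.Im z| <= N z.
Proof.
case: z => a b; rewrite /cmod /= -sqrtr_sqr ler_wsqrtr// lerDr sqr_ge0//.
Qed.

Lemma cmod_le_ReIm z : N z <= `|complex.Re z| + `|complex.Im z|.
Proof.
have -> : z = (complex.Re z)%:C%C + 'i%C * (complex.Im z)%:C%C.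
  exact: complexE.
apply: le_trans (cmodD _ _) _; rewrite cmodM !cmod_real.
have -> : N ('i%C) = 1 by rewrite /cmod /= expr0n /= add0r expr1n sqrtr1.
case: z => a b /=; rewrite mul1r !(mul0r, mulr0, mul1r, subr0, addr0, add0r).
by [].
Qed.

Lemma mulcJ z : z * (z^*%C : C) = ((N z) ^+ 2)%:C%C.
Proof.
by have := sqr_normc z; move=> <-; rewrite rmorphXn.
Qed.

End Modulus.

Section Calculus.
Variable R : realType.
Local Notation C := (cplx R).
Local Notation N := (@cmod R).
Implicit Types (z w d : C) (f g : C -> C) (x y r e M : R).

(** Continuity and differentiability are restated with real radii and real errors, and with
    non-strict conclusions, which survive passage to a limit. *)
Definition ccont f z := forall e, 0 < e ->
  exists2 r, 0 < r & forall w, N (w - z) < r -> N (f w - f z) <= e.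

Definition cdiff f z d := forall e, 0 < e ->
  exists2 r, 0 < r & forall w, N (w - z) < r ->
    N (f w - f z - d * (w - z)) <= e * N (w - z).

(** The norm of [cplx R] takes values in [cplx R] itself, but a positive element of the complex
    order has zero imaginary part, so radii can be replaced by their real parts. *)
Lemma nbhs_cmod z (U : set C) :
  nbhs z U <-> exists2 r : R, 0 < r & forall w, N (w - z) < r -> U w.
Proof.
split=> [/nbhs_ballP [e /= e0 eU]|[r r0 rU]].
  exists (complex.Re e); first by move: e0; rewrite ltcE => /andP[].
  move=> w wz; apply: eU; rewrite /ball /= distrC norm_cmod.
  have eE : e = (complex.Re e)%:C%C.
    by move: e0; case: (e) => a b; rewrite ltcE /= => /andP[/eqP -> _].
  by rewrite eE ltcR.
apply/nbhs_ballP; exists (r%:C%C); first by rewrite /= ltcE /= eqxx.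
by move=> w; rewrite /ball /= distrC norm_cmod ltcR => /rU.
Qed.

Lemma cvg_cmodP T (F : set_system T) (FF : Filter F) (h : T -> C) l :
  h t @[t --> F] --> l <-> forall e : R, 0 < e -> \forall t \near F, N (l - h t) <= e.
Proof.
split=> [/(@cvgrPdist_le _ _ _ F FF) hl e e0|hl].
  have := hl e%:C%C; rewrite ltcR => /(_ e0).
  by apply: filterS => t; rewrite norm_cmod lecR.
apply/(@cvgrPdist_le _ _ _ F FF) => e e0.
have eE : e = (complex.Re e)%:C%C.
  by move: e0; case: (e) => a b; rewrite ltcE /= => /andP[/eqP -> _].
have /hl : 0 < complex.Re e by move: e0; rewrite eE ltcR.
by apply: filterS => t; rewrite {2}eE norm_cmod lecR.
Qed.

Lemma ccontP f z : ccont f z <-> f w @[w --> z] --> f z.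
Proof.
split=> [fz|/(cvg_cmodP (nbhs_filter z)) fz e e0].
  apply/(cvg_cmodP (nbhs_filter z)) => e /fz[r r0 rf].
  by apply/nbhs_cmod; exists r => // w /rf; rewrite cmodBC.
have /fz/nbhs_cmod[r r0 rf] := e0.
by exists r => // w /rf; rewrite cmodBC.
Qed.

Lemma ccont_cst (c : C) z : ccont (fun=> c) z.
Proof. by move=> e e0; exists 1 => // w _; rewrite subrr cmod0 ltW. Qed.

Lemma ccont_id z : ccont id z.
Proof. by move=> e e0; exists e => // w /ltW. Qed.

Lemma ccontD f g z : ccont f z -> ccont g z -> ccont (fun w => f w + g w) z.
Proof.
move=> /ccontP fz /ccontP gz; apply/ccontP.
exact: (@cvgD _ _ _ (nbhs z) (nbhs_filter z) f g _ _ fz gz).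
Qed.

Lemma ccontN f z : ccont f z -> ccont (fun w => - f w) z.
Proof.
move=> /ccontP fz; apply/ccontP; exact: (@cvgN _ _ _ (nbhs z) (nbhs_filter z) f _ fz).
Qed.

Lemma ccontM f g z : ccont f z -> ccont g z -> ccont (fun w => f w * g w) z.
Proof.
move=> /ccontP fz /ccontP gz; apply/ccontP.
exact: (@cvgM _ _ (nbhs z) (nbhs_filter z) f g _ _ fz gz).
Qed.

Lemma ccontV f z : f z != 0 -> ccont f z -> ccont (fun w => (f w)^-1) z.
Proof.
move=> fz0 /ccontP fz; apply/ccontP.
exact: (@cvgV _ _ (nbhs z) (nbhs_filter z) f _ fz0 fz).
Qed.

Lemma ccont_comp f g z : ccont f z -> ccont g (f z) -> ccont (fun w => g (f w)) z.
Proof.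
by move=> /ccontP fz /ccontP gz; apply/ccontP; apply: (cvg_comp _ _ fz gz).
Qed.

(** Caratheodory's form of differentiability. The product, inverse and chain rules then reduce to
    the continuity of the slope function q. *)
Lemma cdiffP f z d : cdiff f z d <->
  exists q, [/\ ccont q z, q z = d & forall w, f w - f z = q w * (w - z)].
Proof.
split=> [fz|[q [qz <- qE]] e e0]; last first.
  have [r r0 rq] := qz _ e0; exists r => // w /rq wz.
  by rewrite qE -mulrBl cmodM ler_wpM2r// cmod_ge0.
exists (fun w => if w == z then d else (f w - f z) / (w - z)); split.
- move=> e e0; have [r r0 rf] := fz _ e0; exists r => // w wz.
  rewrite eqxx; case: eqVneq => [_|wz0]; first by rewrite subrr cmod0 ltW.
  have wz1 : w - z != 0 by rewrite subr_eq0.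
  rewrite -(mulfK wz1 d) -mulrBl cmodM cmodV ler_pdivrMr ?cmod_gt0//.
  exact: rf.
- by rewrite eqxx.
- move=> w; case: eqVneq => [->|wz0]; first by rewrite !subrr mulr0.
  by rewrite divfK// subr_eq0.
Qed.

Lemma cdiff_cont f z d : cdiff f z d -> ccont f z.
Proof.
move=> /cdiffP[q [qz _ qE]].
have : ccont (fun w => f z + q w * (w - z)) z.
  apply: ccontD; first exact: ccont_cst.
  apply: ccontM => //; apply: ccontD; [exact: ccont_id|exact: ccont_cst].
move=> h e /h[r r0 rh]; exists r => // w /rh.
by rewrite -!qE subrr addr0 [f z + _]addrC subrK.
Qed.

Lemma cdiff_local f g z d : (exists2 r, 0 < r & forall w, N (w - z) < r -> f w = g w) ->
  cdiff f z d -> cdiff g z d.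
Proof.
move=> [r r0 rE] fz e /fz[s s0 sf]; exists (Num.min r s); first by rewrite lt_min r0.
move=> w; rewrite lt_min => /andP[wr ws]; rewrite -!rE ?subrr ?cmod0//.
exact: sf.
Qed.

Lemma cdiff_cst (c : C) z : cdiff (fun=> c) z 0.
Proof.
by move=> e e0; exists 1 => // w _; rewrite subrr mul0r subrr cmod0 mulr_ge0 ?cmod_ge0 ?(ltW e0).
Qed.

Lemma cdiff_id z : cdiff id z 1.
Proof.
by move=> e e0; exists 1 => // w _; rewrite mul1r subrr cmod0 mulr_ge0 ?cmod_ge0 ?(ltW e0).
Qed.

Lemma cdiffD f g z d d' : cdiff f z d -> cdiff g z d' ->
  cdiff (fun w => f w + g w) z (d + d').
Proof.
move=> /cdiffP[p [pz pd pE]] /cdiffP[q [qz qd qE]]; apply/cdiffP.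
exists (fun w => p w + q w); split; [exact: ccontD|by rewrite pd qd|].
by move=> w; rewrite mulrDl -pE -qE; ring.
Qed.

Lemma cdiffM f g z d d' : cdiff f z d -> cdiff g z d' ->
  cdiff (fun w => f w * g w) z (d * g z + f z * d').
Proof.
move=> fz gz; have fc := cdiff_cont fz; move: fz gz.
move=> /cdiffP[p [pz pd pE]] /cdiffP[q [qz qd qE]]; apply/cdiffP.
exists (fun w => p w * g z + f w * q w); split.
- apply: ccontD; [apply: ccontM => //; exact: ccont_cst|exact: ccontM].
- by rewrite pd qd.
- by move=> w; rewrite mulrDl mulrAC -pE -mulrA -qE; ring.
Qed.

Lemma cdiffN f z d : cdiff f z d -> cdiff (fun w => - f w) z (- d).
Proof.
move=> /(cdiffM (cdiff_cst (-1) z)); rewrite mul0r add0r mulN1r.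
by apply: cdiff_local; exists 1 => // w _; rewrite mulN1r.
Qed.

Lemma cdiffB f g z d d' : cdiff f z d -> cdiff g z d' ->
  cdiff (fun w => f w - g w) z (d - d').
Proof. by move=> fz /cdiffN; exact: cdiffD. Qed.

Lemma cdiffV f z d : f z != 0 -> cdiff f z d ->
  cdiff (fun w => (f w)^-1) z (- d / f z ^+ 2).
Proof.
move=> fz0 fz; have fc := cdiff_cont fz.
have [r r0 rf] : exists2 r, 0 < r & forall w, N (w - z) < r -> f w != 0.
  have /fc[r r0 rf] : 0 < N (f z) / 2 by rewrite divr_gt0// cmod_gt0.
  exists r => // w /rf; apply: contraTneq => ->; rewrite sub0r cmodN -ltNge.
  have : 0 < N (f z) by rewrite cmod_gt0.
  by lra.
move: fz => /cdiffP[p [pz pd pE]].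
have H : ccont (fun w => - p w / (f w * f z)) z.
  apply: ccontM; first exact: ccontN.
  apply: ccontV; first by rewrite mulf_neq0.
  apply: ccontM => //; exact: ccont_cst.
move=> e /H[s s0 sH]; exists (Num.min r s); first by rewrite lt_min r0.
move=> w; rewrite lt_min => /andP[/rf fw0 /sH]; rewrite pd -expr2 => A.
have -> : (f w)^-1 - (f z)^-1 = - p w / (f w * f z) * (w - z).
  rewrite mulrAC mulNr -pE; field.
  by rewrite fz0 fw0.
by rewrite -mulrBl cmodM ler_wpM2r// cmod_ge0.
Qed.

Lemma cdiff_comp f g z d d' : cdiff f z d -> cdiff g (f z) d' ->
  cdiff (fun w => g (f w)) z (d' * d).
Proof.
move=> fz gz; have fc := cdiff_cont fz; move: fz gz.
move=> /cdiffP[p [pz pd pE]] /cdiffP[q [qz qd qE]]; apply/cdiffP.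
exists (fun w => q (f w) * p w); split.
- by apply: ccontM => //; exact: ccont_comp.
- by rewrite pd qd.
- by move=> w; rewrite qE pE mulrA.
Qed.

Lemma cdiff_is_derive f z d : cdiff f z d <-> is_derive z 1 f d.
Proof.
have E h : h != 0 -> N (h^-1 *: (f (h *: 1 + z) - f z) - d) * N h =
    N (f (h + z) - f z - d * (h + z - z)).
  move=> h0; rewrite -cmodM; congr N; rewrite addrK [h *: 1]mulr1 [_ *: _]mulrC.
  by rewrite mulrBl divfK.
split=> [fz|].
  have H : h^-1 *: (f (h *: 1 + z) - f z) @[h --> 0^'] --> d.
    apply/(cvg_cmodP _) => e /fz[r r0 rf].
    apply/nbhs_cmod; exists r => // h; rewrite subr0 => hr h0.
    rewrite cmodBC -(ler_pM2r (_ : 0 < N h)) ?cmod_gt0// E//.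
    by have := rf (h + z); rewrite addrK; apply.
  split; first by apply/cvg_ex; exists d.
  by apply/cvg_lim; [exact: norm_hausdorff|exact: H].
move=> [/cvg_ex[l /= fl] ld]; have {}ld : l = d.
  by rewrite -ld; apply/esym/cvg_lim; [exact: norm_hausdorff|exact: fl].
rewrite {}ld in fl.
move=> e e0; have H := (cvg_cmodP _ _ _).1 fl _ e0.
have {}H := H (within_filter _ (nbhs_filter (0 : C))).
have [r r0 rf] := (nbhs_cmod _ _).1 H; exists r => // w wz.
have [->|wz0] := eqVneq w z; first by rewrite !subrr mulr0 subrr cmod0 mulr0.
have h0 : w - z != 0 by rewrite subr_eq0.
have := E (w - z) h0; rewrite subrK => <-; apply: ler_wpM2r; first exact: cmod_ge0.
by rewrite cmodBC; apply: rf => //; rewrite subr0.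
Qed.

End Calculus.

(* [derive1] hidden from conversion, which would otherwise unfold it. *)
HB.lock Definition cder (R : realType) (f : cplx R -> cplx R) (z : cplx R) : cplx R :=
  derive1 f z.

Section Cder.
Variable R : realType.
Local Notation C := (cplx R).
Implicit Types (z d : C) (f : C -> C).

Lemma cderE f z : cder f z = derive1 f z.
Proof. by rewrite cder.unlock. Qed.

Lemma derivable_cdiff f z : derivable f z 1 -> cdiff f z (cder f z).
Proof. by move=> /derivableP; rewrite cderE derive1E => /cdiff_is_derive. Qed.

Lemma cdiff_derivable f z d : cdiff f z d -> derivable f z 1.
Proof. by move=> /cdiff_is_derive[]. Qed.

Lemma cdiff_cder f z d : cdiff f z d -> cder f z = d.
Proof. by move=> fd; have [_] := (cdiff_is_derive f z d).1 fd; rewrite cderE derive1E. Qed.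

End Cder.

Section UniformCvg.
Variable R : realType.
Local Notation C := (cplx R).

Lemma uniform_cvg_cmod (U : set C) (h : nat -> C -> C) (g : C -> C) :
  (forall e : R, 0 < e -> \forall n \near \oo, forall z, U z -> cmod (h n z - g z) <= e) ->
  {uniform U, h @ \oo --> g}.
Proof.
move=> H P /uniform_nbhs[E [/= entE EP]].
have [e e0 eE] : exists2 e : R, 0 < e & forall x y : C, cmod (x - y) <= e -> E (y, x).
  have := entE; rewrite -entourage_ballE => -[e /= e0 eE].
  have e'E : e = (complex.Re e)%:C%C.
    by move: e0; case: (e) => p q; rewrite ltcE /= => /andP[/eqP -> _].
  have e'0 : 0 < complex.Re e.
    by move: e0; case: (e) => p q; rewrite ltcE /= => /andP[_].
  exists (complex.Re e / 2); first by rewrite divr_gt0.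
  move=> x y xy; apply: eE; rewrite /= /ball /= distrC norm_cmod e'E ltcR.
  by apply: le_lt_trans xy _; rewrite ltr_pdivrMr// ltr_pMr// ltr1n.
apply: filterS (H _ e0) => n nE; apply: EP => z Uz /=; exact/eE/nE.
Qed.

Lemma norm_gt1 (z : C) : (1 < `|z|) = (1 < cmod z).
Proof. by rewrite norm_cmod -[1]/((1 : R)%:C%C) ltcR. Qed.

End UniformCvg.

(** * Limits along an ultrafilter *)

Lemma free_ultrafilter : exists U : set_system nat, UltraFilter U /\ \oo `<=` U.
Proof. by have [U [UU UF]] := ultraFilterLemma (eventually_filter); exists U. Qed.

(** Every bounded sequence has a limit along [ultra], so limit functions can be defined pointwise,
    without extraction; an actual subsequence is produced only at the end, by [ultra_subseq]. *)
Definition ultra : set_system nat := projT1 (cid free_ultrafilter).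

Global Instance ultra_ultra : UltraFilter ultra.
Proof. exact: (projT2 (cid free_ultrafilter)).1. Qed.

Lemma ultra_ge m : \forall n \near ultra, (m <= n)%N.
Proof. by apply: (projT2 (cid free_ultrafilter)).2; exact: nbhs_infty_ge. Qed.

Lemma ultra_em (P : nat -> Prop) :
  (\forall n \near ultra, P n) \/ (\forall n \near ultra, ~ P n).
Proof. exact: (in_ultra_setVsetC [set n | P n] ultra_ultra). Qed.

Lemma ultraN (P : nat -> Prop) :
  ~ (\forall n \near ultra, P n) -> \forall n \near ultra, ~ P n.
Proof. by case: (ultra_em P). Qed.

Lemma ultra_ex (P : nat -> Prop) m : (\forall n \near ultra, P n) ->
  exists2 n, (m <= n)%N & P n.
Proof.
by move=> UP; have [n [? ?]] := filter_ex (filterI (ultra_ge m) UP); exists n.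
Qed.

Section UltraLimit.
Variable R : realType.
Local Notation C := (cplx R).
Local Notation N := (@cmod R).
Implicit Types (z w d l a : C) (f g : C -> C) (x y r e M : R) (u v : nat -> C).

(** The limit is the supremum of the t that stay below x_n for ultra-many n; the ultrafilter decides
    the opposite inequality. *)
Lemma real_ulim (x_ : nat -> R) M : (\forall n \near ultra, `|x_ n| <= M) ->
  exists l : R, forall e, 0 < e -> \forall n \near ultra, `|x_ n - l| <= e.
Proof.
move=> xM; pose S := [set t | \forall n \near ultra, t <= x_ n].
have S0 : S (- M).
  by apply: filterS xM => n; rewrite ler_norml => /andP[].
have Sub : ubound S M.
  move=> t tS; have [n _ [A B]] := ultra_ex 0 (filterI tS xM).
  by apply: le_trans A _; apply: le_trans B; exact: ler_norm.
have hS : has_sup S by split; [exists (- M)|exists M].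
exists (sup S) => e e0.
have [t tS te] := sup_adherent e0 hS.
have : \forall n \near ultra, ~ (sup S + e <= x_ n).
  apply: ultraN => /(ub_le_sup hS.2); rewrite gerDl; lra.
apply: (filterS2 _) tS => n A B.
rewrite ler_norml; apply/andP; split; first by lra.
by move/negP: B; rewrite -ltNge => B; lra.
Qed.

Definition ucvg u l := forall e, 0 < e -> \forall n \near ultra, N (u n - l) <= e.

Lemma ulim_ex u M : (\forall n \near ultra, N (u n) <= M) -> exists l, ucvg u l.
Proof.
move=> uM.
have [a aE] : exists a : R, forall e, 0 < e -> \forall n \near ultra, `|complex.Re (u n) - a| <= e.
  by apply: (@real_ulim _ M); apply: filterS uM => n; apply: le_trans; exact: cmod_ge_Re.
have [b bE] : exists b : R, forall e, 0 < e -> \forall n \near ultra, `|complex.Im (u n) - b| <= e.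
  by apply: (@real_ulim _ M); apply: filterS uM => n; apply: le_trans; exact: cmod_ge_Im.
exists (a +i* b)%C => e e0.
have e2 : 0 < e / 2 by rewrite divr_gt0.
apply: (filterS2 _) (aE _ e2) (bE _ e2) => n.
have := cmod_le_ReIm (u n - (a +i* b)%C); case: (u n) => p q /=; lra.
Qed.

Lemma ucvg_le u l M : ucvg u l -> (\forall n \near ultra, N (u n) <= M) -> N l <= M.
Proof.
move=> ul uM; apply/ler_addgt0Pr => e e0.
have [n _ [A B]] := ultra_ex 0 (filterI (ul _ e0) uM).
have := cmod_leB l (u n); rewrite cmodBC; lra.
Qed.

Lemma ucvg_ge u l M : ucvg u l -> (\forall n \near ultra, M <= N (u n)) -> M <= N l.
Proof.
move=> ul uM; apply/ler_addgt0Pr => e e0.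
have [n _ [A B]] := ultra_ex 0 (filterI (ul _ e0) uM).
have := cmod_leB (u n) l; lra.
Qed.

Lemma ucvg_cst l : ucvg (fun=> l) l.
Proof. by move=> e /ltW e0; apply: nearW => n; rewrite subrr cmod0. Qed.

Lemma ucvgD u v l a : ucvg u l -> ucvg v a -> ucvg (fun n => u n + v n) (l + a).
Proof.
move=> ul va e e0; have e2 : 0 < e / 2 by rewrite divr_gt0.
apply: (filterS2 _) (ul _ e2) (va _ e2) => n A B.
have := cmodD (u n - l) (v n - a).
have -> : u n - l + (v n - a) = u n + v n - (l + a) by ring.
lra.
Qed.

Lemma ucvg_comp f u l : ccont f l -> ucvg u l -> ucvg (fun n => f (u n)) (f l).
Proof.
move=> fl ul e /fl[r r0 rf]; have r2 : 0 < r / 2 by rewrite divr_gt0.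
by apply: filterS (ul _ r2) => n ?; apply: rf; lra.
Qed.

Lemma ucvgN u l : ucvg u l -> ucvg (fun n => - u n) (- l).
Proof. apply: ucvg_comp; apply: ccontN; exact: ccont_id. Qed.

Lemma ucvgMr c u l : ucvg u l -> ucvg (fun n => u n * c) (l * c).
Proof.
apply: (@ucvg_comp (fun w => w * c)); apply: ccontM; [exact: ccont_id|exact: ccont_cst].
Qed.

Lemma ucvgM u v l a : ucvg u l -> ucvg v a -> ucvg (fun n => u n * v n) (l * a).
Proof.
move=> ul va e e0.
have A0 : 0 < e / 2 / (1 + N a) by rewrite !divr_gt0// ltr_pwDl ?cmod_ge0.
have B0 : 0 < Num.min 1 (e / 2 / (1 + N l)).
  by rewrite lt_min ltr01 !divr_gt0// ltr_pwDl ?cmod_ge0.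
have B0' := B0.
apply: (filterS2 _) (ul _ A0) (va _ B0) => n A; rewrite le_min => /andP[B1 B2].
have -> : u n * v n - l * a = (u n - l) * v n + l * (v n - a) by ring.
apply: le_trans (cmodD _ _) _; rewrite !cmodM.
have vn : N (v n) <= 1 + N a by have := cmod_leB (v n) a; lra.
have := cmod_ge0 l; have := cmod_ge0 a => a0 l0.
have H1 : N (u n - l) * N (v n) <= e / 2 / (1 + N a) * (1 + N a).
  by apply: ler_pM; rewrite ?cmod_ge0.
have H2 : N l * N (v n - a) <= (1 + N l) * (e / 2 / (1 + N l)).
  by apply: ler_pM; rewrite ?cmod_ge0// lerDr.
rewrite divfK in H1; last by rewrite gt_eqF// ltr_pwDl.
rewrite [leRHS]mulrC divfK in H2; last by rewrite gt_eqF// ltr_pwDl.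
lra.
Qed.

Lemma ucvg_eq u v l : (\forall n \near ultra, u n = v n) -> ucvg u l -> ucvg v l.
Proof. by move=> uv ul e /ul; apply: (filterS2 _) uv => n ->. Qed.

Lemma ultra_small e : 0 < e -> \forall n \near ultra, n.+1%:R^-1 <= e.
Proof.
move=> e0; apply: filterS (ultra_ge (Num.bound e^-1)) => n ne.
rewrite invf_ple ?posrE//; apply/ltW.
have := archi_boundP (ltW (_ : 0 < e^-1)); rewrite invr_gt0 => /(_ e0) h.
by apply: lt_le_trans h _; rewrite ler_nat (leq_trans ne).
Qed.

Lemma ultra_big M : \forall n \near ultra, M <= n.+1%:R.
Proof.
have M0 : 0 < (1 + `|M|)^-1 by rewrite invr_gt0 ltr_pwDl.
apply: filterS (ultra_small M0) => n; rewrite lef_pV2 ?posrE ?ltr_pwDl//.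
by have := ler_norm M; lra.
Qed.

Lemma disc_ulim u a r : (forall n, N (u n - a) <= r) -> exists2 l, ucvg u l & N (l - a) <= r.
Proof.
move=> ur; have [l ul] : exists l, ucvg u l.
  apply: (@ulim_ex _ (r + N a)); apply: nearW => n.
  by have := ur n; have := cmod_leB (u n) a; lra.
exists l => //; apply: (ucvg_le (ucvgD ul (ucvg_cst (- a)))).
exact: nearW.
Qed.

(** Compactness of the closed disc: points with |f| > n + 1 would have an ultralimit in the disc,
    where continuity bounds f. [disc_unif_cont] argues in the same way with pairs of points. *)
Lemma disc_bounded f a r : (forall z, N (z - a) <= r -> ccont f z) ->
  exists2 M, 0 < M & forall z, N (z - a) <= r -> N (f z) <= M.
Proof.
move=> fc; apply: contrapT => H.
have /choice[u uE] : forall n : nat, exists z, N (z - a) <= r /\ n.+1%:R < N (f z).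
  move=> n; apply: contrapT => Hn; apply: H; exists n.+1%:R => // z zr.
  by rewrite leNgt; apply/negP => ?; apply: Hn; exists z.
have [l ul lr] := disc_ulim (fun n => (uE n).1).
have := ucvg_comp (fc _ lr) ul => /(_ 1 ltr01) A.
have [n _ [B]] := ultra_ex 0 (filterI A (ultra_big (1 + N (f l)))).
have := (uE n).2; have := cmod_leB (f (u n)) (f l); move=> ? ? ?; lra.
Qed.

Lemma disc_unif_cont f a r : (forall z, N (z - a) <= r -> ccont f z) ->
  forall e, 0 < e -> exists2 s, 0 < s & forall z w, N (z - a) <= r -> N (w - a) <= r ->
   N (z - w) <= s -> N (f z - f w) <= e.
Proof.
move=> fc e e0; apply: contrapT => H.
have /choice[u uE] : forall n : nat, exists p : C * C, [/\ N (p.1 - a) <= r,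
     N (p.2 - a) <= r, N (p.1 - p.2) <= n.+1%:R^-1 & e < N (f p.1 - f p.2)].
  move=> n; apply: contrapT => Hn; apply: H; exists n.+1%:R^-1; first by rewrite invr_gt0.
  by move=> z w zr wr zw; rewrite leNgt; apply/negP => ?; apply: Hn; exists (z, w).
have [l ul lr] : exists2 l, ucvg (fun n => (u n).1) l & N (l - a) <= r.
  by apply: disc_ulim => n; have [] := uE n.
have vl : ucvg (fun n => (u n).2) l.
  move=> s s0; have s2 : 0 < s / 2 by rewrite divr_gt0.
  apply: (filterS2 _) (ul _ s2) (ultra_small s2) => n /= A B.
  have [_ _ h _] := uE n.
  have := le_trans h B; have := cmodB_tri (u n).1 (u n).2 l.
  by rewrite (cmodBC (u n).2 (u n).1); lra.
have := ucvgD (ucvg_comp (fc _ lr) ul) (ucvgN (ucvg_comp (fc _ lr) vl)).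
rewrite subrr => /(_ _ e0) A; have [n _] := ultra_ex 0 A; rewrite subr0.
by have [_ _ _ /lt_le_trans h] := uE n => /h; rewrite ltxx.
Qed.

End UltraLimit.

(** * Goursat's lemma and the mean value property *)

Section PathIntegral.
Variable R : realType.
Local Notation C := (cplx R).
Local Notation N := (@cmod R).
Local Notation mu := (@lebesgue_measure R).
Local Notation i := ('i%C : C).
Implicit Types (z w d : C) (g h : R -> C) (s t a b c e M : R).

Definition rcont g := forall t e, 0 < e ->
  exists2 r, 0 < r & forall s, `|s - t| < r -> N (g s - g t) <= e.

Lemma rcont_cst z : rcont (fun=> z).
Proof. by move=> t e e0; exists 1 => // s _; rewrite subrr cmod0 ltW. Qed.

Lemma rcont_comp (f : C -> C) g : (forall t, ccont f (g t)) -> rcont g ->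
  rcont (fun t => f (g t)).
Proof.
move=> fc gc t e e0; have [r r0 rf] := fc t _ e0.
have [r' r'0 rg] := gc t (r / 2) (divr_gt0 r0 (ltr0n _ 2)).
by exists r' => // s /rg gs; apply: rf; apply: le_lt_trans gs _; rewrite ltr_pdivrMr// ltr_pMr// ltr1n.
Qed.

Lemma rcontD g h : rcont g -> rcont h -> rcont (fun t => g t + h t).
Proof.
move=> gc hc t e e0; have e2 : 0 < e / 2 by rewrite divr_gt0.
have [r r0 rg] := gc t _ e2; have [q q0 qh] := hc t _ e2.
exists (Num.min r q); first by rewrite lt_min r0.
move=> s; rewrite lt_min => /andP[/rg A /qh B].
have -> : g s + h s - (g t + h t) = (g s - g t) + (h s - h t) by ring.
by have := cmodD (g s - g t) (h s - h t); lra.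
Qed.

Lemma rcontMl z g : rcont g -> rcont (fun t => z * g t).
Proof.
move=> gc; apply: (@rcont_comp (fun w => z * w)) => // t.
by apply: ccontM; [exact: ccont_cst|exact: ccont_id].
Qed.

Lemma rcontN g : rcont g -> rcont (fun t => - g t).
Proof.
move=> gc; apply: (@rcont_comp (fun w => - w)) => // t.
by apply: ccontN; exact: ccont_id.
Qed.

Lemma rcontB g h : rcont g -> rcont h -> rcont (fun t => g t - h t).
Proof. by move=> gc hc; apply: rcontD => //; exact: rcontN. Qed.

Lemma rcont_continuous (p : C -> R) g : (forall z w, `|p z - p w| <= N (z - w)) ->
  rcont g -> continuous (p \o g).
Proof.
move=> pl gc t; apply/cvgrPdist_le => e /(gc t)[r r0 rg].
apply/nbhs_ballP; exists r => //= s; rewrite /ball/= => ts.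
by rewrite distrC; apply: le_trans (pl _ _) _; apply: rg; rewrite distrC.
Qed.

Lemma Re_lip z w : `|complex.Re z - complex.Re w| <= N (z - w).
Proof. by have := cmod_ge_Re (z - w); case: z; case: w. Qed.

Lemma Im_lip z w : `|complex.Im z - complex.Im w| <= N (z - w).
Proof. by have := cmod_ge_Im (z - w); case: z; case: w. Qed.

Lemma cont_integrable (p : R -> R) a b : continuous p -> mu.-integrable `[a, b] (EFin \o p).
Proof.
move=> pc; apply: continuous_compact_integrable; first exact: segment_compact.
exact: continuous_subspaceT.
Qed.

Lemma Re_integrable g a b : rcont g -> mu.-integrable `[a, b] (EFin \o (fun t => complex.Re (g t))).
Proof. by move=> gc; apply: cont_integrable; exact: (rcont_continuous Re_lip gc). Qed.

Lemma Im_integrable g a b : rcont g -> mu.-integrable `[a, b] (EFin \o (fun t => complex.Im (g t))).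
Proof. by move=> gc; apply: cont_integrable; exact: (rcont_continuous Im_lip gc). Qed.

Lemma Rintegral_chasles (p : R -> R) a c b : mu.-integrable `[a, b] (EFin \o p) ->
  a <= c -> c <= b ->
  \int[mu]_(t in `[a, b]) p t = \int[mu]_(t in `[a, c]) p t + \int[mu]_(t in `[c, b]) p t.
Proof.
move=> pi ac cb.
have := @Rintegral_itvB R p (BLeft a) (BRight b) c pi.
rewrite !bnd_simp => /(_ ac cb)/eqP; rewrite subr_eq addrC => /eqP ->.
congr (_ + _); rewrite Rintegral_itv_obnd_cbnd//.
apply: integrableS pi => //; apply: subset_itvr; rewrite bnd_simp//.
Qed.

Definition cint a b g : C :=
  ((\int[mu]_(t in `[a, b]) complex.Re (g t)) +i*
   (\int[mu]_(t in `[a, b]) complex.Im (g t)))%C.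

Lemma cint_chasles g a c b : rcont g -> a <= c -> c <= b ->
  cint a b g = cint a c g + cint c b g.
Proof.
move=> gc ac cb; rewrite /cint.
rewrite (Rintegral_chasles (Re_integrable a b gc) ac cb).
by rewrite (Rintegral_chasles (Im_integrable a b gc) ac cb).
Qed.

Lemma cintD g h a b : rcont g -> rcont h ->
  cint a b (fun t => g t + h t) = cint a b g + cint a b h.
Proof.
move=> gc hc; rewrite /cint.
have -> : \int[mu]_(t in `[a, b]) complex.Re (g t + h t) =
    \int[mu]_(t in `[a, b]) complex.Re (g t) + \int[mu]_(t in `[a, b]) complex.Re (h t).
  rewrite -RintegralD//; [|exact: Re_integrable|exact: Re_integrable].
  by apply: eq_Rintegral => t _; case: (g t); case: (h t).
have -> : \int[mu]_(t in `[a, b]) complex.Im (g t + h t) =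
    \int[mu]_(t in `[a, b]) complex.Im (g t) + \int[mu]_(t in `[a, b]) complex.Im (h t).
  rewrite -RintegralD//; [|exact: Im_integrable|exact: Im_integrable].
  by apply: eq_Rintegral => t _; case: (g t); case: (h t).
by [].
Qed.

Lemma cintZ z g a b : rcont g -> cint a b (fun t => z * g t) = z * cint a b g.
Proof.
move=> gc; rewrite /cint.
have rI x : mu.-integrable `[a, b] (EFin \o (fun t => x * complex.Re (g t))).
  have := Re_integrable a b (rcontMl x%:C%C gc); congr (mu.-integrable _ _).
  by apply/funext => t /=; case: (g t) => p q /=; rewrite mul0r ?subr0 ?addr0.
have iI x : mu.-integrable `[a, b] (EFin \o (fun t => x * complex.Im (g t))).
  have := Im_integrable a b (rcontMl x%:C%C gc); congr (mu.-integrable _ _).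
  by apply/funext => t /=; case: (g t) => p q /=; rewrite mul0r ?subr0 ?addr0.
have -> : \int[mu]_(t in `[a, b]) complex.Re (z * g t) =
    complex.Re z * \int[mu]_(t in `[a, b]) complex.Re (g t) -
    complex.Im z * \int[mu]_(t in `[a, b]) complex.Im (g t).
  rewrite -!RintegralZl//; [|exact: Im_integrable|exact: Re_integrable].
  rewrite -RintegralB//.
  by apply: eq_Rintegral => t _; case: (g t); case: (z).
have -> : \int[mu]_(t in `[a, b]) complex.Im (z * g t) =
    complex.Re z * \int[mu]_(t in `[a, b]) complex.Im (g t) +
    complex.Im z * \int[mu]_(t in `[a, b]) complex.Re (g t).
  rewrite -!RintegralZl//; [|exact: Re_integrable|exact: Im_integrable].
  rewrite -RintegralD//.
  by apply: eq_Rintegral => t _; case: (g t); case: (z).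
by case: (z).
Qed.

Lemma cintB g h a b : rcont g -> rcont h ->
  cint a b (fun t => g t - h t) = cint a b g - cint a b h.
Proof.
move=> gc hc; rewrite -[in RHS]mulN1r -cintZ// -cintD//; last exact: rcontMl.
by congr cint; apply/funext => t; rewrite mulN1r.
Qed.

Lemma Rint_cst a b (k : R) : a <= b -> \int[mu]_(t in `[a, b]) k = k * (b - a).
Proof.
move=> ab; rewrite Rintegral_cst//= lebesgue_measure_itv/= lte_fin.
by move: ab; rewrite le_eqVlt => /predU1P[->|->//]; rewrite ltxx subrr.
Qed.

Lemma cint_cst z a b : a <= b -> cint a b (fun=> z) = z * (b - a)%:C%C.
Proof.
move=> ab; rewrite /cint !Rint_cst//; case: z => p q /=.
by apply/eqP; rewrite eq_complex /= !mulr0 subr0 add0r !eqxx.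
Qed.

(* Rotating the integral onto the positive real axis avoids losing a constant factor. *)
Lemma cint_le g a b M : rcont g -> a <= b -> (forall t, a <= t <= b -> N (g t) <= M) ->
  N (cint a b g) <= M * (b - a).
Proof.
move=> gc ab gM; set I := cint a b g.
have [I0|I0] := eqVneq I 0.
  rewrite I0 cmod0 mulr_ge0 ?subr_ge0//.
  by apply: le_trans (cmod_ge0 (g a)) _; apply: gM; rewrite lexx.
pose k : C := (N I)%:C%C / I.
have Nk : N k = 1.
  by rewrite /k cmodM cmodV cmod_real ger0_norm ?cmod_ge0// divff// cmod_eq0.
have -> : N I = complex.Re (cint a b (fun t => k * g t)).
  by rewrite cintZ// -/I /k divfK.
rewrite -Rint_cst// /cint /=; apply: le_Rintegral => //.
- by apply: Re_integrable; exact: rcontMl.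
- by apply: cont_integrable; exact: cst_continuous.
move=> t; rewrite /= in_itv /= => tab.
apply: le_trans (ler_norm _) _; apply: le_trans (cmod_ge_Re _) _.
by rewrite cmodM Nk mul1r; exact: gM.
Qed.

Lemma cint_conj g a b : rcont g -> cint a b (fun t => (g t)^*%C : C) = (cint a b g)^*%C.
Proof.
move=> gc; rewrite /cint /=.
have -> : \int[lebesgue_measure]_(t in `[a, b]) complex.Re (g t)^*%C =
    \int[lebesgue_measure]_(t in `[a, b]) complex.Re (g t).
  by apply: eq_Rintegral => t _; case: (g t).
have -> : \int[lebesgue_measure]_(t in `[a, b]) complex.Im (g t)^*%C =
    - \int[lebesgue_measure]_(t in `[a, b]) complex.Im (g t).
  rewrite -mulN1r -RintegralZl//; last exact: Im_integrable.
  by apply: eq_Rintegral => t _; rewrite mulN1r; case: (g t).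
by [].
Qed.

End PathIntegral.

Arguments cint : simpl never.
Global Opaque cint.

(** * Goursat's lemma on rectangles *)

Section Goursat.
Variable R : realType.
Local Notation C := (cplx R).
Local Notation N := (@cmod R).
Local Notation i := ('i%C : C).
Variable g : R -> R -> C.
Hypothesis g1 : forall t, rcont (g ^~ t).
Hypothesis g2 : forall s, rcont (g s).

(** With w = s + i t this is the integral of g dw along the boundary of the rectangle, taken
    counterclockwise. *)
Definition rect_int (s1 s2 t1 t2 : R) : C :=
  i * (cint t1 t2 (g s2) - cint t1 t2 (g s1)) -
  (cint s1 s2 (g ^~ t2) - cint s1 s2 (g ^~ t1)).

Arguments rect_int : simpl never.

Definition in_rect (Q : R * R * R * R) (s t : R) :=
  let: (s1, s2, t1, t2) := Q in (s1 <= s <= s2) && (t1 <= t <= t2).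

(** Complex differentiability in w = s + i t relative to the rectangle, hence one-sided on its
    edges. *)
Definition rect_diff (Q : R * R * R * R) (s t : R) := exists d : C, forall e : R, 0 < e ->
  exists2 r : R, 0 < r & forall s' t', in_rect Q s' t' ->
    `|s' - s| <= r -> `|t' - t| <= r ->
    N (g s' t' - g s t - d * ((s' - s)%:C%C + i * (t' - t)%:C%C)) <=
      e * (`|s' - s| + `|t' - t|).

Lemma rect_int_split s1 s s2 t1 t t2 :
  s1 <= s -> s <= s2 -> t1 <= t -> t <= t2 ->
  rect_int s1 s2 t1 t2 = rect_int s1 s t1 t + rect_int s s2 t1 t +
    (rect_int s1 s t t2 + rect_int s s2 t t2).
Proof.
move=> a b c d; rewrite /rect_int.
rewrite (cint_chasles (g2 s2) c d) (cint_chasles (g2 s1) c d).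
rewrite (cint_chasles (g1 t2) a b) (cint_chasles (g1 t1) a b).
by ring.
Qed.

Lemma cmodi : N i = 1.
Proof. by rewrite /cmod /= expr0n /= add0r expr1n sqrtr1. Qed.

(** An affine integrand contributes nothing: the two pairs of opposite sides each yield i d (s2 -
    s1)(t2 - t1), and these cancel. The error over a pair of opposite sides is at most 2 e times
    their length. *)
Lemma rect_int_small s1 s2 t1 t2 (c d : C) e s0 t0 :
  s1 <= s2 -> t1 <= t2 ->
  (forall s t, in_rect (s1, s2, t1, t2) s t ->
    N (g s t - c - d * ((s - s0)%:C%C + i * (t - t0)%:C%C)) <= e) ->
  N (rect_int s1 s2 t1 t2) <= 2 * e * (s2 - s1 + (t2 - t1)).
Proof.
move=> s12 t12 H.
pose r s t := g s t - c - d * ((s - s0)%:C%C + i * (t - t0)%:C%C).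
have E1 : cint t1 t2 (g s2) - cint t1 t2 (g s1) =
    cint t1 t2 (fun t => g s2 t - g s1 t - d * (s2 - s1)%:C%C) +
    d * (s2 - s1)%:C%C * (t2 - t1)%:C%C.
  rewrite cintB; [|exact: rcontB|exact: rcont_cst].
  by rewrite cintB// cint_cst// subrK.
have E2 : cint s1 s2 (g ^~ t2) - cint s1 s2 (g ^~ t1) =
    cint s1 s2 (fun s => g s t2 - g s t1 - d * (i * (t2 - t1)%:C%C)) +
    d * (i * (t2 - t1)%:C%C) * (s2 - s1)%:C%C.
  rewrite cintB; [|exact: (rcontB (g1 t2) (g1 t1))|exact: rcont_cst].
  by rewrite (cintB _ _ (g1 t2) (g1 t1)) cint_cst// subrK.
have -> : rect_int s1 s2 t1 t2 =
    i * cint t1 t2 (fun t => g s2 t - g s1 t - d * (s2 - s1)%:C%C) -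
    cint s1 s2 (fun s => g s t2 - g s t1 - d * (i * (t2 - t1)%:C%C)).
  by rewrite /rect_int E1 E2; ring.
apply: le_trans (cmodB _ _) _; rewrite cmodM cmodi mul1r mulrDr addrC.
apply: lerD.
  apply: cint_le => //; first by apply: rcontB; [exact: (rcontB (g1 t2) (g1 t1))|exact: rcont_cst].
  move=> s ss.
  have -> : g s t2 - g s t1 - d * (i * (t2 - t1)%:C%C) = r s t2 - r s t1.
    by rewrite /r !(rmorphB (real_complex R)) /=; ring.
  apply: le_trans (cmodB _ _) _.
  have := H s t2; have := H s t1; rewrite /= ss !lexx t12 /r => /(_ isT) A /(_ isT) B.
  by move: A B; lra.
apply: cint_le => //; first by apply: rcontB; [exact: rcontB|exact: rcont_cst].
move=> t tt.
have -> : g s2 t - g s1 t - d * (s2 - s1)%:C%C = r s2 t - r s1 t.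
  by rewrite /r !(rmorphB (real_complex R)) /=; ring.
apply: le_trans (cmodB _ _) _.
have := H s2 t; have := H s1 t; rewrite /= tt !lexx s12 /r => /(_ isT) A /(_ isT) B.
by move: A B; lra.
Qed.

Local Definition wd (Q : R * R * R * R) := let: (s1, s2, t1, t2) := Q in s2 - s1 + (t2 - t1).
Local Definition ri (Q : R * R * R * R) := let: (s1, s2, t1, t2) := Q in rect_int s1 s2 t1 t2.
Local Definition rok (Q : R * R * R * R) := let: (s1, s2, t1, t2) := Q in (s1 <= s2) && (t1 <= t2).

(** If all four quarters satisfied the bound e (w/2)^2, their sum would satisfy e w^2. *)
Lemma quarter_rect e Q : rok Q -> e * wd Q ^+ 2 < N (ri Q) ->
  exists Q', [/\ rok Q', forall s t, in_rect Q' s t -> in_rect Q s t,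
    wd Q' = wd Q / 2 & e * wd Q' ^+ 2 < N (ri Q')].
Proof.
case: Q => [[[s1 s2] t1] t2] /=; move=> /andP[s12 t12] H.
pose s := (s1 + s2) / 2; pose t := (t1 + t2) / 2.
have s1s : s1 <= s by rewrite /s; lra.
have ss2 : s <= s2 by rewrite /s; lra.
have t1t : t1 <= t by rewrite /t; lra.
have tt2 : t <= t2 by rewrite /t; lra.
apply: contrapT => /forallNP K.
move: H; rewrite (rect_int_split s1s ss2 t1t tt2) ltNge => /negP; apply.
set w := s2 - s1 + (t2 - t1).
have B Q : rok Q -> (forall a b, in_rect Q a b -> in_rect (s1, s2, t1, t2) a b) ->
    wd Q = w / 2 -> N (ri Q) <= e * (w / 2) ^+ 2.
  by move=> Q1 Q2 Q3; rewrite leNgt; apply/negP => Q4; apply: (K Q); split=> //; rewrite ?Q3.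
have /= A1 := B (s1, s, t1, t); have /= A2 := B (s, s2, t1, t).
have /= A3 := B (s1, s, t, t2); have /= A4 := B (s, s2, t, t2).
have {}A1 : N (rect_int s1 s t1 t) <= e * (w / 2) ^+ 2.
  apply: A1; first by rewrite s1s t1t.
    by move=> a b; lra.
  by rewrite /w /s /t; lra.
have {}A2 : N (rect_int s s2 t1 t) <= e * (w / 2) ^+ 2.
  apply: A2; first by rewrite ss2 t1t.
    by move=> a b; lra.
  by rewrite /w /s /t; lra.
have {}A3 : N (rect_int s1 s t t2) <= e * (w / 2) ^+ 2.
  apply: A3; first by rewrite s1s tt2.
    by move=> a b; lra.
  by rewrite /w /s /t; lra.
have {}A4 : N (rect_int s s2 t t2) <= e * (w / 2) ^+ 2.
  apply: A4; first by rewrite ss2 tt2.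
    by move=> a b; lra.
  by rewrite /w /s /t; lra.
have -> : e * w ^+ 2 = e * (w / 2) ^+ 2 *+ 4 by field.
apply: le_trans (cmodD _ _) _.
have := cmodD (rect_int s1 s t1 t) (rect_int s s2 t1 t).
have := cmodD (rect_int s1 s t t2) (rect_int s s2 t t2).
lra.
Qed.

Lemma goursat s1 s2 t1 t2 : s1 <= s2 -> t1 <= t2 ->
  (forall s t, in_rect (s1, s2, t1, t2) s t -> rect_diff (s1, s2, t1, t2) s t) ->
  rect_int s1 s2 t1 t2 = 0.
Proof.
move=> s12 t12 gd; set Q0 := (s1, s2, t1, t2).
apply/eqP; rewrite -cmod_eq0 eq_le cmod_ge0 andbT; apply/ler_addgt0Pr => e' e'0.
rewrite add0r leNgt; apply/negP => He'.
have [e e0 He] : exists2 e, 0 < e & e * wd Q0 ^+ 2 < N (ri Q0).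
  have w0 : 0 < 1 + wd Q0 ^+ 2 by rewrite ltr_pwDl// sqr_ge0.
  exists (e' / (1 + wd Q0 ^+ 2)); first by rewrite divr_gt0.
  apply: le_lt_trans He'; rewrite mulrAC ler_pdivrMr// ler_pM2l//; lra.
have step (Q : {Q | rok Q /\ e * wd Q ^+ 2 < N (ri Q)}) :
    exists Q' : {Q | rok Q /\ e * wd Q ^+ 2 < N (ri Q)},
    (forall s t, in_rect (sval Q') s t -> in_rect (sval Q) s t) /\
    wd (sval Q') = wd (sval Q) / 2.
  case: Q => Q [Q1 Q2] /=; have [Q' [A B D E]] := quarter_rect Q1 Q2.
  by exists (exist _ Q' (conj A E)).
have [F FE] := choice step.
have Q0ok : rok Q0 /\ e * wd Q0 ^+ 2 < N (ri Q0) by split=> //; rewrite /= s12 t12.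
pose q n := iter n F (exist _ Q0 Q0ok).
have q_sub m n s t : (m <= n)%N -> in_rect (sval (q n)) s t -> in_rect (sval (q m)) s t.
  move=> mn; rewrite -(subnK mn); elim: (n - m)%N => [//|k IH] h; apply: IH.
  by apply: (FE _).1; exact: h.
have q_wd n : wd (sval (q n)) = wd Q0 / 2 ^+ n.
  elim: n => [|n IH]; first by rewrite expr0 divr1.
  by rewrite /q iterS (FE _).2 -/(q n) IH exprS; field; rewrite expf_neq0.
pose s_ n := let: (a, _, _, _) := sval (q n) in a.
pose t_ n := let: (_, _, a, _) := sval (q n) in a.
have q_in n : in_rect (sval (q n)) (s_ n) (t_ n).
  rewrite /s_ /t_; case: (q n) => [[[[a b] c] d] [/= /andP[ab cd] _]] /=.
  by rewrite !lexx ab cd.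
pose u n : C := ((s_ n) +i* (t_ n))%C.
(* The point common to all nested rectangles is the ultralimit of their lower left corners. *)
have [s [t [st_ sQ]]] : exists s t, (forall e, 0 < e -> \forall n \near ultra,
     `|s_ n - s| <= e /\ `|t_ n - t| <= e) /\ forall n, in_rect (sval (q n)) s t.
  have S0 n : `|s_ n| <= `|s1| + `|s2|.
    have := q_sub _ _ _ _ (leq0n n) (q_in n); rewrite /= => /andP[/andP[A B] _].
    rewrite ler_norml; have := ler_norm s2; have := ler_norm (- s1); rewrite normrN.
    by have := normr_ge0 s1; have := normr_ge0 s2; move=> *; apply/andP; split; lra.
  have T0 n : `|t_ n| <= `|t1| + `|t2|.
    have := q_sub _ _ _ _ (leq0n n) (q_in n); rewrite /= => /andP[_ /andP[A B]].
    rewrite ler_norml; have := ler_norm t2; have := ler_norm (- t1); rewrite normrN.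
    by have := normr_ge0 t1; have := normr_ge0 t2; move=> *; apply/andP; split; lra.
  have [s sE] := real_ulim (nearW _ S0); have [t tE] := real_ulim (nearW _ T0).
  exists s, t; split=> [d d0|n]; first by apply: filterS2 (sE _ d0) (tE _ d0).
  case E : (sval (q n)) => [[[a b] c] d] /=.
  have L d' : 0 < d' -> exists m, [/\ in_rect (a, b, c, d) (s_ m) (t_ m),
      `|s_ m - s| <= d' & `|t_ m - t| <= d'].
    move=> d'0; have [m nm [A B]] := ultra_ex n (filterI (sE _ d'0) (tE _ d'0)).
    by exists m; split => //; rewrite -E; apply: q_sub nm _.
  have L' (p1 p2 : R) : (forall d', 0 < d' -> p1 <= p2 + d') -> p1 <= p2.
    by move=> h; apply/ler_addgt0Pr.
  apply/andP; split; apply/andP; split; apply: (L') => d' d'0;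
  have [m [/= /andP[/andP[A B] /andP[A' B']]]] := L _ d'0;
  rewrite !ler_norml => /andP[? ?] /andP[? ?]; lra.
have [d dE] := gd s t (sQ 0).
(* Half of e compensates the factor 2 of [rect_int_small]; the linear error on the n-th rectangle is
   at most e/2 times its [wd]. *)
have [r r0 rE] := dE (e / 2) (divr_gt0 e0 (ltr0n _ 2)).
have [n nr] : exists n, wd Q0 / 2 ^+ n <= r.
  have w0 : 0 <= wd Q0 by rewrite /= addr_ge0// subr_ge0.
  exists (Num.bound (wd Q0 / r)).
  rewrite ler_pdivrMr ?exprn_gt0// mulrC -ler_pdivrMr//.
  have h := archi_boundP (divr_ge0 w0 (ltW r0)).
  apply/ltW; apply: lt_trans h _.
  by rewrite -natrX ltr_nat; exact: ltn_expl.
have := (svalP (q n)).2; have := (svalP (q n)).1; have := sQ n; have := q_sub 0 n.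
have := q_wd n; case E: (sval (q n)) => [[[a b] c] d'] /=.
move=> wE qs /andP[/andP[A1 A2] /andP[B1 B2]] /andP[ab cd].
rewrite -wE /= in nr.
rewrite ltNge => /negP; apply.
have -> : e * (b - a + (d' - c)) ^+ 2 = 2 * (e / 2 * (b - a + (d' - c))) * (b - a + (d' - c)) by field.
apply: (rect_int_small (c := g s t) (d := d) (s0 := s) (t0 := t)) => // s' t' st'.
have st'0 := qs s' t' (leq0n _) st'.
move: st' => /= /andP[/andP[C1 C2] /andP[D1 D2]].
have X1 : `|s' - s| <= b - a by rewrite ler_norml; apply/andP; split; lra.
have X2 : `|t' - t| <= d' - c by rewrite ler_norml; apply/andP; split; lra.
apply: le_trans (rE _ _ st'0 _ _) _; [lra|lra|].
apply: ler_wpM2l; lra.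
Qed.

End Goursat.

Arguments polar : simpl never.

(** * Logarithmic polar coordinates *)

Section Polar.
Variable R : realType.
Local Notation C := (cplx R).
Local Notation N := (@cmod R).
Local Notation i := ('i%C : C).
Implicit Types (z w d : C) (s t r e : R).

Lemma polarE r t : polar r t = r%:C%C * ((cos t)%:C%C + i * (sin t)%:C%C).
Proof.
by rewrite /polar; apply/eqP; rewrite eq_complex /= !(mul0r, mulr0, mul1r, subr0, addr0, add0r) !eqxx.
Qed.

Lemma polarM r r' t t' : polar r t * polar r' t' = polar (r * r') (t + t').
Proof.
rewrite /polar cosD sinD; apply/eqP; rewrite eq_complex /=.
by apply/andP; split; apply/eqP; ring.
Qed.

Lemma cmod_polar r t : N (polar r t) = `|r|.
Proof.
rewrite /cmod /polar /= !exprMn -mulrDr cos2Dsin2 mulr1; exact: sqrtr_sqr.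
Qed.

Lemma polarB r r' t : N (polar r t - polar r' t) = `|r - r'|.
Proof.
by rewrite -(cmod_polar _ t); congr N; rewrite !polarE rmorphB /= mulrBl.
Qed.

Lemma polar0 t : polar 0 t = 0.
Proof. by rewrite polarE mul0r. Qed.

Lemma polar_2pi r : polar r (2 * pi) = polar r 0.
Proof. by rewrite /polar mulr_natl cos2pi sin2pi cos0 sin0. Qed.

Lemma polarr0 r : polar r 0 = r%:C%C.
Proof. by rewrite polarE cos0 sin0 mulr0 addr0 mulr1. Qed.

Lemma real_cont_eps (f : R -> R) (x : R) : {for x, continuous f} ->
  forall e, 0 < e -> exists2 r, 0 < r & forall y, `|y - x| < r -> `|f y - f x| <= e.
Proof.
move=> /cvgrPdist_le fx e /fx/nbhs_ballP[r /= r0 rf]; exists r => // y yx.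
by rewrite distrC; apply: rf; rewrite /ball /= distrC.
Qed.

Lemma rcont_polar r : rcont (polar r).
Proof.
move=> t e e0.
have e1 : 0 < e / 2 / (1 + `|r|) by rewrite !divr_gt0// ltr_pwDl.
have [p p0 pE] := real_cont_eps (@continuous_cos R t) e1.
have [q q0 qE] := real_cont_eps (@continuous_sin R t) e1.
exists (Num.min p q); first by rewrite lt_min p0.
move=> s; rewrite lt_min => /andP[/pE A /qE B].
have -> : polar r s - polar r t =
    r%:C%C * ((cos s - cos t)%:C%C + i * (sin s - sin t)%:C%C).
  by rewrite !polarE !(rmorphB (real_complex R)) /=; ring.
rewrite cmodM cmod_real.
have H := cmodD (cos s - cos t)%:C%C (i * (sin s - sin t)%:C%C).
rewrite cmodM cmodi mul1r !cmod_real in H.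
have {}H : N ((cos s - cos t)%:C%C + i * (sin s - sin t)%:C%C) <= e / (1 + `|r|).
  apply: le_trans H _; have -> : e / (1 + `|r|) = e / 2 / (1 + `|r|) + e / 2 / (1 + `|r|).
    by field; rewrite gt_eqF// ltr_pwDl.
  exact: lerD.
have -> : e = (1 + `|r|) * (e / (1 + `|r|)) by field; rewrite gt_eqF// ltr_pwDl.
by apply: ler_pM; rewrite ?cmod_ge0// lerDr.
Qed.

Lemma rcont_polar_comp (f : C -> C) r t : (forall z, N z <= r -> ccont f z) -> 0 <= t -> t <= r ->
  rcont (fun s => f (polar t s)).
Proof.
move=> fc t0 tr; apply: rcont_comp; last exact: rcont_polar.
by move=> s; apply: fc; rewrite cmod_polar ger0_norm.
Qed.

Lemma real_diff_eps (f : R -> R) (x d : R) : is_derive x 1 f d ->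
  forall e, 0 < e -> exists2 r, 0 < r & forall h, `|h| < r -> `|f (x + h) - f x - d * h| <= e * `|h|.
Proof.
move=> [/cvg_ex[l /= fl] ld] e e0; have {}ld : l = d.
  by rewrite -ld; apply/esym/cvg_lim; [exact: norm_hausdorff|exact: fl].
move: fl; rewrite {}ld => /cvgrPdist_le /(_ _ e0) /nbhs_ballP[r /= r0 rf].
exists r => // h hr; have [->|h0] := eqVneq h 0.
  by rewrite addr0 subrr mulr0 subrr normr0 mulr0.
have := rf h; rewrite /ball /= sub0r normrN => /(_ hr h0).
rewrite distrC -(ler_pM2r (_ : 0 < `|h|)) ?normr_gt0// -normrM.
by rewrite [h%:A]mulr1 [_ *: _]mulrC mulrBl divfK// [h + x]addrC.
Qed.

(** [polar (expR h) k] is the exponential of h + i k; this says that its complex derivative at 0 is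
    1, and comes from the derivatives of exp, cos and sin at 0. *)
Lemma polar_diff0 e : 0 < e -> exists2 r, 0 < r & forall h k, `|h| < r -> `|k| < r ->
  N (polar (expR h) k - 1 - (h%:C%C + i * k%:C%C)) <= e * (`|h| + `|k|).
Proof.
move=> e0; have [e1 [e1_0 e18 e11]] : exists e1, [/\ 0 < e1, e1 <= e / 8 & e1 <= 1].
  exists (Num.min (e / 8) 1); rewrite lt_min divr_gt0//=.
  by split => //; rewrite ge_min lexx ?orbT.
have [p p0 pE] := real_diff_eps (@is_derive_expR R 0) e1_0.
have [q q0 qE] := real_diff_eps (@is_derive_cos R 0) e1_0.
have [u u0 uE] := real_diff_eps (@is_derive_sin R 0) e1_0.
exists (Num.min p (Num.min (Num.min q u) e1)); first by rewrite !lt_min p0 q0 u0 e1_0.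
move=> h k; rewrite !lt_min => /and3P[hp _ he] /and3P[kp /andP[kq ku] ke].
have {pE} := pE h hp; rewrite add0r expR0 mul1r => A.
have {qE} := qE k kq; rewrite add0r cos0 sin0 oppr0 mul0r subr0 => B.
have {uE} := uE k ku; rewrite add0r cos0 sin0 mul1r subr0 => D.
have -> : polar (expR h) k - 1 - (h%:C%C + i * k%:C%C) =
   (expR h - 1 - h)%:C%C + (expR h)%:C%C * ((cos k - 1)%:C%C + i * (sin k - k)%:C%C) +
   (expR h - 1)%:C%C * (i * k%:C%C).
  by rewrite polarE !(rmorphB (real_complex R)) /= rmorph1; ring.
apply: le_trans (cmodD _ _) _; apply: le_trans (lerD (cmodD _ _) (lexx _)) _.
rewrite !cmodM cmodi mul1r !cmod_real.
have H := cmodD ((cos k - 1)%:C%C) (i * (sin k - k)%:C%C).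
rewrite cmodM cmodi mul1r !cmod_real in H.
have h0 := normr_ge0 h; have k0 := normr_ge0 k.
have A' : e1 * `|h| <= `|h| by rewrite ler_piMl.
have E1 : `|expR h - 1| <= 2 * `|h|.
  have -> : expR h - 1 = (expR h - 1 - h) + h by ring.
  by apply: le_trans (ler_normD _ _) _; lra.
have E2 : `|expR h| <= 3.
  have -> : expR h = (expR h - 1) + 1 by ring.
  apply: le_trans (ler_normD _ _) _; rewrite normr1; lra.
have F1 : `|expR h| * N ((cos k - 1)%:C%C + i * (sin k - k)%:C%C) <= 3 * (2 * e1 * `|k|).
  by apply: ler_pM => //; [exact: cmod_ge0|lra].
have F2 : `|expR h - 1| * `|k| <= 2 * e1 * `|k|.
  apply: ler_wpM2r => //; lra.
have G : e1 * `|k| <= e / 8 * `|k| by exact: ler_wpM2r.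
have G' : e1 * `|h| <= e / 8 * `|h| by exact: ler_wpM2r.
have G2 : 0 <= e * `|h| by rewrite mulr_ge0// ltW.
lra.
Qed.

(** The chain rule for phi composed with the exponential of s + i t. Multiplicativity of [polar]
    brings the derivative of the exponential back to the origin. *)
Lemma polar_chain (phi : C -> C) s t d : cdiff phi (polar (expR s) t) d ->
  forall e, 0 < e -> exists2 r, 0 < r & forall s' t', `|s' - s| <= r -> `|t' - t| <= r ->
    N (phi (polar (expR s') t') - phi (polar (expR s) t) -
       d * polar (expR s) t * ((s' - s)%:C%C + i * (t' - t)%:C%C)) <=
      e * (`|s' - s| + `|t' - t|).
Proof.
move=> pd e e0; set z0 := polar (expR s) t.
have Nz0 : 0 < N z0 by rewrite cmod_polar normr_gt0 gt_eqF// expR_gt0.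
pose e1 := e / 2 / (2 * N z0); have e1_0 : 0 < e1 by rewrite !divr_gt0// mulr_gt0.
have D0 : 0 < 1 + N d by rewrite ltr_pwDl// cmod_ge0.
have [e2 [e2_0 e2_1 e2_2]] : exists e2, [/\ 0 < e2, e2 <= 1 & e2 <= e / 2 / ((1 + N d) * N z0)].
  exists (Num.min 1 (e / 2 / ((1 + N d) * N z0))).
  rewrite lt_min ltr01/= !divr_gt0 ?mulr_gt0//.
  by split => //; rewrite ge_min lexx ?orbT.
have [p p0 pE] := pd _ e1_0; have [q q0 qE] := polar_diff0 e2_0.
exists (Num.min (q / 2) (p / (8 * N z0))).
  by rewrite lt_min !divr_gt0// mulr_gt0.
move=> s' t'; rewrite !le_min => /andP[sq sp] /andP[tq tp].
set w := polar (expR s') t'; set h := (s' - s)%:C%C + _.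
have h_ge0 := normr_ge0 (s' - s); have k_ge0 := normr_ge0 (t' - t).
have wE : w = z0 * polar (expR (s' - s)) (t' - t).
  by rewrite polarM -expRD /w; congr polar; [congr expR|]; ring.
have Eh : N (polar (expR (s' - s)) (t' - t) - 1 - h) <= e2 * (`|s' - s| + `|t' - t|).
  by apply: qE; lra.
have Nh : N h <= `|s' - s| + `|t' - t|.
  by apply: le_trans (cmodD _ _) _; rewrite cmodM cmodi mul1r !cmod_real.
have wz : w - z0 = z0 * h + z0 * (polar (expR (s' - s)) (t' - t) - 1 - h).
  by rewrite wE; ring.
have Nwz : N (w - z0) <= 2 * N z0 * (`|s' - s| + `|t' - t|).
  rewrite wz -mulrDr cmodM -mulrA mulrCA; apply: ler_wpM2l; first exact: cmod_ge0.
  apply: le_trans (cmodD _ _) _.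
  have : e2 * (`|s' - s| + `|t' - t|) <= `|s' - s| + `|t' - t|.
    by rewrite ler_piMl// addr_ge0.
  lra.
have -> : phi w - phi z0 - d * z0 * h = (phi w - phi z0 - d * (w - z0)) +
    d * (z0 * (polar (expR (s' - s)) (t' - t) - 1 - h)).
  by rewrite wz; ring.
have wzp : N (w - z0) < p.
  apply: le_lt_trans Nwz _.
  have X : `|s' - s| + `|t' - t| <= p / (4 * N z0).
    have -> : p / (4 * N z0) = p / (8 * N z0) + p / (8 * N z0) by field; rewrite gt_eqF.
    exact: lerD.
  apply: le_lt_trans (ler_wpM2l _ X) _; first by rewrite mulr_ge0// ltW.
  have -> : 2 * N z0 * (p / (4 * N z0)) = p / 2 by field; rewrite gt_eqF.
  by rewrite ltr_pdivrMr// ltr_pMr// ltr1n.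
apply: le_trans (cmodD _ _) _.
have A := pE _ wzp.
have B : e1 * N (w - z0) <= e / 2 * (`|s' - s| + `|t' - t|).
  apply: le_trans (ler_wpM2l (ltW e1_0) Nwz) _.
  by rewrite le_eqVlt; apply/orP; left; apply/eqP; rewrite /e1; field; rewrite gt_eqF.
have D : N (d * (z0 * (polar (expR (s' - s)) (t' - t) - 1 - h))) <=
    e / 2 * (`|s' - s| + `|t' - t|).
  rewrite !cmodM mulrA.
  have Y : N d * N z0 * e2 <= e / 2.
    apply: (@le_trans _ _ ((1 + N d) * N z0 * (e / 2 / ((1 + N d) * N z0)))).
      apply: ler_pM => //; [by rewrite mulr_ge0 ?cmod_ge0|exact: ltW|].
      by apply: ler_wpM2r; [exact: cmod_ge0|rewrite lerDr].
    by rewrite mulrC divfK// gt_eqF// mulr_gt0.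
  apply: (@le_trans _ _ (N d * N z0 * (e2 * (`|s' - s| + `|t' - t|)))).
    by apply: ler_wpM2l => //; rewrite mulr_ge0 ?cmod_ge0.
  by rewrite mulrA ler_wpM2r// addr_ge0.
apply: le_trans (lerD A (lexx _)) _; apply: le_trans (lerD B D) _.
by rewrite -mulrDl -splitr.
Qed.

End Polar.

Global Opaque polar cmod.

Section Reflection.
Variable R : realType.
Local Notation C := (cplx R).
Local Notation N := (@cmod R).

(** On |z| = r the conjugate of z is r^2 / z, so with c the conjugate of a divided by r, r - c z
    equals z/r times the conjugate of z - a. In [jensen] this replaces a factor vanishing at a by
    one of value r at the origin. *)
Lemma circle_reflection (a : C) (r : R) : 0 < r -> exists c : C,
  forall z, N z = r -> N (polar r 0 - c * z) = N (z - a).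
Proof.
move=> r0; exists ((a^*%C : C) / r%:C%C) => z zr.
have rC : (r%:C%C : C) != 0 by rewrite -cmod_eq0 cmod_real gtr0_norm// gt_eqF.
have zz := mulcJ z.
have zJ : N (((z - a)^*%C : C)) = N (z - a) by have := normcJ (z - a) => -[].
have jB : ((z - a)^*%C : C) = (z^*%C : C) - (a^*%C : C) by rewrite rmorphB.
have E : polar r 0 - (a^*%C : C) / r%:C%C * z = z * ((z - a)^*%C : C) / r%:C%C.
  rewrite polarr0 jB mulrBr zz zr rmorphXn /=.
  move: (r%:C%C : C) (a^*%C : C) rC => x y x0.
  by field.
rewrite E !cmodM cmodV zJ zr cmod_real gtr0_norm// mulrAC mulfV ?mul1r// gt_eqF//.
Qed.

End Reflection.

(** * The mean value property, with an exceptional circle *)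

Section MeanValue.
Variable R : realType.
Local Notation C := (cplx R).
Local Notation N := (@cmod R).
Local Notation i := ('i%C : C).
Local Notation tau := (2 * pi : R).
Variables (phi : C -> C) (r alpha : R).
Hypothesis r0 : 0 < r.
Hypothesis phic : forall z, N z <= r -> ccont phi z.
(** On the circle of radius [alpha] only continuity is assumed. This serves [cauchy_formula], where
    phi is z times a divided difference at a and alpha = |a|. The origin is left out because
    logarithmic coordinates never reach it. *)
Hypothesis phid : forall z, 0 < N z -> N z <= r -> N z != alpha -> exists d, cdiff phi z d.

Let J rho := cint 0 tau (fun t => phi (polar rho t)).

Lemma tau_gt0 : 0 < tau.
Proof. by rewrite mulr_gt0// pi_gt0. Qed.

Lemma min_lip (a b c : R) : `|Num.min a c - Num.min b c| <= `|a - b|.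
Proof.
have := ler_norm (a - b); have := ler_norm (b - a); rewrite distrC ler_norml.
by case: (leP a c) => ?; case: (leP b c) => ? ? ?; lra.
Qed.

(** Goursat's lemma for phi composed with the exponential, on [ln rho1, ln rho2] x [0, 2 pi]: the
    sides t = 0 and t = 2 pi cancel by periodicity, and the other two are the circle means. *)
Lemma mean_const rho1 rho2 : 0 < rho1 -> rho1 <= rho2 -> rho2 <= r ->
  ~~ (rho1 <= alpha <= rho2) -> J rho1 = J rho2.
Proof.
move=> a0 ab br nal.
pose s1 := ln rho1; pose s2 := ln rho2; have b0 : 0 < rho2 by exact: lt_le_trans ab.
have s12 : s1 <= s2 by rewrite ler_ln ?posrE.
have e1 : expR s1 = rho1 by rewrite lnK.
have e2 : expR s2 = rho2 by rewrite lnK.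
(* [goursat] asks for continuity in each variable along whole lines, so the radius is capped at r.
   The cap is inactive on the rectangle itself, where differentiability is taken relative to it. *)
pose g s t := phi (polar (Num.min (expR s) r) t).
have minr s : 0 <= Num.min (expR s) r by rewrite le_min expR_ge0 ltW.
have g2 s : rcont (g s) by apply: (rcont_polar_comp phic) => //; rewrite ge_min lexx orbT.
have g1 t : rcont (g ^~ t).
  apply: (@rcont_comp _ phi (fun s => polar (Num.min (expR s) r) t)).
    by move=> s; apply: phic; rewrite cmod_polar ger0_norm// ge_min lexx orbT.
  move=> s e /(real_cont_eps (@continuous_expR R s))[p p0 pE]; exists p => // s' /pE.
  by rewrite polarB; apply: le_trans; exact: min_lip.
have gE s : s <= s2 -> Num.min (expR s) r = expR s.
  move=> ss2; apply/min_idPl; apply: le_trans br.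
  by rewrite -e2 ler_expR.
have H : forall s t, in_rect (s1, s2, 0, tau) s t -> rect_diff g (s1, s2, 0, tau) s t.
  move=> s t /andP[/andP[A B] _].
  have : exists d, cdiff phi (polar (expR s) t) d.
    have N1 : N (polar (expR s) t) = expR s by rewrite cmod_polar ger0_norm// expR_ge0.
    apply: phid; rewrite N1 ?expR_gt0//.
      by apply: le_trans br; rewrite -e2 ler_expR.
    apply: contraNneq nal => <-; rewrite -{1}e1 -{1}e2 !ler_expR; exact/andP.
  move=> [d /polar_chain dE]; exists (d * polar (expR s) t) => e /dE[p p0 pE].
  exists p => // s' t' /andP[/andP[_ B'] _] hs ht; rewrite /g !gE//.
  exact: pE.
have JE s : s <= s2 -> J (expR s) = cint 0 tau (g s).
  by move=> ss; congr cint; apply/funext => t; rewrite /g gE.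
have H0 := goursat g1 g2 s12 (ltW tau_gt0) H; move: H0; rewrite /rect_int.
have <- : g ^~ 0 = g ^~ tau by apply/funext => s; rewrite /g polar_2pi.
have cancel_i (a b c : C) : i * (a - b) - (c - c) = 0 -> b = a.
  move=> /eqP; rewrite subrr subr0 mulf_eq0 -cmod_eq0 cmodi oner_eq0 /= subr_eq0.
  by move=> /eqP.
move=> /cancel_i; rewrite -(JE s1 s12) -(JE s2 (lexx _)) e1 e2.
exact.
Qed.

Lemma mean_unif_cont e : 0 < e -> exists2 del, 0 < del &
  forall a b, 0 <= a <= r -> 0 <= b <= r -> `|a - b| <= del -> N (J a - J b) <= e.
Proof.
move=> e0.
have [del del0 dE] : exists2 s, 0 < s & forall z w, N (z - 0) <= r -> N (w - 0) <= r ->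
   N (z - w) <= s -> N (phi z - phi w) <= e / tau.
  apply: (@disc_unif_cont _ phi 0 r); first by move=> z; rewrite subr0; exact: phic.
  by rewrite divr_gt0// tau_gt0.
exists del => // a b /andP[a0 ar] /andP[b0 br] ab.
rewrite /J -cintB; [|exact: (rcont_polar_comp phic)|exact: (rcont_polar_comp phic)].
have -> : e = e / tau * (tau - 0) by rewrite subr0 divfK// gt_eqF// tau_gt0.
apply: cint_le => //.
- by apply: rcontB; exact: (rcont_polar_comp phic).
- exact: ltW tau_gt0.
- by move=> t _; apply: dE; rewrite ?polarB// subr0 cmod_polar ger0_norm.
Qed.

(** The circle mean is constant on each side of the radius alpha; by uniform continuity, crossing
    alpha and passing from a small circle to the origin cost at most e/2 each. *)
Lemma mean_value : cint 0 tau (fun t => phi (polar r t)) = phi 0 * (tau)%:C%C.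
Proof.
have J0 : J 0 = phi 0 * tau%:C%C.
  rewrite -(subr0 tau) -cint_cst ?subr0; last exact: ltW tau_gt0.
  by congr cint; apply/funext => t; rewrite polar0.
rewrite -J0 -/(J r); apply/eqP; rewrite -subr_eq0 -cmod_eq0 eq_le cmod_ge0 andbT.
apply/ler_addgt0Pr => e e0; rewrite add0r.
have [del del0 dE] := mean_unif_cont (divr_gt0 e0 (ltr0n _ 2)).
have [al|al] := boolP ((0 < alpha) && (alpha <= r)); last first.
  pose rho := Num.min del r.
  have rho0 : 0 < rho by rewrite lt_min del0.
  have rhor : rho <= r by rewrite ge_min lexx orbT.
  have -> : J r = J rho.
    apply/esym/mean_const => //; apply: contra al => /andP[h ->]; rewrite andbT.
    exact: lt_le_trans h.
  have : N (J rho - J 0) <= e / 2.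
    apply: dE; rewrite ?lexx ?(ltW rho0) ?(ltW r0)//.
    by rewrite subr0 ger0_norm ?(ltW rho0)// ge_min lexx.
  lra.
move: al => /andP[al0 alr].
have [rho [rho0 rhod rhoa]] : exists rho, [/\ 0 < rho, rho <= del & rho < alpha].
  exists (Num.min del (alpha / 2)); rewrite lt_min del0 divr_gt0//; split => //.
    by rewrite ge_min lexx.
  by rewrite gt_min; apply/orP; right; lra.
have [lo [lo1 lo2 lo3]] : exists lo, [/\ rho <= lo, lo < alpha & alpha - del / 2 <= lo].
  exists (Num.max rho (alpha - del / 2)); split; rewrite ?le_max ?lexx ?orbT//.
  by rewrite gt_max rhoa /=; lra.
have [hi [hi1 hi2 hi3 hi4]] : exists hi, [/\ alpha <= hi, hi <= alpha + del / 2, hi <= r &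
    (hi == r) || (alpha < hi)].
  have [h|h] := leP r (alpha + del / 2); first by exists r; split; rewrite ?eqxx.
  by exists (alpha + del / 2); split; rewrite ?(ltW h)//; [lra|apply/orP; right; lra].
have -> : J r = J hi.
  case/orP: hi4 => [/eqP ->//|h].
  apply/esym/mean_const => //; first exact: lt_le_trans al0 hi1.
  by rewrite negb_and -ltNge h.
have E2 : J lo = J rho.
  apply/esym/mean_const => //; first by lra.
  by rewrite negb_and -!ltNge lo2 orbT.
have A : N (J hi - J lo) <= e / 2.
  apply: dE; [lra|lra|rewrite ger0_norm; lra].
have B : N (J lo - J 0) <= e / 2.
  rewrite E2; apply: dE; [lra|lra|rewrite ger0_norm; lra].
have := cmodB_tri (J lo) (J hi) (J 0); lra.
Qed.

End MeanValue.

Definition hol_disc (R : realType) (f : cplx R -> cplx R) (a : cplx R) (r : R) :=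
  forall z, cmod (z - a) <= r -> exists d, cdiff f z d.

Section Cauchy.
Variable R : realType.
Local Notation C := (cplx R).
Local Notation N := (@cmod R).
Local Notation tau := (2 * pi : R).
Implicit Types (f : C -> C) (z w a : C) (r M : R).

Lemma hol_disc_cdiff f a r z : hol_disc f a r -> N (z - a) <= r -> cdiff f z (cder f z).
Proof. by move=> fh /fh[d fd]; rewrite (cdiff_cder fd). Qed.

(** On |z| = r the kernel z / (z - a) is the conjugate of r^2 / (r^2 - conj(a) z), which is
    differentiable on the disc and equals 1 at the origin. *)
Lemma cint_kernel a r : N a < r ->
  cint 0 tau (fun t => polar r t / (polar r t - a)) = tau%:C%C.
Proof.
move=> ar; have r0 : 0 < r by apply: le_lt_trans ar; exact: cmod_ge0.
pose p z : C := (r ^+ 2)%:C%C / ((r ^+ 2)%:C%C - (a^*%C : C) * z).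
have den z : N z <= r -> (r ^+ 2)%:C%C - (a^*%C : C) * z != 0.
  move=> zr; rewrite subr_eq0; apply/eqP => h.
  have : N ((r ^+ 2)%:C%C) <= N a * r.
    rewrite h cmodM; have -> : N (a^*%C) = N a.
      by have := normcJ a => -[].
    by apply: ler_wpM2l => //; exact: cmod_ge0.
  rewrite cmod_real ger0_norm ?sqr_ge0// expr2 ler_pM2r//; lra.
have pd z : N z <= r -> exists d, cdiff p z d.
  move=> /den dz; eexists; apply: cdiffM; first exact: cdiff_cst.
  apply: cdiffV => //; apply: cdiffB; first exact: cdiff_cst.
  by apply: cdiffM; [exact: cdiff_cst|exact: cdiff_id].
have pc z : N z <= r -> ccont p z by move=> /pd[d]; exact: cdiff_cont.
have := @mean_value R p r 0 r0 pc (fun z _ zr _ => pd z zr).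
have -> : p 0 = 1.
  by rewrite /p mulr0 subr0 divff//; have := den 0; rewrite mulr0 subr0 cmod0; apply; exact: ltW.
rewrite mul1r => pE.
have E : (fun t => polar r t / (polar r t - a)) = (fun t => (p (polar r t))^*%C : C).
  apply/funext => t; set z := polar r t.
  have Nz : N z = r by rewrite cmod_polar gtr0_norm.
  have za : z - a != 0 by rewrite subr_eq0; apply: contraTneq ar => <-; rewrite Nz ltxx.
  have z0 : z != 0 by rewrite -cmod_gt0 Nz.
  have zz := mulcJ z; rewrite Nz in zz.
  have cM (x y : C) : (x * y)^*%C = x^*%C * y^*%C :> C by rewrite rmorphM.
  have cB (x y : C) : (x - y)^*%C = x^*%C - y^*%C :> C by rewrite rmorphB.
  rewrite /p cM conjc_inv cB cM conjcK conjc_real -zz.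
  rewrite (_ : z * (z^*%C : C) - a * (z^*%C : C) = (z - a) * (z^*%C : C)); last by ring.
  have zj : (z^*%C : C) != 0 by rewrite conjc_eq0.
  by field; rewrite zj za.
rewrite E cint_conj; last exact: (rcont_polar_comp pc (ltW r0)).
by rewrite pE conjc_real.
Qed.

(** The mean value property for z q(z), with q the divided difference of f at a: the value at 0 is
    zero, and the kernel integral turns this into Cauchy's formula. *)
Lemma cauchy_formula f a r : hol_disc f 0 r -> N a < r ->
  cint 0 tau (fun t => f (polar r t) * (polar r t / (polar r t - a))) = f a * tau%:C%C.
Proof.
move=> fh ar; have r0 : 0 < r by apply: le_lt_trans ar; exact: cmod_ge0.
have fa : cdiff f a (cder f a) by apply: (hol_disc_cdiff fh); rewrite subr0 ltW.
move/cdiffP : (fa) => [q [qc qa qE]].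
pose p z := z * q z.
have qE' z : z != a -> q z = (f z - f a) / (z - a).
  by move=> za; rewrite qE mulfK// subr_eq0.
have qd z : N z <= r -> z != a -> exists d, cdiff q z d.
  move=> zr za; exists ((cder f z - 0) * (z - a)^-1 + (f z - f a) * (- (1 - 0) / (z - a) ^+ 2)).
  have : cdiff (fun z => (f z - f a) / (z - a)) z
      ((cder f z - 0) * (z - a)^-1 + (f z - f a) * (- (1 - 0) / (z - a) ^+ 2)).
    apply: cdiffM; first apply: cdiffB; [|exact: cdiff_cst|].
      by apply: (hol_disc_cdiff fh); rewrite subr0.
    apply: cdiffV; first by rewrite subr_eq0.
    apply: cdiffB; [exact: cdiff_id|exact: cdiff_cst].
  apply: cdiff_local; exists (N (z - a)); first by rewrite cmod_gt0 subr_eq0.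
  move=> w wz; rewrite qE'//; apply: contraTneq wz => ->.
  by rewrite cmodBC ltxx.
have pc z : N z <= r -> ccont p z.
  move=> zr; apply: ccontM; first exact: ccont_id.
  by have [->//|za] := eqVneq z a; have [d] := qd z zr za; exact: cdiff_cont.
have pd z : 0 < N z -> N z <= r -> N z != N a -> exists d, cdiff p z d.
  move=> _ zr za; have za' : z != a by apply: contraNneq za => ->.
  by have [d qzd] := qd z zr za'; exists (1 * q z + z * d); apply: cdiffM => //; exact: cdiff_id.
have := mean_value r0 pc pd; rewrite {2}/p mul0r mul0r => pE.
pose K t := polar r t / (polar r t - a).
have ta t : polar r t - a != 0.
  by rewrite subr_eq0; apply: contraTneq ar => <-; rewrite cmod_polar gtr0_norm// ltxx.
have Kc : rcont K.
  apply: (@rcont_comp _ (fun z => z / (z - a))); last exact: rcont_polar.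
  move=> t; apply: ccontM; first exact: ccont_id.
  by apply: ccontV => //; apply: ccontD; [exact: ccont_id|exact: ccont_cst].
have E : (fun t => p (polar r t)) = (fun t => f (polar r t) * K t - f a * K t).
  apply/funext => t; have h : polar r t != a by rewrite -subr_eq0; exact: ta.
  have alg (z x y b : C) : z * ((x - y) / b) = x * (z / b) - y * (z / b) by ring.
  by rewrite /p /K (qE' _ h); exact: alg.
have fK : rcont (fun t => f (polar r t) * K t).
  apply: (@rcont_comp _ (fun z => f z * (z / (z - a)))); last exact: rcont_polar.
  move=> t; apply: ccontM.
    have [|d] := fh (polar r t); first by rewrite subr0 cmod_polar gtr0_norm.
    exact: cdiff_cont.
  apply: ccontM; first exact: ccont_id.
  by apply: ccontV => //; apply: ccontD; [exact: ccont_id|exact: ccont_cst].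
move: pE; rewrite E cintB//; last exact: rcontMl.
by rewrite cintZ// cint_kernel// => /eqP; rewrite subr_eq0 => /eqP.
Qed.

End Cauchy.

(** * Taylor expansions and Cauchy estimates *)

Section Taylor.
Variable R : realType.
Local Notation C := (cplx R).
Local Notation N := (@cmod R).
Local Notation tau := (2 * pi : R).
Implicit Types (f : C -> C) (z w a h : C) (r M : R).

Lemma hol_disc_cont f a r z : hol_disc f a r -> N (z - a) <= r -> ccont f z.
Proof. by move=> fh /fh[d]; exact: cdiff_cont. Qed.

Lemma hol_discS f a r b s : hol_disc f a r -> N (b - a) + s <= r -> hol_disc f b s.
Proof.
by move=> fh bs z zb; apply: fh; have := cmodB_tri b z a; lra.
Qed.

Lemma hol_disc_shift f a b r : hol_disc f (a + b) r -> hol_disc (fun z => f (a + z)) b r.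
Proof.
move=> fh z zr; have [|d fd] := fh (a + z).
  by rewrite (_ : a + z - (a + b) = z - b)//; ring.
exists (d * (0 + 1)); apply: (@cdiff_comp _ (fun z => a + z) f) => //.
by apply: cdiffD; [exact: cdiff_cst|exact: cdiff_id].
Qed.

Lemma max_modulus f a r M : 0 < r -> hol_disc f a r ->
  (forall t, 0 <= t <= tau -> N (f (a + polar r t)) <= M) -> N (f a) <= M.
Proof.
move=> r0 fh fM.
have fh' : hol_disc (fun z => f (a + z)) 0 r by apply: hol_disc_shift; rewrite addr0.
have fc z : N z <= r -> ccont (fun z => f (a + z)) z.
  by move=> zr; apply: (hol_disc_cont fh'); rewrite subr0.
have := @mean_value R _ r 0 r0 fc (fun z _ zr _ => fh' z (eq_ind_r (fun w => N w <= r) zr (subr0 z))).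
rewrite addr0 => E.
have := @cint_le R (fun t => f (a + polar r t)) 0 tau M
  (rcont_polar_comp fc (ltW r0) (lexx _)) (ltW (tau_gt0 R)) fM.
rewrite E cmodM cmod_real gtr0_norm ?tau_gt0// subr0 ler_pM2r//; exact: tau_gt0.
Qed.

Lemma taylor0 f r M : 0 < r -> hol_disc f 0 r -> (forall z, N z = r -> N (f z) <= M) ->
  exists c : nat -> C, (forall k, N (c k) <= M / r ^+ k) /\
   forall m a, N a < r ->
     N (f a - \sum_(k < m) c k * a ^+ k) <= M * (N a / r) ^+ m * (r / (r - N a)).
Proof.
move=> r0 fh fM.
have M0 : 0 <= M.
  by apply: le_trans (cmod_ge0 (f (polar r 0))) _; apply: fM; rewrite cmod_polar gtr0_norm.
have tauC : (tau%:C%C : C) != 0 by rewrite -cmod_gt0 cmod_real gtr0_norm ?tau_gt0.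
have Np t : N (polar r t) = r by rewrite cmod_polar gtr0_norm.
have p0 t : polar r t != 0 by rewrite -cmod_gt0 Np.
have fc : rcont (fun t => f (polar r t)).
  apply: (rcont_polar_comp (r := r)) => //; last exact: ltW.
  by move=> z zr; apply: (hol_disc_cont fh); rewrite subr0.
pose c k := cint 0 tau (fun t => f (polar r t) * (polar r t)^-1 ^+ k) / tau%:C%C.
have ck_cont k : rcont (fun t => f (polar r t) * (polar r t)^-1 ^+ k).
  apply: (@rcont_comp _ (fun z => f z * z^-1 ^+ k)); last exact: rcont_polar.
  move=> t; apply: ccontM.
    by apply: (hol_disc_cont fh); rewrite subr0 Np.
  elim: k => [|k IH]; first by apply: ccont_cst.
  under eq_fun do rewrite exprS.
  by apply: ccontM => //; apply: ccontV => //; exact: ccont_id.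
exists c; split=> [k|m a ar].
  rewrite /c cmodM cmodV cmod_real gtr0_norm ?tau_gt0// ler_pdivrMr ?tau_gt0//.
  rewrite -{2}(subr0 tau); apply: cint_le => //; first exact: ltW (tau_gt0 R).
  move=> t _; rewrite cmodM cmodX cmodV Np -exprVn; apply: ler_wpM2r; last exact: fM.
  by rewrite exprn_ge0// invr_ge0 ltW.
have ta t : polar r t - a != 0.
  by rewrite subr_eq0; apply: contraTneq ar => <-; rewrite Np ltxx.
pose K k t := f (polar r t) * ((a / polar r t) ^+ k * (polar r t / (polar r t - a))).
have Kc k : rcont (K k).
  apply: (@rcont_comp _ (fun z => f z * ((a / z) ^+ k * (z / (z - a))))); last exact: rcont_polar.
  move=> t; apply: ccontM.
    by apply: (hol_disc_cont fh); rewrite subr0 Np.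
  apply: ccontM; last first.
    apply: ccontM; first exact: ccont_id.
    by apply: ccontV => //; apply: ccontD; [exact: ccont_id|exact: ccont_cst].
  elim: k => [|k IH]; first by apply: ccont_cst.
  under eq_fun do rewrite exprS.
  apply: ccontM => //; apply: ccontM; first exact: ccont_cst.
  by apply: ccontV => //; exact: ccont_id.
have KE k : f a - \sum_(j < k) c j * a ^+ j = cint 0 tau (K k) / tau%:C%C.
  elim: k => [|k IH].
    rewrite big_ord0 subr0; have := cauchy_formula fh ar.
    have -> : (fun t => f (polar r t) * (polar r t / (polar r t - a))) = K 0%N.
      by apply/funext => t; rewrite /K expr0 mul1r.
    by move=> ->; rewrite mulfK.
  rewrite big_ord_recr /= opprD addrA IH.
  have -> : K k = fun t => a ^+ k * (f (polar r t) * (polar r t)^-1 ^+ k) + K k.+1 t.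
    apply/funext => t; rewrite /K exprS !exprMn; have := ta t; have := p0 t.
    move: (polar r t) => z z0 za; by field; rewrite z0 za.
  have /= -> := cintD 0 tau (rcontMl (a ^+ k) (ck_cont k)) (Kc k.+1).
  have /= -> := cintZ (a ^+ k) 0 tau (ck_cont k).
  have alg (x y u v : C) : v != 0 -> (x * u + y) / v - u / v * x = y / v by move=> ?; field.
  exact: alg.
rewrite KE cmodM cmodV cmod_real gtr0_norm ?tau_gt0// ler_pdivrMr ?tau_gt0//.
rewrite -{2}(subr0 tau); apply: cint_le => //; first exact: ltW (tau_gt0 R).
move=> t _; rewrite /K !cmodM cmodX !cmodM !cmodV Np -mulrA.
apply: ler_pM; rewrite ?cmod_ge0 ?mulr_ge0 ?exprn_ge0 ?divr_ge0 ?invr_ge0 ?cmod_ge0 ?(ltW r0)//.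
  exact: fM.
apply: ler_wpM2l; first by rewrite exprn_ge0// divr_ge0 ?cmod_ge0// ltW.
apply: ler_wpM2l; first exact: ltW.
rewrite lef_pV2 ?posrE ?subr_gt0//; last by rewrite cmod_gt0.
by have := cmod_leB (polar r t) a; rewrite Np.
Qed.

Lemma cdiff_quad f z d r K : 0 < r -> (forall w, N (w - z) < r ->
  N (f w - f z - d * (w - z)) <= K * N (w - z) ^+ 2) -> cdiff f z d.
Proof.
move=> r0 H e e0; have K0 : 0 < 1 + `|K| by rewrite ltr_pwDl.
exists (Num.min r (e / (1 + `|K|))); first by rewrite lt_min r0 divr_gt0.
move=> w; rewrite lt_min => /andP[/H h1 h2]; apply: le_trans h1 _.
rewrite expr2 mulrA; apply: ler_wpM2r; first exact: cmod_ge0.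
apply: (@le_trans _ _ ((1 + `|K|) * N (w - z))).
  by apply: ler_wpM2r; [exact: cmod_ge0|have := ler_norm K; lra].
by rewrite mulrC -ler_pdivlMr// ltW.
Qed.

Lemma taylor f a r M : 0 < r -> hol_disc f a r -> (forall z, N (z - a) = r -> N (f z) <= M) ->
  exists c : nat -> C, [/\ c 0%N = f a, c 1%N = cder f a, forall k, N (c k) <= M / r ^+ k &
    forall m z, N (z - a) <= r / 2 ->
     N (f z - \sum_(k < m) c k * (z - a) ^+ k) <= 2 * M * (N (z - a) / r) ^+ m].
Proof.
move=> r0 fh fM.
have fh' : hol_disc (fun z => f (a + z)) 0 r by apply: hol_disc_shift; rewrite addr0.
have M0 : 0 <= M.
  apply: le_trans (cmod_ge0 (f (a + r%:C%C))) _; apply: fM.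
  by rewrite addrC addKr cmod_real gtr0_norm.
have [|c [cM cE]] := taylor0 r0 fh' (M := M).
  by move=> z zr; apply: fM; rewrite addrC addKr.
have {}cE m z : N (z - a) <= r / 2 ->
     N (f z - \sum_(k < m) c k * (z - a) ^+ k) <= 2 * M * (N (z - a) / r) ^+ m.
  move=> zr; have zr' : N (z - a) < r by lra.
  have := cE m _ zr'; rewrite [a + _]addrC subrK => h; apply: le_trans h _.
  rewrite -mulrA [2 * M]mulrC -mulrA; apply: ler_wpM2l => //.
  rewrite mulrC; apply: ler_wpM2r.
    by rewrite exprn_ge0// divr_ge0 ?cmod_ge0// ltW.
  by rewrite ler_pdivrMr ?subr_gt0//; lra.
have c0 : c 0%N = f a.
  have := cE 1%N a; rewrite subrr cmod0 big_ord_recl big_ord0 expr0 mulr1 addr0 mul0r expr1 mulr0.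
  move=> /(_ (divr_ge0 (ltW r0) (ler0n _ 2))) h.
  apply/esym/eqP; rewrite -subr_eq0 -cmod_eq0 eq_le cmod_ge0 andbT; exact: h.
exists c; split=> //; apply/esym/cdiff_cder.
apply: (@cdiff_quad _ _ _ (r / 2) (2 * M / r ^+ 2)); first by rewrite divr_gt0.
move=> w wr; have := cE 2%N w (ltW wr).
rewrite !big_ord_recl big_ord0 expr0 mulr1 addr0 c0 /= expr1 opprD addrA => h.
by apply: le_trans h _; rewrite expr_div_n; rewrite mulrA mulrAC.
Qed.

Lemma cauchy_est1 f a r M : 0 < r -> hol_disc f a r -> (forall z, N (z - a) = r -> N (f z) <= M) ->
  N (cder f a) <= M / r.
Proof. by move=> r0 fh fM; have [c [_ <- h _]] := taylor r0 fh fM; have := h 1%N. Qed.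

Lemma cauchy_est0 f a r M z : 0 < r -> hol_disc f a r -> (forall z, N (z - a) = r -> N (f z) <= M) ->
  N (z - a) <= r / 2 -> N (f z) <= 2 * M.
Proof.
move=> r0 fh fM zr; have [c [_ _ _ h]] := taylor r0 fh fM.
by have := h 0%N z zr; rewrite big_ord0 subr0 expr0 mulr1.
Qed.

Lemma cauchy_lip f a r M z : 0 < r -> hol_disc f a r -> (forall z, N (z - a) = r -> N (f z) <= M) ->
  N (z - a) <= r / 2 -> N (f z - f a) <= 2 * M / r * N (z - a).
Proof.
move=> r0 fh fM zr; have [c [c0 _ _ h]] := taylor r0 fh fM.
have := h 1%N z zr; rewrite big_ord_recl big_ord0 expr0 mulr1 addr0 c0 expr1.
by rewrite mulrA mulrAC.
Qed.

Lemma cauchy_est2 f a r M z : 0 < r -> hol_disc f a r -> (forall z, N (z - a) = r -> N (f z) <= M) ->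
  N (z - a) <= r / 2 ->
  N (f z - f a - cder f a * (z - a)) <= 2 * M / r ^+ 2 * N (z - a) ^+ 2.
Proof.
move=> r0 fh fM zr; have [c [c0 c1 _ h]] := taylor r0 fh fM.
have := h 2%N z zr.
rewrite !big_ord_recl big_ord0 expr0 mulr1 addr0 c0 c1 /= expr1 opprD addrA => {}h.
by apply: le_trans h _; rewrite expr_div_n mulrA mulrAC.
Qed.

Lemma hol_bounded f a r : hol_disc f a r ->
  exists2 M, 0 < M & forall z, N (z - a) <= r -> N (f z) <= M.
Proof. by move=> fh; apply: disc_bounded => z /(hol_disc_cont fh). Qed.

(** f minus its second-order Taylor polynomial is O(|z - a|^3); Cauchy's estimate on the disc of
    centre w and radius |w - a|, where |z - a| <= 2 |w - a|, makes its derivative at w O(|w -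
    a|^2). *)
Lemma cder_hol f a r : 0 < r -> hol_disc f a r -> exists d, cdiff (cder f) a d.
Proof.
move=> r0 fh; have [M M0 fM] := hol_bounded fh.
have [|c [c0 c1 _ h]] := taylor r0 fh (M := M); first by move=> z zr; apply: fM; rewrite zr.
exists (2 * c 2%N); apply: (@cdiff_quad _ _ _ (r / 4) (2 * M * 8 / r ^+ 3)); first by rewrite divr_gt0.
move=> w wr; have [->|wa] := eqVneq w a.
  by rewrite !subrr mulr0 subrr cmod0 expr2 !mulr0.
have wa0 : 0 < N (w - a) by rewrite cmod_gt0 subr_eq0.
pose g z := f z - (c 0%N + c 1%N * (z - a) + c 2%N * ((z - a) * (z - a))).
have gd z : N (z - a) <= r -> cdiff g z (cder f z - cder f a - 2 * c 2%N * (z - a)).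
  have -> : cder f z - cder f a - 2 * c 2%N * (z - a) =
   cder f z - (0 + (0 * (z - a) + c 1%N * (1 - 0)) +
     (0 * ((z - a) * (z - a)) + c 2%N * ((1 - 0) * (z - a) + (z - a) * (1 - 0)))).
    by rewrite -c1; move: (cder f z) (c 1%N) (c 2%N) => x y t; ring.
  move=> zr; have za : cdiff (fun z => z - a) z (1 - 0).
    by apply: cdiffB; [exact: cdiff_id|exact: cdiff_cst].
  apply: cdiffB; first exact: hol_disc_cdiff fh zr.
  apply: cdiffD; first apply: cdiffD; first exact: cdiff_cst.
    by apply: cdiffM => //; exact: cdiff_cst.
  by apply: cdiffM; [exact: cdiff_cst|exact: cdiffM].
have gh : hol_disc g w (N (w - a)).
  move=> z zw; eexists; apply: gd; have := cmodB_tri w z a; lra.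
have := cauchy_est1 wa0 gh (M := 2 * M * (2 * N (w - a) / r) ^+ 3).
rewrite (cdiff_cder (gd w _)); last by lra.
have -> : 2 * M * (2 * N (w - a) / r) ^+ 3 / N (w - a) = 2 * M * 8 / r ^+ 3 * N (w - a) ^+ 2.
  by field; rewrite gt_eqF//= gt_eqF.
apply=> z zw.
have za : N (z - a) <= 2 * N (w - a) by have := cmodB_tri w z a; lra.
have := h 3%N z; rewrite !big_ord_recl big_ord0 /= expr0 mulr1 addr0 expr1 !expr2 => h'.
rewrite /g -addrA; apply: le_trans (h' _) _; first by lra.
apply: ler_wpM2l; first by rewrite mulr_ge0// ltW.
apply: lerXn2r; rewrite ?nnegrE ?divr_ge0 ?mulr_ge0 ?cmod_ge0 ?(ltW r0)//.
by rewrite ler_pdivrMr// divfK// gt_eqF.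
Qed.

(** Away from a the quotient rule applies; at a the third-order Taylor bound, divided by |w - a|,
    gives differentiability with derivative the coefficient c 2. *)
Lemma division f a r : 0 < r -> hol_disc f a r -> exists q, [/\ hol_disc q a r,
  (forall z, f z = f a + (z - a) * q z) & q a = cder f a].
Proof.
move=> r0 fh; have [M M0 fM] := hol_bounded fh.
have [|c [c0 c1 _ h]] := taylor r0 fh (M := M); first by move=> z zr; apply: fM; rewrite zr.
pose q z := if z == a then cder f a else (f z - f a) / (z - a).
have qE z : f z - f a = (z - a) * q z.
  rewrite /q; case: eqVneq => [->|za]; first by rewrite !subrr mul0r.
  by rewrite mulrC divfK// subr_eq0.
exists q; split; last by rewrite /q eqxx.
  move=> z zr; have [->|za] := eqVneq z a.
    exists (c 2%N); apply: (@cdiff_quad _ _ _ (r / 2) (2 * M / r ^+ 3)); first by rewrite divr_gt0.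
    move=> w wr; have [->|wa] := eqVneq w a.
      by rewrite !subrr mulr0 subrr cmod0 expr2 !mulr0.
    have wa0 : 0 < N (w - a) by rewrite cmod_gt0 subr_eq0.
    have := h 3%N w (ltW wr).
    rewrite !big_ord_recl big_ord0 /= expr0 mulr1 addr0 expr1 c0 c1.
    have qa : q a = cder f a by rewrite /q eqxx.
    have fw : f w = f a + (w - a) * q w by rewrite -qE addrC subrK.
    have -> : f w - (f a + (cder f a * (w - a) + c 2%N * (w - a) ^+ 2)) =
        (w - a) * (q w - q a - c 2%N * (w - a)).
      by rewrite fw qa; move: (cder f a) (q w) (f a) (c 2%N) => x y t u; ring.
    rewrite cmodM -ler_pdivlMl// => h'; apply: le_trans h' _.
    rewrite le_eqVlt; apply/orP; left; apply/eqP; field.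
    by rewrite gt_eqF//= gt_eqF.
  have : cdiff (fun z => (f z - f a) / (z - a)) z
      ((cder f z - 0) * (z - a)^-1 + (f z - f a) * (- (1 - 0) / (z - a) ^+ 2)).
    apply: cdiffM; first apply: cdiffB; [|exact: cdiff_cst|].
      exact: hol_disc_cdiff fh zr.
    apply: cdiffV; first by rewrite subr_eq0.
    apply: cdiffB; [exact: cdiff_id|exact: cdiff_cst].
  move=> H; eexists; move: H; apply: cdiff_local; exists (N (z - a)).
    by rewrite cmod_gt0 subr_eq0.
  move=> w wz; rewrite /q; case: eqVneq => // wa; move: wz.
  by rewrite wa cmodBC ltxx.
by move=> z; rewrite -qE addrC subrK.
Qed.

(** If a could be divided out indefinitely, f = (z - a)^m g with |g| <= M / r^m on the circle, hence
    |f| <= 2 M / 2^m on the half disc. This is why the nonzero value is sought within r/2. *)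
Lemma zero_order f a r : 0 < r -> hol_disc f a r ->
  (exists2 z, N (z - a) <= r / 2 & f z != 0) ->
  exists m g, [/\ hol_disc g a r, g a != 0 & forall z, f z = (z - a) ^+ m * g z].
Proof.
move=> r0 fh [z0 z0r fz0]; apply: contrapT => /forallNP K.
have {}K m : exists g, hol_disc g a r /\ forall z, f z = (z - a) ^+ m * g z.
  elim: m => [|m [g [gh gE]]]; first by exists f; split=> // z; rewrite expr0 mul1r.
  have ga : g a = 0.
    by apply/eqP/negPn/negP => ga; apply: (K m); exists g.
  have [q [qh qE _]] := division r0 gh; exists q; split=> // z.
  by rewrite gE qE ga add0r exprSr mulrA.
have [M M0 fM] := hol_bounded fh.
have {}K m : N (f z0) <= 2 * M / 2 ^+ m.
  have [g [gh gE]] := K m.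
  have gM z : N (z - a) = r -> N (g z) <= M / r ^+ m.
    move=> zr; rewrite ler_pdivlMr ?exprn_gt0//.
    by have := fM z; rewrite gE cmodM cmodX zr mulrC; apply.
  have := cauchy_est0 r0 gh gM z0r => h.
  rewrite gE cmodM cmodX.
  apply: (@le_trans _ _ ((r / 2) ^+ m * (2 * (M / r ^+ m)))).
    apply: ler_pM => //; rewrite ?exprn_ge0 ?cmod_ge0//.
    by apply: lerXn2r; rewrite ?nnegrE ?cmod_ge0 ?divr_ge0 ?(ltW r0).
  rewrite le_eqVlt; apply/orP; left; apply/eqP; rewrite expr_div_n; field.
  by rewrite !expf_neq0 ?pnatr_eq0// gt_eqF.
have Nf : 0 < N (f z0) by rewrite cmod_gt0.
have M2 : 0 < 2 * M by rewrite mulr_gt0.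
have := archi_boundP (ltW (divr_gt0 M2 Nf)); set m := Num.bound _ => hm.
have := K m; rewrite ler_pdivlMr ?exprn_gt0// leNgt => /negP; apply.
rewrite [N _ * _]mulrC -ltr_pdivrMr//; apply: lt_trans hm _.
by rewrite -natrX ltr_nat; exact: ltn_expl.
Qed.

End Taylor.

Section RealEmbedding.
Variable R : realType.
Local Notation C := (cplx R).
Implicit Types x y : R.

Definition rc x : C := x%:C%C.

Lemma rcB x y : rc (x - y) = rc x - rc y. Proof. exact: rmorphB. Qed.
Lemma rc0 : rc 0 = 0. Proof. exact: rmorph0. Qed.
Lemma rc1 : rc 1 = 1. Proof. exact: rmorph1. Qed.
Lemma cmod_rc x : cmod (rc x) = `|x|. Proof. exact: cmod_real. Qed.
End RealEmbedding.

(* Elements of [cplx R] are only manipulated through [cmod], [rc], [polar] and the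
   field operations from here on; unfolding them makes unification diverge. *)
Global Opaque cplx rc.

(** * Limits of holomorphic functions *)

Section Limits.
Variable R : realType.
Local Notation C := (cplx R).
Local Notation N := (@cmod R).
Implicit Types (f g G k : C -> C) (z w a b : C) (r s M : R) (h : nat -> C -> C).

Definition ulim (u : nat -> C) : C := xget 0 [set l | ucvg u l].

Lemma ulimP (u : nat -> C) M : (\forall n \near ultra, N (u n) <= M) -> ucvg u (ulim u).
Proof. by move=> /ulim_ex[l ul]; have := xgetPex 0 (ex_intro _ l ul). Qed.

Section UlimHol.
Variables (h : nat -> C -> C) (a : C) (r M : R).
Hypothesis r0 : 0 < r.
Hypothesis hh : \forall n \near ultra, hol_disc (h n) a r /\ forall z, N (z - a) <= r -> N (h n z) <= M.
Let g z := ulim (h ^~ z).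

Lemma ulim_disc z : N (z - a) <= r -> ucvg (h ^~ z) (g z).
Proof. by move=> zr; apply: (@ulimP _ M); apply: filterS hh => n [_]; apply. Qed.

(** The second-order Taylor bound has a constant independent of n, so it passes to the limit; the
    ultralimit of the derivatives, which Cauchy's estimate bounds, is then the derivative of the
    limit. *)
Lemma ulim_cdiff z : N (z - a) <= r / 2 ->
  cdiff g z (cder g z) /\ ucvg (fun n => cder (h n) z) (cder g z).
Proof.
move=> zr; have r2 : 0 < r / 2 by rewrite divr_gt0.
have zd w : N (w - z) <= r / 2 -> N (w - a) <= r.
  by move=> ?; have := cmodB_tri z w a; lra.
have H : \forall n \near ultra, [/\ hol_disc (h n) z (r / 2),
    forall w, N (w - z) = r / 2 -> N (h n w) <= M & True].
  apply: filterS hh => n [A B]; split=> //.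
    by apply: (hol_discS A); lra.
  by move=> w wr; apply: B; apply: zd; rewrite wr.
have [d dE] : exists d, ucvg (fun n => cder (h n) z) d.
  apply: (@ulim_ex _ _ (M / (r / 2))); apply: filterS H => n [A B _].
  exact: cauchy_est1 r2 A B.
have gd : cdiff g z d.
  apply: (@cdiff_quad _ _ _ _ (r / 2 / 2) (2 * M / (r / 2) ^+ 2)); first by rewrite divr_gt0.
  move=> w wz.
  have wr : N (w - a) <= r by apply: zd; lra.
  have zr' : N (z - a) <= r by lra.
  have := ucvgD (ucvgD (ulim_disc wr) (ucvgN (ulim_disc zr'))) (ucvgN (ucvgMr (w - z) dE)).
  move=> /ucvg_le; apply.
  by apply: filterS H => n [A B _]; apply: (cauchy_est2 r2 A B) => //; exact: ltW.
by rewrite (cdiff_cder gd).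
Qed.

Lemma ulim_lip z w : N (z - a) <= r / 2 -> N (w - z) <= r / 4 ->
  (\forall n \near ultra, N (h n w - h n z) <= 4 * M / r * N (w - z)) /\
  N (g w - g z) <= 4 * M / r * N (w - z).
Proof.
move=> zr wz; have r2 : 0 < r / 2 by rewrite divr_gt0.
have zd w' : N (w' - z) <= r / 2 -> N (w' - a) <= r.
  by move=> ?; have := cmodB_tri z w' a; lra.
have H : \forall n \near ultra, N (h n w - h n z) <= 4 * M / r * N (w - z).
  apply: filterS hh => n [A B].
  have -> : 4 * M / r = 2 * M / (r / 2) by field; rewrite gt_eqF.
  apply: cauchy_lip r2 _ _ _; last lra.
    by apply: (hol_discS A); lra.
  by move=> w' wr; apply: B; apply: zd; rewrite wr.
split=> //.
have wr : N (w - a) <= r by apply: zd; lra.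
have zr' : N (z - a) <= r by lra.
by apply: ucvg_le (ucvgD (ulim_disc wr) (ucvgN (ulim_disc zr'))) H.
Qed.

(** Otherwise points with error above e would have an ultralimit l; convergence at l and the common
    Lipschitz bound near l, each within e/4, contradict the gap. *)
Lemma ulim_unif e : 0 < e ->
  \forall n \near ultra, forall z, N (z - a) <= r / 2 -> N (h n z - g z) <= e.
Proof.
move=> e0; case: (ultra_em (fun n => forall z, N (z - a) <= r / 2 -> N (h n z - g z) <= e)) => // K.
have {}K : \forall n \near ultra, exists z, N (z - a) <= r / 2 /\ e < N (h n z - g z).
  apply: filterS K => n nK; apply: contrapT => /forallNP K'; apply: nK => z zr.
  by rewrite leNgt; apply/negP => ez; apply: (K' z).
have /choice[z_ zE] : forall n, exists z, N (z - a) <= r / 2 /\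
    ((exists z, N (z - a) <= r / 2 /\ e < N (h n z - g z)) -> e < N (h n z - g z)).
  move=> n; have [[z [zr ez]]|nz] := pselect (exists z, N (z - a) <= r / 2 /\ e < N (h n z - g z)).
    by exists z.
  by exists a; rewrite subrr cmod0 divr_ge0// ltW.
have [l zl lr] := disc_ulim (fun n => (zE n).1).
have M0 : 0 <= M.
  have [n _ [_ B]] := ultra_ex 0 hh; apply: le_trans (cmod_ge0 (h n a)) _.
  by apply: B; rewrite subrr cmod0 ltW.
have [L L0 LE] : exists2 L, 0 < L & 4 * M / r <= L.
  exists (4 * M / r + 1); last by rewrite lerDl.
  by rewrite ltr_wpDl// !mulr_ge0// invr_ge0 ltW.
have [d [d0 dr de]] : exists d, [/\ 0 < d, d <= r / 4 & d <= e / (4 * L)].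
  exists (Num.min (r / 4) (e / (4 * L))); rewrite lt_min !divr_gt0 ?mulr_gt0//.
  by split=> //; rewrite ge_min lexx ?orbT.
have lr' : N (l - a) <= r by lra.
have e4 : 0 < e / 4 by rewrite divr_gt0.
have Le z : N (z - l) <= d -> 4 * M / r * N (z - l) <= e / 4.
  move=> zd; apply: (@le_trans _ _ (L * (e / (4 * L)))).
    by apply: ler_pM; rewrite ?cmod_ge0 ?mulr_ge0 ?invr_ge0 ?(ltW r0)//; lra.
  by rewrite le_eqVlt; apply/orP; left; apply/eqP; field; rewrite gt_eqF.
have lip n z : N (z - l) <= d -> hol_disc (h n) a r /\ (forall z, N (z - a) <= r -> N (h n z) <= M) ->
    N (h n z - h n l) <= e / 4.
  move=> z1 [A B]; have r2 : 0 < r / 2 by rewrite divr_gt0.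
  have := @cauchy_lip R (h n) l (r / 2) M z r2.
  have -> : 2 * M / (r / 2) = 4 * M / r by field; rewrite gt_eqF.
  move=> h'; apply: le_trans (h' _ _ _) (Le _ z1); last by lra.
    by apply: (hol_discS A); lra.
  by move=> w wr; apply: B; have := cmodB_tri l w a; lra.
have glip z : N (z - l) <= d -> N (g z - g l) <= e / 4.
  move=> z1; apply: le_trans (ulim_lip lr _).2 (Le _ z1); exact: le_trans dr.
have [n _ [[K1 K2] [K3 K4]]] := ultra_ex 0 (filterI (filterI K hh) (filterI (zl _ d0) (ulim_disc lr' e4))).
have B1 := (zE n).2 K1; have B2 := lip n _ K3 K2; have B3 := glip _ K3.
have B4 := cmodB_tri (h n l) (h n (z_ n)) (g (z_ n)).
have B5 := cmodB_tri (g l) (h n l) (g (z_ n)).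
rewrite (cmodBC (g l) (g _)) in B5.
have {}K4 : N (h n l - g l) <= e / 4 by exact: K4.
clear -e0 K4 B1 B2 B3 B4 B5; lra.
Qed.

End UlimHol.

(** The maximum modulus principle for 1/G. This replaces the argument principle whenever a zero has
    to be found. *)
Lemma min_modulus G a s m : 0 < s -> hol_disc G a s ->
  (forall z, N (z - a) = s -> m <= N (G z)) -> N (G a) < m ->
  exists2 z, N (z - a) <= s & G z = 0.
Proof.
move=> s0 Gh Gm Ga; apply: contrapT => K.
have G0 z : N (z - a) <= s -> G z != 0.
  by move=> zs; apply/eqP => Gz; apply: K; exists z.
have m0 : 0 < m by apply: le_lt_trans Ga; exact: cmod_ge0.
have Gh' : hol_disc (fun z => (G z)^-1) a s.
  move=> z zs; have [d Gd] := Gh z zs; eexists; apply: cdiffV Gd; exact: G0.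
have GA : 0 < N (G a) by rewrite cmod_gt0 G0// subrr cmod0 ltW.
have : N ((G a)^-1) <= m^-1.
  apply: (max_modulus s0 Gh') => t _.
  have ps : N (a + polar s t - a) = s by rewrite [a + _]addrC addrK cmod_polar gtr0_norm.
  by rewrite cmodV lef_pV2 ?posrE ?Gm// cmod_gt0 G0// ps.
by rewrite cmodV lef_pV2 ?posrE// leNgt Ga.
Qed.

(** The radius s makes the quadratic Taylor error be s / 8 on the circle, and the smallness of G a
    gives |G a| <= be s / 4. The linear term of size be s therefore leaves |G| >= be s / 2 > |G a|,
    and [min_modulus] applies. *)
Lemma simple_zero G a r M : 0 < r -> hol_disc G a r -> 0 < M ->
  (forall z, N (z - a) <= r -> N (G z) <= M) -> 0 < N (cder G a) ->
  64 * M * N (G a) <= (N (cder G a) * r) ^+ 2 ->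
  exists z, [/\ N (z - a) <= N (cder G a) * r ^+ 2 / (16 * M), G z = 0 &
    N (cder G a) / 2 <= N (cder G z)].
Proof.
move=> r0 Gh M0 GM; set be := N (cder G a) => b0 small.
have GM' z : N (z - a) = r -> N (G z) <= M by move=> zr; apply: GM; rewrite zr.
have bM : be * r <= M.
  by rewrite -ler_pdivlMr//; exact: cauchy_est1 r0 Gh GM'.
set s := be * r ^+ 2 / (16 * M).
have s0 : 0 < s by rewrite divr_gt0 ?mulr_gt0 ?exprn_gt0.
have sr : s <= r / 16.
  rewrite /s ler_pdivrMr ?mulr_gt0//.
  have -> : r / 16 * (16 * M) = M * r by field.
  by rewrite expr2 mulrA ler_pM2r.
have sb : 2 * M / r ^+ 2 * s = be / 8 by rewrite /s; field; rewrite !gt_eqF.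
have Gas : N (G a) <= be * s / 4.
  have -> : be * s / 4 = (be * r) ^+ 2 / (64 * M) by rewrite /s; field; rewrite gt_eqF.
  by rewrite ler_pdivlMr ?mulr_gt0// mulrC.
have bs0 : 0 < be * s by rewrite mulr_gt0.
have [|||z zs Gz] := @min_modulus G a s (be * s / 2) s0 _ _ _.
- by apply: (hol_discS Gh); rewrite subrr cmod0; lra.
- move=> z zs.
  have z2 : N (z - a) <= r / 2 by rewrite zs; lra.
  have := cauchy_est2 r0 Gh GM' z2; rewrite zs expr2 mulrA sb => h1.
  have h2 := cmod_leB (cder G a * (z - a)) (G a).
  have h3 : N (cder G a * (z - a)) = be * s by rewrite cmodM zs.
  have h4 := cmodB (G z) (G z - G a - cder G a * (z - a)).
  have h5 := cmodB (G z - (G z - G a - cder G a * (z - a))) (G a).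
  have h6 : G z - (G z - G a - cder G a * (z - a)) - G a = cder G a * (z - a).
    by move: (G z) (G a) (cder G a) => x y t; ring.
  rewrite h6 h3 in h5.
  move: h1 h4 h5 Gas bs0; rewrite mulrAC.
  move: (N (G z)) (N (G a)) (N (G z - _ - _)) (N (G z - _)) (be * s) => x1 x2 x3 x4 x5; lra.
- lra.
exists z; split=> //.
(* H is G minus its tangent at a. On the circle of radius s around the zero it is at most 2 M / r^2
   (2 s)^2, so Cauchy's estimate bounds the change of G' by 4 (be / 8) = be / 2. *)
pose H w := G w - G a - cder G a * (w - a).
have Hd w : N (w - a) <= r -> cdiff H w (cder G w - cder G a).
  move=> wr; have -> : cder G w - cder G a = cder G w - 0 - (0 * (w - a) + cder G a * (1 - 0)).
    by move: (cder G w) (cder G a) => x y; ring.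
  apply: cdiffB; first apply: cdiffB; [exact: hol_disc_cdiff Gh wr|exact: cdiff_cst|].
  by apply: cdiffM; [exact: cdiff_cst|apply: cdiffB; [exact: cdiff_id|exact: cdiff_cst]].
have Hh : hol_disc H z s.
  move=> w wz; eexists; apply: Hd; have := cmodB_tri z w a; lra.
have HM w : N (w - z) = s -> N (H w) <= 2 * M / r ^+ 2 * (2 * s) ^+ 2.
  move=> wz; have wa : N (w - a) <= 2 * s by have := cmodB_tri z w a; lra.
  apply: le_trans (cauchy_est2 r0 Gh GM' _) _; first lra.
  apply: ler_wpM2l; first by rewrite !mulr_ge0 ?invr_ge0 ?exprn_ge0 ?(ltW M0) ?(ltW r0).
  by rewrite lerXn2r ?nnegrE ?cmod_ge0// mulr_ge0// ltW.
have := cauchy_est1 s0 Hh HM; rewrite (cdiff_cder (Hd z _)); last lra.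
have -> : 2 * M / r ^+ 2 * (2 * s) ^+ 2 / s = 4 * (2 * M / r ^+ 2 * s).
  by field; rewrite !gt_eqF.
rewrite sb cmodBC => h1; have := cmod_leB (cder G a) (cder G z); rewrite -/be.
by move: h1; move: (N (cder G z)) (N (_ - _)) => x y; lra.
Qed.

(** Were the inequality to fail, [simple_zero] would find a zero of G in the disc with nonzero
    derivative. *)
Lemma ramified_bound G a r M : 0 < r -> hol_disc G a r -> 0 < M ->
  (forall z, N (z - a) <= r -> N (G z) <= M) ->
  (forall z, N (z - a) <= r -> G z = 0 -> cder G z = 0) ->
  N (cder G a) ^+ 2 <= 64 * M / r ^+ 2 * N (G a).
Proof.
move=> r0 Gh M0 GM ram; rewrite leNgt; apply/negP => small.
have b0 : 0 < N (cder G a).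
  rewrite lt_def cmod_ge0 andbT; apply/eqP => b0; move: small.
  rewrite b0 expr0n /= ltNge !mulr_ge0 ?invr_ge0 ?exprn_ge0 ?cmod_ge0 ?(ltW M0) ?(ltW r0)//.
have [|z [zs Gz]] := simple_zero r0 Gh M0 GM b0.
  apply: ltW; move: small; rewrite mulrAC ltr_pdivrMr ?exprn_gt0//.
  by rewrite exprMn.
rewrite (ram z)//; first by rewrite cmod0 => ?; lra.
apply: le_trans zs _; rewrite ler_pdivrMr ?mulr_gt0//.
have : N (cder G a) * r <= M.
  rewrite -ler_pdivlMr//; apply: cauchy_est1 r0 Gh _ => w wr; apply: GM; by rewrite wr.
rewrite expr2 mulrA => h; rewrite [r * _]mulrC; apply: ler_wpM2r; [exact: ltW|lra].
Qed.

(** (z - a)^2 k, set to 0 at a, is differentiable there with derivative 0, so [division] applies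
    twice. *)
Lemma removable k a r M : 0 < r ->
  (forall z, z != a -> N (z - a) <= r -> (exists d, cdiff k z d) /\ N (k z) <= M) ->
  exists2 q, hol_disc q a r & forall z, z != a -> q z = k z.
Proof.
move=> r0 kh; pose p z := (z - a) * ((z - a) * k z).
have pa : p a = 0 by rewrite /p subrr mul0r.
have pd : cdiff p a 0.
  apply: (@cdiff_quad _ _ _ _ r `|M|) => // w wr.
  rewrite pa subr0 mul0r subr0 /p; have [->|wa] := eqVneq w a.
    by rewrite subrr mul0r cmod0 expr2 mul0r mulr0.
  rewrite !cmodM mulrA -expr2 mulrC; apply: ler_wpM2r; first by rewrite exprn_ge0 ?cmod_ge0.
  by apply: le_trans (kh w wa (ltW wr)).2 _; exact: ler_norm.
have ph : hol_disc p a r.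
  move=> z zr; have [->|za] := eqVneq z a; first by exists 0.
  have [[d kd] _] := kh z za zr; eexists.
  have za' : cdiff (fun z => z - a) z (1 - 0).
    by apply: cdiffB; [exact: cdiff_id|exact: cdiff_cst].
  exact: (cdiffM za' (cdiffM za' kd)).
have [q1 [q1h q1E q1a]] := division r0 ph.
have [q [qh qE _]] := division r0 q1h.
exists q => // z za; have za' : z - a != 0 by rewrite subr_eq0.
have := q1E z; rewrite pa add0r qE q1a (cdiff_cder pd) add0r /p.
by move=> /(mulfI za')/(mulfI za').
Qed.

Lemma liouville f M : (forall z, exists d, cdiff f z d) -> (forall z, N (f z) <= M) ->
  forall z, f z = f 0.
Proof.
move=> fh fM z; apply/eqP; rewrite -subr_eq0 -cmod_eq0 eq_le cmod_ge0 andbT.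
have M0 : 0 <= M by apply: le_trans (cmod_ge0 (f 0)) (fM 0).
apply/ler_addgt0Pr => e e0; rewrite add0r.
pose r := 1 + 2 * N z + 2 * M / e * N z.
have x0 : 0 <= 2 * M / e * N z by rewrite !mulr_ge0 ?cmod_ge0 ?invr_ge0 ?(ltW e0).
have z0 := cmod_ge0 z.
have r0 : 0 < r by rewrite /r; lra.
have := @cauchy_lip R f 0 r M z r0 (fun z _ => fh z) (fun z _ => fM z).
rewrite subr0 => /(_ _)/le_trans; apply; first by rewrite /r; lra.
rewrite mulrAC ler_pdivrMr// /r.
rewrite (_ : e * _ = e * (1 + 2 * N z) + 2 * M * N z); last by field; rewrite gt_eqF.
by rewrite lerDr mulr_ge0 ?(ltW e0)//; lra.
Qed.

End Limits.

(** * Spherical derivatives and normality *)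

Section Spherical.
Variable R : realType.
Local Notation C := (cplx R).
Local Notation N := (@cmod R).
Implicit Types (f g : C -> C) (z w a : C) (r s t M K x y e : R) (h : nat -> C -> C).

(** A mean value inequality by continuous induction: the supremum of the good initial segments is
    itself good and cannot lie below 1. The local constant K is kept. *)
Lemma local_lip (psi : R -> R) K :
  (forall t, 0 <= t <= 1 -> exists2 d, 0 < d & forall s, 0 <= s <= 1 -> `|s - t| < d ->
     `|psi s - psi t| <= K * `|s - t|) ->
  `|psi 1 - psi 0| <= K.
Proof.
move=> loc; pose P s := `|psi s - psi 0| <= K * s.
pose S := [set t | 0 <= t <= 1 /\ forall s, 0 <= s <= t -> P s].
have S0 : S 0.
  split=> [|s s0]; first by rewrite lexx ler01.
  by rewrite /P (_ : s = 0) ?subrr ?normr0 ?mulr0//; lra.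
have Sub : ubound S 1 by move=> t [/andP[]].
have hS : has_sup S by split; [exists 0|exists 1].
set c := sup S.
have c0 : 0 <= c by exact: ub_le_sup hS.2 _ S0.
have c1 : c <= 1 by apply: ge_sup => //; exists 0.
have [|d d0 dE] := loc c; first by rewrite c0.
have belowc s : 0 <= s -> s < c -> P s.
  move=> s0 sc; have [|t [_ tS] st] := @sup_adherent _ S (c - s) _ hS; first by rewrite subr_gt0.
  apply: tS; rewrite s0 /=; apply: ltW.
  by move: st; rewrite -/c opprB addrC subrK.
have Pc : P c.
  have [->|c00] := eqVneq c 0; first by rewrite /P subrr normr0 mulr0.
  pose s := Num.max 0 (c - d / 2).
  have s0 : 0 <= s by rewrite le_max lexx.
  have sc : s < c by rewrite gt_max lt_def c00 c0 /=; lra.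
  have sd : c - d / 2 <= s by rewrite le_max lexx orbT.
  have := belowc s s0 sc; rewrite /P => A.
  have B : `|psi s - psi c| <= K * (c - s).
    rewrite -(ger0_norm (_ : 0 <= c - s)) ?subr_ge0 ?(ltW sc)// distrC [in leRHS]distrC distrC.
    by apply: dE; rewrite ?s0 /=; [lra|rewrite ltr_norml; apply/andP; split; lra].
  have := ler_distD (psi s) (psi c) (psi 0); rewrite (distrC (psi c) (psi s)); lra.
suff cE : c = 1 by move: Pc; rewrite /P cE mulr1.
apply/eqP; rewrite eq_le c1 /= leNgt; apply/negP => clt.
have [t [tc t1 td]] : exists t, [/\ c < t, t <= 1 & t <= c + d / 2].
  exists (Num.min 1 (c + d / 2)); rewrite lt_min clt !ge_min !lexx orbT.
  by split=> //=; lra.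
have : S t.
  split=> [|s /andP[s0 st]]; first by rewrite t1 andbT; lra.
  have [sc|cs] := ltP s c; first exact: belowc.
  have B : `|psi s - psi c| <= K * (s - c).
    rewrite -[X in K * X](ger0_norm (_ : 0 <= s - c)) ?subr_ge0//.
    by apply: dE; [lra|rewrite ltr_norml; apply/andP; split; lra].
  have := ler_distD (psi c) (psi s) (psi 0); rewrite /P in Pc *; lra.
by move=> /(ub_le_sup hS.2); rewrite leNgt tc.
Qed.

(** The spherical derivative |f'| / (1 + |f|^2) is at most K at z. *)
Definition sph_le f K z := N (cder f z) <= K * (1 + N (f z) ^+ 2).

(** The factor (x + y)/(1 + y^2) is at most 3/2, because x <= y + 1/2 and 3 y^2 - 4 y + 2 = 3 (y -
    2/3)^2 + 2/3. *)
Lemma psi_est x y e : 0 <= x -> 0 <= y -> `|y - x| <= e -> e <= 1 / 2 ->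
  `|(1 + y ^+ 2)^-1 - (1 + x ^+ 2)^-1| <= 3 / 2 * e / (1 + x ^+ 2).
Proof.
move=> x0 y0 yx e2.
have X0 : 0 < 1 + x ^+ 2 by rewrite ltr_pwDl// sqr_ge0.
have Y0 : 0 < 1 + y ^+ 2 by rewrite ltr_pwDl// sqr_ge0.
have -> : (1 + y ^+ 2)^-1 - (1 + x ^+ 2)^-1 = (x - y) * ((x + y) / (1 + y ^+ 2)) / (1 + x ^+ 2).
  by field; rewrite !gt_eqF.
rewrite normrM [X in _ * X]ger0_norm ?invr_ge0 ?(ltW X0)//.
rewrite ler_wpM2r ?invr_ge0 ?(ltW X0)//.
rewrite normrM distrC mulrC; apply: ler_pM => //.
rewrite ger0_norm; last by apply: divr_ge0; [exact: addr_ge0|exact: ltW].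
rewrite ler_pdivrMr//.
have : x <= y + 1 / 2 by move: yx; rewrite ler_norml => /andP[? ?]; lra.
have := sqr_ge0 (y - 2 / 3); rewrite sqrrB; nra.
Qed.

(** 1/(1 + |f|^2) is small where f is large and bounded below where f is bounded, so one Lipschitz
    bound controls both alternatives of normality. The constant 2 is 3/2 from [psi_est] times 4/3,
    the linear error being at most K/3. *)
Lemma psi_lip f a r K z : hol_disc f a r -> 0 < K ->
  (forall w, N (w - a) <= r -> sph_le f K w) -> N (z - a) <= r ->
  `|(1 + N (f z) ^+ 2)^-1 - (1 + N (f a) ^+ 2)^-1| <= 2 * K * N (z - a).
Proof.
move=> fh K0 fK zr.
pose p t := a + rc t * (z - a).
have p1 : p 1 = z by rewrite /p rc1 mul1r addrC subrK.
have p0 : p 0 = a by rewrite /p rc0 mul0r addr0.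
have pB s t : N (p s - p t) = `|s - t| * N (z - a).
  rewrite -cmod_rc -cmodM rcB; congr N; rewrite /p; ring.
rewrite -{1}p1 -{1}p0.
apply: (@local_lip (fun t => (1 + N (f (p t)) ^+ 2)^-1)) => t /andP[t0 t1].
have pr : N (p t - a) <= r.
  rewrite -p0 pB subr0 ger0_norm//; apply: le_trans zr.
  by rewrite ler_piMl// cmod_ge0.
have fd := hol_disc_cdiff fh pr.
have K3 : 0 < K / 3 by rewrite divr_gt0.
have [d1 d10 d1E] := fd _ K3.
have h2 : 0 < (1 / 2 : R) by [].
have [d2 d20 d2E] := cdiff_cont fd h2.
have z1 : 0 < 1 + N (z - a) by rewrite ltr_pwDl// cmod_ge0.
exists (Num.min d1 d2 / (1 + N (z - a))); first by rewrite divr_gt0// lt_min d10.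
move=> s _; rewrite ltr_pdivlMr// => st.
have : N (p s - p t) < Num.min d1 d2.
  by rewrite pB; apply: le_lt_trans st; rewrite ler_wpM2l// lerDr.
rewrite lt_min => /andP[/d1E A /d2E B].
pose e := N (f (p s) - f (p t)).
have X0 : 0 < 1 + N (f (p t)) ^+ 2 by rewrite ltr_pwDl// sqr_ge0.
have X1 : 1 <= 1 + N (f (p t)) ^+ 2 by rewrite lerDl sqr_ge0.
have H := psi_est (cmod_ge0 (f (p t))) (cmod_ge0 (f (p s))) (_ : _ <= e) B.
apply: le_trans (H _) _.
  rewrite ler_norml; have := cmod_leB (f (p s)) (f (p t)); have := cmod_leB (f (p t)) (f (p s)).
  by rewrite cmodBC -/e => h3 h4; apply/andP; split; lra.
rewrite ler_pdivrMr//.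
have E : e <= 4 / 3 * K * (1 + N (f (p t)) ^+ 2) * N (p s - p t).
  have h3 : e <= N (f (p s) - f (p t) - cder f (p t) * (p s - p t)) + N (cder f (p t) * (p s - p t)).
    by apply: le_trans (cmodD _ _); rewrite subrK.
  apply: le_trans h3 _; rewrite cmodM.
  have h4 : N (cder f (p t)) * N (p s - p t) <= K * (1 + N (f (p t)) ^+ 2) * N (p s - p t).
    by apply: ler_wpM2r; [exact: cmod_ge0|exact: fK].
  have h5 : K / 3 * N (p s - p t) <= K / 3 * (1 + N (f (p t)) ^+ 2) * N (p s - p t).
    by rewrite -[leRHS]mulrA ler_wpM2l ?(ltW K3)// ler_peMl// cmod_ge0.
  have -> : 4 / 3 * K * (1 + N (f (p t)) ^+ 2) * N (p s - p t) =
     K / 3 * (1 + N (f (p t)) ^+ 2) * N (p s - p t) + K * (1 + N (f (p t)) ^+ 2) * N (p s - p t).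
    by field.
  by apply: lerD => //; apply: le_trans h5.
apply: le_trans (ler_wpM2l _ E) _ => //.
by rewrite pB le_eqVlt; apply/orP; left; apply/eqP; field.
Qed.

(** From |f a| >= 2 the function of [psi_lip] is at most 1/5 at a; it changes by at most 3/10, so it
    stays below 1/2. *)
Lemma sph_large f a r K z : hol_disc f a r -> 0 < K ->
  (forall w, N (w - a) <= r -> sph_le f K w) -> N (z - a) <= r ->
  20 * K * N (z - a) <= 3 -> 2 <= N (f a) -> 1 <= N (f z).
Proof.
move=> fh K0 fK zr zK fa; have := psi_lip fh K0 fK zr.
have A : (1 + N (f a) ^+ 2)^-1 <= 5^-1.
  rewrite lef_pV2 ?posrE ?ltr_pwDl ?sqr_ge0//.
  have : 2 ^+ 2 <= N (f a) ^+ 2 by rewrite lerXn2r ?nnegrE// cmod_ge0.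
  lra.
move=> B; have {}B : (1 + N (f z) ^+ 2)^-1 <= 2^-1.
  by move: B; rewrite ler_norml => /andP[_ B]; lra.
move: B; rewrite lef_pV2 ?posrE ?ltr_pwDl ?sqr_ge0// => B.
rewrite leNgt; apply/negP => fz.
have : N (f z) ^+ 2 < 1 by rewrite expr_lt1// cmod_ge0.
lra.
Qed.

(** The function of [psi_lip] is at least 1/(1 + M^2) at a and loses at most half of that, so |f
    z|^2 <= 1 + 2 M^2. *)
Lemma sph_bounded f a r K z M : hol_disc f a r -> 0 < K ->
  (forall w, N (w - a) <= r -> sph_le f K w) -> N (z - a) <= r ->
  4 * K * (1 + M ^+ 2) * N (z - a) <= 1 -> N (f a) <= M -> N (f z) <= 2 + 2 * M ^+ 2.
Proof.
move=> fh K0 fK zr zK fa; have := psi_lip fh K0 fK zr.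
have M0 : 0 < 1 + M ^+ 2 by rewrite ltr_pwDl// sqr_ge0.
have A : (1 + M ^+ 2)^-1 <= (1 + N (f a) ^+ 2)^-1.
  rewrite lef_pV2 ?posrE ?ltr_pwDl ?sqr_ge0//.
  rewrite lerD2l lerXn2r ?nnegrE// ?cmod_ge0//; exact: le_trans (cmod_ge0 _) fa.
have D : 2 * K * N (z - a) <= (1 + M ^+ 2)^-1 / 2.
  have -> : (1 + M ^+ 2)^-1 / 2 = 1 / (2 * (1 + M ^+ 2)) by field; rewrite gt_eqF.
  by rewrite ler_pdivlMr ?mulr_gt0//; lra.
rewrite ler_norml => /andP[B _].
have {}B : (1 + M ^+ 2)^-1 / 2 <= (1 + N (f z) ^+ 2)^-1 by lra.
rewrite -invfM lef_pV2 ?posrE ?mulr_gt0 ?ltr_pwDl ?sqr_ge0// in B.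
have [h|h] := leP (N (f z)) 1; first by have := sqr_ge0 M; lra.
have : N (f z) <= N (f z) ^+ 2 by rewrite expr2 ler_peMl// ?cmod_ge0 ?ltW.
lra.
Qed.

(** [sph_large] is valid up to radius min r (3/(20 K)). The limit of 1/h_n is controlled on half
    that disc, and [zero_order] tests it on half of that again: hence the quarter. *)
Definition escape r K : R := Num.min r (3 / (20 * K)) / 4.

Lemma escape_gt0 r K : 0 < r -> 0 < K -> 0 < escape r K.
Proof. by move=> r0 K0; rewrite divr_gt0// lt_min r0 divr_gt0// mulr_gt0. Qed.

(** The limit v of 1/h_n vanishes at a. If v were not identically 0 nearby, its zero at a would be
    isolated, so |1/h_n| would be bounded below on a small circle; the maximum principle for h_n
    would then bound h_n(a), which tends to infinity. *)
Lemma sph_escape h a r K : 0 < r -> 0 < K ->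
  (\forall n \near ultra, hol_disc (h n) a r /\ forall z, N (z - a) <= r -> sph_le (h n) K z) ->
  (forall M, \forall n \near ultra, M < N (h n a)) ->
  forall M, \forall n \near ultra, forall z, N (z - a) <= escape r K -> M < N (h n z).
Proof.
move=> r0 K0 hh ha.
have [c [c0 cr cK cE]] : exists c, [/\ 0 < c, c <= r, 20 * K * c <= 3 & escape r K = c / 4].
  exists (Num.min r (3 / (20 * K))); split=> //.
  - by rewrite lt_min r0 divr_gt0// mulr_gt0.
  - by rewrite ge_min lexx.
  - by rewrite mulrC -ler_pdivlMr ?mulr_gt0// ge_min lexx orbT.
have large : \forall n \near ultra, hol_disc (h n) a r /\ forall z, N (z - a) <= c -> 1 <= N (h n z).
  apply: filterS2 hh (ha 2) => n [A B] D; split=> // z zc.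
  apply: (sph_large A K0 B) => //; [lra| |exact: ltW].
  by apply: le_trans cK; rewrite ler_pM2l// mulr_gt0.
pose u n z := (h n z)^-1.
have uh : \forall n \near ultra, hol_disc (u n) a c /\ forall z, N (z - a) <= c -> N (u n z) <= 1.
  apply: filterS large => n [A B]; split=> z zc.
    have [|d dE] := A z; first lra.
    eexists; apply: cdiffV dE; rewrite -cmod_gt0; have := B z zc; lra.
  by rewrite /u cmodV invf_le1//; have := B z zc; lra.
pose v z := ulim (u ^~ z).
have vh : hol_disc v a (c / 2).
  by move=> z zc; exists (cder v z); exact: (ulim_cdiff c0 uh zc).1.
have c2 : 0 < c / 2 by rewrite divr_gt0.
have vunif e : 0 < e -> \forall n \near ultra, forall z, N (z - a) <= c / 2 -> N (u n z - v z) <= e.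
  exact: (ulim_unif c0 uh).
have aa : N (a - a) <= c / 2 by rewrite subrr cmod0 ltW.
have inv_lt M x : 0 < M -> 0 < x -> x^-1 < M^-1 -> M < x.
  by move=> ? ?; rewrite ltf_pV2 ?posrE.
have va : v a = 0.
  apply/eqP; rewrite -cmod_eq0 eq_le cmod_ge0 andbT; apply/ler_addgt0Pr => e e0; rewrite add0r.
  have aac : N (a - a) <= c by rewrite subrr cmod0 ltW.
  apply: ucvg_le (ulim_disc uh aac) _.
  apply: filterS (ha e^-1) => n A; rewrite /u cmodV -[e]invrK.
  rewrite lef_pV2 ?posrE ?invr_gt0 ?(ltW A)//.
  by apply: lt_trans A; rewrite invr_gt0.
have [v0|[z0 [z0c vz0]]] : (forall z, N (z - a) <= c / 4 -> v z = 0) \/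
    exists z, N (z - a) <= c / 4 /\ v z != 0.
  have [[z zE]|nz] := pselect (exists z, N (z - a) <= c / 4 /\ v z != 0); first by right; exists z.
  by left => z zc; apply/eqP/negPn/negP => vz; apply: nz; exists z.
  move=> M; pose M1 := 1 + `|M|; have M10 : 0 < M1 by rewrite ltr_pwDl.
  have M1v : 0 < (2 * M1)^-1 by rewrite invr_gt0 mulr_gt0.
  apply: filterS2 large (vunif _ M1v) => n [_ A] B z; rewrite cE => zc.
  have := B z; rewrite v0// subr0 /u cmodV => /(_ _)D.
  have {}D : (N (h n z))^-1 <= (2 * M1)^-1 by apply: D; lra.
  have hz : 0 < N (h n z) by have := A z; lra.
  rewrite lef_pV2 ?posrE ?mulr_gt0// in D.
  by apply: lt_le_trans D; rewrite /M1; have := ler_norm M; have := normr_ge0 M; lra.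
exfalso.
have [|m [g [gh ga gE]]] := zero_order c2 vh.
  by exists z0 => //; lra.
have ga0 : 0 < N (g a) by rewrite cmod_gt0.
have [d d0 dE] : exists2 d, 0 < d & forall w, N (w - a) < d -> N (g w - g a) <= N (g a) / 2.
  by apply: (hol_disc_cont gh aa); rewrite divr_gt0.
have [s [s0 sd sc]] : exists s, [/\ 0 < s, s < d & s <= c / 4].
  exists (Num.min (d / 2) (c / 4)); split.
  - by rewrite lt_min !divr_gt0.
  - by rewrite gt_min; apply/orP; left; lra.
  - by rewrite ge_min lexx orbT.
pose eta := s ^+ m * (N (g a) / 2).
have eta0 : 0 < eta by rewrite mulr_gt0 ?exprn_gt0// divr_gt0.
have [n _ [[A B] D]] := ultra_ex 0 (filterI (filterI large (vunif _ (divr_gt0 eta0 (ltr0n _ 2)))) (ha (2 / eta))).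
have : N (h n a) <= 2 / eta.
  apply: (max_modulus s0 (hol_discS A.1 _)); first by rewrite subrr cmod0; lra.
  move=> t _; set z := a + polar s t.
  have za : N (z - a) = s by rewrite /z [a + _]addrC addrK cmod_polar gtr0_norm.
  have Bz : N (u n z - v z) <= eta / 2 by apply: B; rewrite za; lra.
  have vz : eta <= N (v z).
    rewrite gE cmodM cmodX za /eta ler_wpM2l ?exprn_ge0 ?(ltW s0)//.
    have := dE z; rewrite za => /(_ sd); have := cmod_leB (g a) (g z); rewrite cmodBC; lra.
  have uz : eta / 2 <= N (u n z) by have := cmod_leB (v z) (u n z); rewrite cmodBC; lra.
  move: uz; rewrite /u cmodV -[2 / eta]invrK invf_div => uz.
  have hz : 0 < N (h n z) by have := A.2 z; rewrite za; lra.
  by rewrite -[N (h n z)]invrK lef_pV2 ?posrE ?invr_gt0// divr_gt0.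
by rewrite leNgt D.
Qed.

End Spherical.

(** * Normality from bounded spherical derivatives *)

Section Normality.
Variable R : realType.
Local Notation C := (cplx R).
Local Notation N := (@cmod R).
Implicit Types (f g : C -> C) (z w a : C) (r s t M K x y e : R) (h : nat -> C -> C).

Definition ulimf h z := ulim (h ^~ z).

Definition ubdd h a := exists M s, 0 < s /\
  \forall n \near ultra, hol_disc (h n) a s /\ forall z, N (z - a) <= s -> N (h n z) <= M.

Lemma ubdd_cdiff h z : ubdd h z ->
  [/\ cdiff (ulimf h) z (cder (ulimf h) z), ucvg (h ^~ z) (ulimf h z) &
   ucvg (fun n => cder (h n) z) (cder (ulimf h) z)].
Proof.
move=> [M [s [s0 H]]].
have zz : N (z - z) <= s / 2 by rewrite subrr cmod0 divr_ge0// ltW.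
have zs : N (z - z) <= s by rewrite subrr cmod0 ltW.
have [A B] := ulim_cdiff s0 H zz; split=> //; exact: (ulim_disc H zs).
Qed.

Lemma ubdd_unif h a r : (forall z, N (z - a) <= r -> ubdd h z) ->
  forall e, 0 < e -> \forall n \near ultra, forall z, N (z - a) <= r -> N (h n z - ulimf h z) <= e.
Proof.
move=> hb e e0.
case: (ultra_em (fun n => forall z, N (z - a) <= r -> N (h n z - ulimf h z) <= e)) => // K.
have [r0|r0] := ltP r 0.
  by apply: nearW => n z zr; have := cmod_ge0 (z - a); rewrite leNgt (le_lt_trans zr).
have aa : N (a - a) <= r by rewrite subrr cmod0.
have /choice[z_ zE] : forall n, exists z, N (z - a) <= r /\
    (~ (forall z, N (z - a) <= r -> N (h n z - ulimf h z) <= e) -> e < N (h n z - ulimf h z)).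
  move=> n; have [[z [zr ez]]|nz] := pselect (exists z, N (z - a) <= r /\ e < N (h n z - ulimf h z)).
    by exists z.
  exists a; split=> // H; exfalso; apply: H => z zr; rewrite leNgt; apply/negP => ez.
  by apply: nz; exists z.
have [l zl lr] := disc_ulim (fun n => (zE n).1).
have [M [s [s0 H]]] := hb l lr.
have s2 : 0 < s / 2 by rewrite divr_gt0.
have [n _ [[A B] D]] := ultra_ex 0 (filterI (filterI K (ulim_unif s0 H e0)) (zl _ s2)).
have := (zE n).2 A; rewrite ltNge => /negP; case; exact: B.
Qed.

(** Diagonal extraction: at stage m an index beyond the previous one is drawn from the m-th event,
    which the free ultrafilter realizes arbitrarily far out. *)
Lemma ultra_subseq (P : nat -> nat -> Prop) : (forall m, \forall n \near ultra, P m n) ->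
  exists2 s : nat -> nat, {homo s : m n / (m < n)%N} & forall m, P m (s m).
Proof.
move=> PU; have /choice[p pE] : forall mk : nat * nat, exists n, (mk.2 <= n)%N /\ P mk.1 n.
  by move=> [m k]; have [n ? ?] := ultra_ex k (PU m); exists n.
pose s := fix s m := if m is m'.+1 then p (m, (s m').+1) else p (0%N, 0%N).
exists s; last by case=> [|m]; [exact: (pE (0%N, 0%N)).2|exact: (pE (m.+1, _)).2].
by apply: homo_ltn => [|m]; [exact: ltn_trans|exact: (pE (m.+1, (s m).+1)).1].
Qed.

Lemma escape_le r K : 0 < r -> escape r K <= r / 4.
Proof. by move=> r0; rewrite /escape ler_pM2r// ge_min lexx. Qed.

Lemma sph_ubdd h a r K : 0 < r -> 0 < K ->
  (\forall n \near ultra, hol_disc (h n) a r /\ forall z, N (z - a) <= r -> sph_le (h n) K z) ->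
  (exists M, \forall n \near ultra, N (h n a) <= M) -> ubdd h a.
Proof.
move=> r0 K0 hh [M hM].
have M1 : 0 < 1 + M ^+ 2 by rewrite ltr_pwDl// sqr_ge0.
exists (2 + 2 * M ^+ 2); exists (Num.min r (1 / (4 * K * (1 + M ^+ 2)))).
split; first by rewrite lt_min r0 divr_gt0 ?mulr_gt0.
apply: filterS2 hh hM => n [A B] D; split=> [|z].
  by apply: (hol_discS A); rewrite subrr cmod0 add0r ge_min lexx.
rewrite le_min => /andP[z1 z2]; apply: (sph_bounded A K0 B z1) => //.
by move: z2; rewrite ler_pdivlMr ?mulr_gt0// mulrC.
Qed.

(** The ultrafilter settles whether h_n(a) is bounded or tends to infinity, and the spherical bound
    spreads either behaviour to a neighbourhood. *)
Lemma ubdd_or_escape h a r K : 0 < r -> 0 < K ->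
  (\forall n \near ultra, hol_disc (h n) a r /\ forall z, N (z - a) <= r -> sph_le (h n) K z) ->
  ubdd h a \/ forall M, \forall n \near ultra, forall z, N (z - a) <= escape r K -> M < N (h n z).
Proof.
move=> r0 K0 hh.
have [hM|hM] := pselect (exists M, \forall n \near ultra, N (h n a) <= M).
  by left; exact: sph_ubdd hh hM.
right; apply: (sph_escape r0 K0 hh) => M.
have [H|H] := ultra_em (fun n => N (h n a) <= M); first by exfalso; apply: hM; exists M.
by apply: filterS H => n /negP; rewrite -ltNge.
Qed.

Lemma ubdd_point h a : ubdd h a -> exists M, \forall n \near ultra, N (h n a) <= M.
Proof.
move=> [M [s [s0 H]]]; exists M; apply: filterS H => n [_]; apply.
by rewrite subrr cmod0 ltW.
Qed.

(** If h escaped at z, it would escape on the disc of radius [escape r K], which contains a. This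
    radius depends only on r and K, so boundedness spreads along chains of fixed step. *)
Lemma ubdd_near h a z r K : 0 < r -> 0 < K ->
  (\forall n \near ultra, hol_disc (h n) z r /\ forall w, N (w - z) <= r -> sph_le (h n) K w) ->
  N (a - z) <= escape r K -> ubdd h a -> ubdd h z.
Proof.
move=> r0 K0 hh az /ubdd_point[M hM]; have [//|H] := ubdd_or_escape r0 K0 hh.
have [n _ [A B]] := ultra_ex 0 (filterI hM (H M)).
by move: A; rewrite leNgt B.
Qed.

(** The sufficient half of Marty's criterion. The alternative between boundedness and escape is
    decided at a and then holds on the whole disc of radius [rho]. *)
Lemma sph_normal (F : set (C -> C)) (a : C) r K : 0 < r -> 0 < K ->
  (forall f, F f -> hol_disc f a r /\ forall z, N (z - a) <= r -> sph_le f K z) ->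
  normal_at F a.
Proof.
move=> r0 K0 FK; have r2 : 0 < r / 2 by rewrite divr_gt0.
pose rho := escape (r / 2) K; have rho0 : 0 < rho := escape_gt0 r2 K0.
have rhor : rho <= r / 2 / 4 by exact: escape_le.
pose G := [set z : C | N (z - a) < rho].
have Gnbhs z : G z -> nbhs z G.
  rewrite /G /= => za; apply/nbhs_cmod; exists (rho - N (z - a)); first by rewrite subr_gt0.
  by move=> w wz /=; have := cmodB_tri z w a; lra.
exists G.
  split; first by rewrite openE => z; exact: Gnbhs.
  by rewrite /G /= subrr cmod0.
move=> h hF.
have hz z : N (z - a) <= r / 2 -> \forall n \near ultra, hol_disc (h n) z (r / 2) /\
    forall w, N (w - z) <= r / 2 -> sph_le (h n) K w.
  move=> zr; apply: nearW => n; have [A B] := FK _ (hF n); split.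
    by apply: (hol_discS A); lra.
  by move=> w wz; apply: B; have := cmodB_tri z w a; lra.
have aa : N (a - a) <= r / 2 by rewrite subrr cmod0 ltW.
have [ha|ha] := ubdd_or_escape r2 K0 (hz a aa); last first.
  have [s s_mono sE] := ultra_subseq (fun m => ha m%:R).
  exists s => //; right => z Gz; exists G; first exact: Gnbhs.
  move=> M; exists (Num.bound M) => //= n Mn w Gw.
  apply: le_lt_trans (sE n w _); last by apply: ltW.
  have [M0|M0] := leP 0 M.
    by apply: ltW; apply: lt_le_trans (archi_boundP M0) _; rewrite ler_nat.
  by apply: le_trans (ltW M0) _; rewrite ler0n.
have hub z : N (z - a) <= rho -> ubdd h z.
  move=> za; apply: (ubdd_near r2 K0 (hz z _) _ ha); first by lra.
  by rewrite cmodBC.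
have hunif m : \forall n \near ultra, forall z, N (z - a) <= rho ->
    N (h n z - ulimf h z) <= m.+1%:R^-1.
  by apply: (ubdd_unif hub); rewrite invr_gt0.
have [s s_mono sE] := ultra_subseq hunif.
exists s => //; left; exists (ulimf h).
  move=> z Gz; have [A _ _] := ubdd_cdiff (hub z (ltW Gz)); exact: cdiff_derivable A.
move=> z Gz; exists G; first exact: Gnbhs.
apply: uniform_cvg_cmod => e e0.
exists (Num.bound e^-1) => //= n en w Gw.
apply: le_trans (sE n w (ltW Gw)) _.
rewrite invf_ple ?posrE//; apply: ltW.
have := archi_boundP (ltW (_ : 0 < e^-1)); rewrite invr_gt0 => /(_ e0) H.
by apply: lt_le_trans H _; rewrite ler_nat leqW.
Qed.

End Normality.

(** * Zalcman's lemma *)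

Section Zalcman.
Variable R : realType.
Local Notation C := (cplx R).
Local Notation N := (@cmod R).
Implicit Types (f g : C -> C) (z w a p : C) (r s t M K x y e rho : R) (h : nat -> C -> C).

Definition ent f := forall z, exists d, cdiff f z d.

Lemma ent_hol f a r : ent f -> hol_disc f a r.
Proof. by move=> fe z _. Qed.

Lemma ent_cdiff f z : ent f -> cdiff f z (cder f z).
Proof. by move=> /(_ z)[d fd]; rewrite (cdiff_cder fd). Qed.

Lemma cdiff_affine f p (c z : C) d : cdiff f (p + c * z) d ->
  cdiff (fun w => f (p + c * w)) z (d * c).
Proof.
move=> fd; have H : cdiff (fun w => p + c * w) z (0 + (0 * z + c * 1)).
  apply: cdiffD; first exact: cdiff_cst.
  by apply: cdiffM; [exact: cdiff_cst|exact: cdiff_id].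
have := cdiff_comp H fd; by rewrite mul0r !add0r mulr1.
Qed.

(** Within m/2 of p the distance to the boundary is at least m/2, so the spherical derivative is at
    most 4 times that at p; the scale rho = 1 / A p makes it 1 at the origin. As K r < 2 A p m, the
    disc of radius K r / 4 fits after rescaling. *)
Lemma rescale f a r K z : ent f -> 0 < r -> 0 < K -> N (z - a) <= r ->
  K * (1 + N (f z) ^+ 2) < N (cder f z) ->
  exists p rho, [/\ N (p - a) <= 2 * r, 0 < rho <= 4 / K,
    forall w, N w <= K * r / 4 -> sph_le (fun u => f (p + rc rho * u)) 4 w &
    N (cder (fun u => f (p + rc rho * u)) 0) = 1 + N (f (p + rc rho * 0)) ^+ 2].
Proof.
move=> fe r0 K0 za fz.
have X0 w : 0 < 1 + N (f w) ^+ 2 by rewrite ltr_pwDl// sqr_ge0.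
pose A w := N (cder f w) / (1 + N (f w) ^+ 2).
have A0 w : 0 <= A w by rewrite divr_ge0 ?cmod_ge0 ?ltW.
have AE w : N (cder f w) = A w * (1 + N (f w) ^+ 2) by rewrite /A divfK// gt_eqF.
have Az : K < A z by rewrite /A ltr_pdivlMr.
(* Zalcman's weight: spherical derivative times distance to the circle of radius 2 r. A point within
   a factor 2 of the supremum suffices, so no maximum has to be attained. *)
pose S w := A w * (2 * r - N (w - a)).
have Sz : K * r < S z.
  apply: (@lt_le_trans _ _ (A z * r)); first by rewrite ltr_pM2r.
  by rewrite /S ler_wpM2l//; lra.
pose V := [set y | exists2 w, N (w - a) <= 2 * r & y = S w].
have dh : hol_disc (cder f) a (2 * r).
  by move=> w _; apply: (@cder_hol _ f w 1 ltr01); exact: ent_hol.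
have [B B0 BE] := hol_bounded dh.
have hS : has_sup V.
  split; first by exists (S z), z => //; lra.
  exists (B * (2 * r)) => _ [w wr ->]; have w0 := cmod_ge0 (w - a).
  apply: ler_pM; [exact: A0|lra| |lra].
  rewrite /A ler_pdivrMr//; apply: le_trans (BE w wr) _.
  by rewrite ler_peMr ?(ltW B0)// lerDl sqr_ge0.
have Vz : V (S z) by exists z => //; lra.
have sup0 : K * r < sup V by apply: lt_le_trans Sz _; exact: ub_le_sup hS.2 _ Vz.
have Kr : 0 < K * r by rewrite mulr_gt0.
have [|_ [p pr ->] Sp] := @sup_adherent _ V (sup V / 2) _ hS; first by rewrite divr_gt0//; lra.
have {}Sp : sup V < 2 * S p by lra.
have SpE w : N (w - a) <= 2 * r -> S w <= 2 * S p.
  by move=> wr; apply: le_trans (ltW Sp); apply: (ub_le_sup hS.2); exists w.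
pose m := 2 * r - N (p - a).
have SpE' : S p = A p * m by [].
have Sp0 : K * r < 2 * S p by lra.
have m0 : 0 < m.
  have : m != 0 by apply/eqP => mE; rewrite SpE' mE mulr0 in Sp0; lra.
  by rewrite lt_def => -> /=; rewrite /m; lra.
have Ap0 : 0 < A p.
  by rewrite lt_def A0 andbT; apply/eqP => Ap; rewrite SpE' Ap mul0r in Sp0; lra.
have Npa := cmod_ge0 (p - a).
exists p, (A p)^-1; split => //.
- have -> : 4 / K = (K / 4)^-1 by rewrite invf_div.
  have K4 : 0 < K / 4 by rewrite divr_gt0.
  rewrite invr_gt0 Ap0 /= lef_pV2 ?posrE// ler_pdivrMr//.
  have : A p * m <= A p * (2 * r) by rewrite ler_pM2l// /m; lra.
  rewrite -SpE' => h; have : K * r < A p * 4 * r by lra.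
  by rewrite ltr_pM2r// => /ltW.
- move=> w wR; rewrite /sph_le.
  set v := p + rc (A p)^-1 * w.
  rewrite (cdiff_cder (cdiff_affine (ent_cdiff v fe))) cmodM cmod_rc ger0_norm ?invr_ge0//.
  have vp : N (v - p) <= m / 2.
    rewrite /v [p + _]addrC addrK cmodM cmod_rc ger0_norm ?invr_ge0// mulrC ler_pdivrMr//.
    rewrite mulrC mulrA -SpE'; lra.
  have va : N (v - a) <= N (p - a) + m / 2 by have := cmodB_tri p v a; lra.
  have mv : m / 2 <= 2 * r - N (v - a) by rewrite /m in va *; lra.
  have Sv : S v <= 2 * S p by apply: SpE; lra.
  have h : A v * (m / 2) <= 4 * A p * (m / 2).
    apply: (@le_trans _ _ (S v)); first by rewrite /S ler_wpM2l.
    by apply: le_trans Sv _; rewrite SpE'; lra.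
  rewrite ler_pM2r ?divr_gt0// in h.
  rewrite AE ler_pdivrMr// [leRHS]mulrAC; apply: ler_wpM2r; [exact: ltW|exact: h].
- have fe0 := ent_cdiff (p + rc (A p)^-1 * 0) fe.
  rewrite (cdiff_cder (cdiff_affine fe0)) cmodM cmod_rc ger0_norm ?invr_ge0//.
  by rewrite mulr0 addr0 AE mulrAC divff ?mul1r// gt_eqF.
Qed.

(** [sph_normal] must fail on the disc of radius r = 1/(n+1) with bound K = (n+1)^2; the point of
    failure is the input of [rescale], and K r = n + 1 lets the controlled discs exhaust the
    plane. *)
Lemma zalcman (F : set (C -> C)) a : (forall f, F f -> ent f) -> ~ normal_at F a ->
  exists (phi : nat -> C -> C) (p : nat -> C) (rho : nat -> R), [/\ forall n, F (phi n),
    forall n, N (p n - a) <= 2 / n.+1%:R, forall n, 0 < rho n <= 4 / n.+1%:R,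
    forall n w, N w <= n.+1%:R / 4 -> sph_le (fun u => phi n (p n + rc (rho n) * u)) 4 w &
    forall n, N (cder (fun u => phi n (p n + rc (rho n) * u)) 0) =
      1 + N (phi n (p n + rc (rho n) * 0)) ^+ 2].
Proof.
move=> Fe nF.
have H n : exists q : (C -> C) * C * R, [/\ F q.1.1,
    N (q.1.2 - a) <= 2 / n.+1%:R, 0 < q.2 <= 4 / n.+1%:R,
    forall w, N w <= n.+1%:R / 4 -> sph_le (fun u => q.1.1 (q.1.2 + rc q.2 * u)) 4 w &
    N (cder (fun u => q.1.1 (q.1.2 + rc q.2 * u)) 0) =
      1 + N (q.1.1 (q.1.2 + rc q.2 * 0)) ^+ 2].
  have n0 : 0 < n.+1%:R^-1 :> R by rewrite invr_gt0.
  have K0 : 0 < n.+1%:R ^+ 2 :> R by rewrite exprn_gt0.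
  have [f [z [Ff za fz]]] : exists f z, [/\ F f, N (z - a) <= n.+1%:R^-1 &
     n.+1%:R ^+ 2 * (1 + N (f z) ^+ 2) < N (cder f z)].
    apply: contrapT => K; apply: nF; apply: (sph_normal n0 K0) => f Ff; split.
      by apply: ent_hol; exact: Fe.
    by move=> z za; rewrite /sph_le leNgt; apply/negP => fz; apply: K; exists f, z.
  have [p [rho [p1 /andP[p2 p3] p4 p5]]] := rescale (Fe _ Ff) n0 K0 za fz.
  exists (f, p, rho); split => //=.
  - rewrite p2; apply: le_trans p3 _; rewrite ler_wpM2l// lef_pV2 ?posrE//.
    by rewrite expr2 ler_peMl// ler1n.
  - move=> w wn; apply: p4; apply: le_trans wn _.
    by rewrite expr2 mulfK// gt_eqF.
have [q qE] := choice H.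
exists (fun n => (q n).1.1), (fun n => (q n).1.2), (fun n => (q n).2).
by split=> n; have [] := qE n.
Qed.

(** The normalization at 0 excludes escape: if |h_n| > 2/ep on the disc of radius ep, Cauchy's
    estimate gives |(1/h_n)'(0)| <= 1/2, whereas this number is (1 + |h_n(0)|^2) / |h_n(0)|^2 >
    1. *)
Lemma zalcman_limit h : (forall n, ent (h n)) ->
  (forall n w, N w <= n.+1%:R / 4 -> sph_le (h n) 4 w) ->
  (forall n, N (cder (h n) 0) = 1 + N (h n 0) ^+ 2) ->
  [/\ forall z, ubdd h z, ent (ulimf h), forall z, sph_le (ulimf h) 4 z & 1 <= N (cder (ulimf h) 0)].
Proof.
move=> he hs h0; have K0 : (0 : R) < 4 by [].
have loc z : \forall n \near ultra, hol_disc (h n) z 1 /\ forall w, N (w - z) <= 1 -> sph_le (h n) 4 w.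
  apply: filterS (ultra_big (4 * (1 + N z))) => n nz; split; first exact: ent_hol.
  by move=> w wz; apply: hs; have := cmod_leB w z; lra.
pose ep := escape 1 (4 : R); have ep0 : 0 < ep := escape_gt0 ltr01 K0.
have ub0 : ubdd h 0.
  have [//|H] := ubdd_or_escape ltr01 K0 (loc 0).
  have [n _ nE] := ultra_ex 0 (H (2 / ep)); exfalso.
  have M0 : 0 < 2 / ep by rewrite divr_gt0.
  have nz z : N (z - 0) <= ep -> h n z != 0.
    by move=> zr; rewrite -cmod_gt0; apply: lt_trans (nE z zr).
  have uh : hol_disc (fun z => (h n z)^-1) 0 ep.
    move=> z zr; eexists; apply: cdiffV; [exact: nz|exact: ent_cdiff].
  have z0 : N (0 - 0 : C) <= ep by rewrite subrr cmod0 ltW.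
  have := cauchy_est1 ep0 uh (M := ep / 2).
  rewrite (cdiff_cder (cdiffV (nz 0 z0) (ent_cdiff 0 (he n)))) cmodM cmodN cmodV cmodX h0.
  have X0 : 0 < N (h n 0) ^+ 2 by rewrite exprn_gt0// cmod_gt0 nz.
  have -> : ep / 2 / ep = 2^-1 by field; rewrite gt_eqF.
  move=> D.
  have {}D : (1 + N (h n 0) ^+ 2) / N (h n 0) ^+ 2 <= 2^-1.
    apply: D => z zr; have -> : ep / 2 = (2 / ep)^-1 by rewrite invf_div.
    rewrite cmodV lef_pV2 ?posrE ?cmod_gt0 ?nz ?zr//.
    by apply: ltW; apply: nE; rewrite zr.
  by move: D; rewrite ler_pdivrMr//; lra.
have ub z : ubdd h z.
  have [k kz] : exists k : nat, N z <= k%:R * ep.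
    exists (Num.bound (N z / ep)); rewrite -ler_pdivrMr//; apply: ltW.
    by apply: archi_boundP; rewrite divr_ge0 ?cmod_ge0 ?ltW.
  (* Boundedness is carried from 0 to z by k steps of length at most ep. *)
  elim: k z kz => [|k IH] z kz.
    have -> : z = 0; last exact: ub0.
    by apply/eqP; rewrite -cmod_eq0 eq_le cmod_ge0 andbT -(mul0r ep).
  pose z' := rc (k%:R / k.+1%:R) * z.
  have k0 : 0 < k.+1%:R :> R by [].
  apply: (ubdd_near ltr01 K0 (loc z) (_ : N (z' - z) <= _)).
    have -> : z' - z = rc (- k.+1%:R^-1) * z.
      rewrite /z' -{2}[z]mul1r -mulrBl -rc1 -rcB; congr (rc _ * _).
      by rewrite -natr1; field; rewrite natr1 gt_eqF.
    rewrite cmodM cmod_rc normrN ger0_norm ?invr_ge0// mulrC ler_pdivrMr//.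
    by rewrite mulrC.
  apply: IH; rewrite cmodM cmod_rc ger0_norm ?divr_ge0//.
  rewrite mulrAC ler_pdivrMr// -mulrA [ep * _]mulrC.
  by apply: ler_wpM2l.
split => //.
- move=> z; have [A _ _] := ubdd_cdiff (ub z); by exists (cder (ulimf h) z).
- move=> z; have [_ A B] := ubdd_cdiff (ub z); rewrite /sph_le.
  set D := N _; set G := N _; apply/ler_addgt0Pr => e e0.
  have G0 : 0 <= G := cmod_ge0 _.
  (* The constant collects the errors: 4 ((G + d)^2 - G^2) + d <= (8 G + 5) d when d <= 1. *)
  have [d [d0 d1 dE]] : exists d, [/\ 0 < d, d <= 1 & d <= e / (5 + 8 * G)].
    exists (Num.min 1 (e / (5 + 8 * G))); rewrite lt_min ltr01 !ge_min !lexx orbT divr_gt0//.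
    lra.
  have [n nz [A1 B1]] := ultra_ex 0 (filterI (ultra_big (4 * (1 + N z))) (filterI (A _ d0) (B _ d0))).
  have [m _ [nz' [A2 B2]]] := ultra_ex 0 (filterI (ultra_big (4 * (1 + N z))) (filterI (A _ d0) (B _ d0))).
  have := hs m z; rewrite /sph_le => /(_ _)S.
  have {}S : N (cder (h m) z) <= 4 * (1 + N (h m z) ^+ 2) by apply: S; lra.
  have G1 : N (h m z) <= G + d by have := cmod_leB (h m z) (ulimf h z); rewrite -/G; lra.
  have D1 : D <= N (cder (h m) z) + d.
    by have := cmod_leB (cder (ulimf h) z) (cder (h m) z); rewrite cmodBC -/D; lra.
  have G2 : N (h m z) ^+ 2 <= (G + d) ^+ 2 by rewrite lerXn2r ?nnegrE ?cmod_ge0//; lra.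
  have dd : d ^+ 2 <= d by rewrite expr2 ler_piMl// ltW.
  have dE' : d * (5 + 8 * G) <= e by rewrite -ler_pdivlMr//; lra.
  move: G2; rewrite sqrrD; lra.
- have [_ _ B] := ubdd_cdiff (ub 0); apply: ucvg_ge B _.
  by apply: nearW => n; rewrite h0 lerDl sqr_ge0.
Qed.

End Zalcman.

(** * Totally ramified values and repelling fixed points *)

Section Ramified.
Variable R : realType.
Local Notation C := (cplx R).
Local Notation N := (@cmod R).
Implicit Types (f : C -> C) (z w : C).

Lemma cmod_prod (I : finType) (F : I -> C) : N (\prod_i F i) = \prod_i N (F i).
Proof. by rewrite (big_morph N (@cmodM R) (@cmod1 R)). Qed.

Lemma ent_prod (I : Type) (s : seq I) (a : I -> C) f : ent f ->
  ent (fun z => \prod_(j <- s) (f z - a j)).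
Proof.
move=> fe z; elim: s => [|i s [d dE]].
  have -> : (fun z => \prod_(j <- [::]) (f z - a j)) = fun=> 1.
    by apply/funext => w; rewrite big_nil.
  by exists 0; exact: cdiff_cst.
have -> : (fun z => \prod_(j <- i :: s) (f z - a j)) =
    fun z => (f z - a i) * \prod_(j <- s) (f z - a j).
  by apply/funext => w; rewrite big_cons.
by eexists; apply: (cdiffM (cdiffB (ent_cdiff z fe) (cdiff_cst (a i) z)) dE).
Qed.

Variables (g : C -> C) (a : 'I_5 -> C).
Hypothesis ge : ent g.
Hypothesis gs : forall z, sph_le g 4 z.
Hypothesis a_inj : injective a.
Hypothesis ram : forall j z, g z = a j -> cder g z = 0.

Let P z := \prod_j (g z - a j).

Lemma separation : exists d : R, [/\ 0 < d, d <= 1 & forall i j, i != j -> 2 * d <= N (a i - a j)].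
Proof.
pose d := \big[Order.min/1]_(p : 'I_5 * 'I_5 | p.1 != p.2) (N (a p.1 - a p.2) / 2).
exists d; split.
- apply: lt_bigmin => // -[i j] /= ij.
  by rewrite divr_gt0// cmod_gt0 subr_eq0; apply: contraNneq ij => /a_inj ->.
- exact: bigmin_le_id.
- move=> i j ij; rewrite mulrC -ler_pdivlMr//.
  have h := @bigmin_le_cond _ R _ 1 (i, j) (fun p : 'I_5 * 'I_5 => p.1 != p.2)
           (fun p => N (a p.1 - a p.2) / 2) ij.
  exact: h.
Qed.

(** Two regimes. At distance at least d from every a_j, |g'|^2 <= 16 (1 + |g|)^4 while (1 + |g|)^5
    <= L^5 |P|. Within d of one a_j, [ramified_bound] gives |g'|^2 <= const |g - a_j|, the other
    factors of P are at least d, and g is bounded. *)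
Lemma ramified_est : exists2 K : R, 0 < K &
  forall z, N (cder g z) ^+ 2 * (1 + N (g z)) <= K * N (P z).
Proof.
have [d [d0 d1 dE]] := separation.
pose A := \sum_j N (a j).
have A0 : 0 <= A by apply: sumr_ge0 => j _; exact: cmod_ge0.
have aA j : N (a j) <= A.
  by rewrite /A (bigD1 j)//= lerDl sumr_ge0// => i _; exact: cmod_ge0.
pose L := 1 + (1 + A) / d; have L0 : 0 < L by rewrite ltr_pwDl// divr_ge0 ?(ltW d0)// addr_ge0.
pose M := A + 1; have M0 : 0 < M by rewrite ltr_wpDl.
(* The radius at which [sph_bounded] applies with K = 4, that is 16 (1 + M^2) s = 1. *)
pose s := 1 / (16 * (1 + M ^+ 2)).
have M20 : 0 < 1 + M ^+ 2 by rewrite ltr_pwDl// sqr_ge0.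
have s0 : 0 < s by rewrite divr_gt0// mulr_gt0.
pose M2 := 2 + 2 * M ^+ 2 + A.
have M21 : 0 < M2 by rewrite /M2; have := sqr_ge0 M; lra.
pose K1 := 16 * L ^+ 5; pose K2 := 64 * M2 / s ^+ 2 * (1 + M) / d ^+ 5.
have K10 : 0 < K1 by rewrite mulr_gt0// exprn_gt0.
have K20 : 0 < K2.
  rewrite /K2; apply: divr_gt0; last exact: exprn_gt0.
  apply: mulr_gt0; last by rewrite addr_gt0.
  by apply: divr_gt0; [exact: mulr_gt0|exact: exprn_gt0].
exists (K1 + K2); first by rewrite addr_gt0.
move=> z; set x := N (g z); have x0 : 0 <= x := cmod_ge0 _.
have P0 := cmod_ge0 (P z).
have [[j gj]|far] := pselect (exists j, N (g z - a j) < d); last first.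
  have {}far j : d <= N (g z - a j).
    by rewrite leNgt; apply/negP => ?; apply: far; exists j.
  apply: (@le_trans _ _ (K1 * N (P z))); last by rewrite ler_wpM2r// lerDl ltW.
  have D : N (cder g z) ^+ 2 <= 16 * (1 + x) ^+ 4.
    have h := gs z; rewrite /sph_le -/x in h.
    have h2 : N (cder g z) <= 4 * (1 + x) ^+ 2.
      by apply: le_trans h _; rewrite sqrrD; lra.
    have -> : 16 * (1 + x) ^+ 4 = (4 * (1 + x) ^+ 2) ^+ 2 by ring.
    by rewrite lerXn2r ?nnegrE ?cmod_ge0// mulr_ge0 ?sqr_ge0.
  have Pr : (1 + x) ^+ 5 <= L ^+ 5 * N (P z).
    rewrite cmod_prod.
    have -> : L ^+ 5 * \prod_j N (g z - a j) = \prod_j (L * N (g z - a j)).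
      by rewrite big_split /= prodr_const card_ord.
    have -> : (1 + x) ^+ 5 = \prod_(j < 5) (1 + x) by rewrite prodr_const card_ord.
    apply: ler_prod => j _; rewrite addr_ge0//=.
    have h1 : x <= N (g z - a j) + A.
      by have := cmod_leB (g z) (a j); have := aA j; rewrite -/x; lra.
    have h2 : 1 + A <= (1 + A) / d * N (g z - a j).
      by rewrite mulrAC ler_pdivlMr// ler_wpM2l// addr_ge0.
    by rewrite /L mulrDl mul1r; lra.
  apply: (@le_trans _ _ (16 * (1 + x) ^+ 5)).
    have -> : 16 * (1 + x) ^+ 5 = 16 * (1 + x) ^+ 4 * (1 + x) by ring.
    by rewrite ler_wpM2r// addr_ge0.
  by rewrite /K1 -mulrA ler_wpM2l.
apply: (@le_trans _ _ (K2 * N (P z))); last by rewrite ler_wpM2r// lerDr ltW.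
have xM : x <= M.
  by have := cmod_leB (g z) (a j); have := aA j; rewrite /M -/x; lra.
have gb w : N (w - z) <= s -> N (g w) <= 2 + 2 * M ^+ 2.
  move=> wz; have K0 : (0 : R) < 4 by [].
  apply: (@sph_bounded R g z s 4 w M (@ent_hol R g z s ge) K0 (fun w _ => gs w) wz _ xM).
  by move: wz; rewrite /s ler_pdivlMr ?mulr_gt0// mulrC; lra.
have Gd w : cdiff (fun w => g w - a j) w (cder g w).
  by have := cdiffB (ent_cdiff w ge) (cdiff_cst (a j) w); rewrite subr0.
have GE w : cder (fun w => g w - a j) w = cder g w := cdiff_cder (Gd w).
have := @ramified_bound R (fun w => g w - a j) z s M2 s0.
rewrite GE => h.
have {}h : N (cder g z) ^+ 2 <= 64 * M2 / s ^+ 2 * N (g z - a j).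
  apply: h => //.
  - by move=> w _; exists (cder g w).
  - move=> w wz; apply: le_trans (cmodB _ _) _; rewrite /M2.
    by apply: lerD; [exact: gb|exact: aA].
  - by move=> w _ /eqP; rewrite subr_eq0 GE => /eqP; exact: ram.
(* Four factors d bound |g z - a i| for i <> j; the fifth is absorbed by d <= 1. *)
have Pr : N (g z - a j) * d ^+ 5 <= N (P z).
  rewrite cmod_prod (bigD1 j)//= ler_wpM2l ?cmod_ge0//.
  have -> : d ^+ 5 = d * \prod_(i < 5 | i != j) d.
    have -> : d ^+ 5 = \prod_(i < 5) d by rewrite prodr_const card_ord.
    by rewrite (bigD1 j).
  apply: (@le_trans _ _ (\prod_(i < 5 | i != j) d)).
    by rewrite ler_piMl// prodr_ge0// => i _; exact: ltW.
  apply: ler_prod => i ij; rewrite (ltW d0) /=.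
  have := dE i j ij; have := cmodB_tri (g z) (a i) (a j).
  by rewrite (cmodBC (a i) (g z)); lra.
have x1 : 0 <= 1 + x by rewrite addr_ge0.
apply: (@le_trans _ _ (64 * M2 / s ^+ 2 * N (g z - a j) * (1 + M))).
  by apply: ler_pM => //; [exact: sqr_ge0|lra].
have -> : K2 * N (P z) = 64 * M2 / s ^+ 2 * (1 + M) * (N (P z) / d ^+ 5).
  by rewrite /K2; ring.
rewrite mulrAC; apply: ler_wpM2l.
  rewrite mulr_ge0 ?addr_ge0 ?(ltW M0)// divr_ge0 ?sqr_ge0// mulr_ge0// ltW//.
by rewrite ler_pdivlMr ?exprn_gt0.
Qed.

Lemma P_eq0 z : (P z == 0) -> exists j, g z = a j.
Proof.
rewrite /P => /prodf_eq0[j _]; rewrite subr_eq0 => /eqP gj; by exists j.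
Qed.

Lemma P_isolated z0 : cder g 0 != 0 -> exists2 r : R, 0 < r &
  forall z, z != z0 -> N (z - z0) <= r -> P z != 0.
Proof.
(* This radius puts the origin in the half disc where [zero_order] wants a nonzero value; P 0 <> 0,
   since an a_j-point at 0 would give g'(0) = 0. *)
move=> g0; pose r := 2 * N z0 + 1.
have r0 : 0 < r by rewrite ltr_wpDl// mulr_ge0// cmod_ge0.
have Ph : hol_disc P z0 r by apply: ent_hol; exact: ent_prod.
have [|m [q [qh q0 qE]]] := zero_order r0 Ph.
  exists 0; first by rewrite sub0r cmodN /r; have := cmod_ge0 z0; lra.
  by apply: contra g0 => /P_eq0[j] /ram ->.
have zz : N (z0 - z0) <= r by rewrite subrr cmod0 ltW.
have q02 : 0 < N (q z0) / 2 by rewrite divr_gt0// cmod_gt0.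
have [d d0 dE] := hol_disc_cont qh zz q02.
exists (d / 2); first by rewrite divr_gt0.
move=> z zz0 zd; rewrite qE mulf_neq0//; first by rewrite expf_neq0// subr_eq0.
rewrite -cmod_gt0; have := dE z; have := cmod_leB (q z0) (q z); rewrite cmodBC.
by move=> h1 h2; have := h2 (_ : N (z - z0) < d); lra.
Qed.

(* Every zero of [g - a j] is multiple, so [(g')^2 / prod (g - a j)] has only removable
   singularities; it is a bounded entire function, and tends to [0] when [g] is large. *)
Lemma ramified_flat : cder g 0 = 0.
Proof.
apply/eqP/negPn/negP => g0.
have [K K0 KE] := ramified_est.
pose k z := cder g z ^+ 2 / P z.
have ke z : P z != 0 -> exists d, cdiff k z d.
  move=> Pz; have [d1 d1E] : exists d, cdiff (cder g) z d.
    by apply: (@cder_hol _ g z 1 ltr01); exact: ent_hol.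
  have [d2 d2E] := ent_prod (index_enum _) a ge z.
  have := cdiffM (cdiffM d1E d1E) (cdiffV Pz d2E).
  by move=> h; eexists; exact: h.
have kb z : P z != 0 -> N (k z) * (1 + N (g z)) <= K.
  move=> Pz; rewrite /k cmodM cmodV cmodX mulrAC ler_pdivrMr ?cmod_gt0//; exact: KE.
have kb' z : P z != 0 -> N (k z) <= K.
  move=> Pz; apply: le_trans (kb z Pz).
  by rewrite ler_peMr ?cmod_ge0// lerDl cmod_ge0.
have ext z0 : exists v r q, [/\ 0 < r, hol_disc q z0 r, q z0 = v &
    forall z, z != z0 -> N (z - z0) <= r -> P z != 0 /\ q z = k z].
  have [r r0 rE] := P_isolated z0 g0.
  have [|q qh qE] := @removable R k z0 r K r0.
    by move=> z zz0 zr; have Pz := rE z zz0 zr; split; [exact: ke|exact: kb'].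
  by exists (q z0), r, q; split=> // z zz0 zr; split; [exact: rE|exact: qE].
have [V VE] := choice ext.
pose H z := if P z == 0 then V z else k z.
have HN z : P z != 0 -> H z = k z by rewrite /H => /negbTE ->.
have He : ent H.
  move=> z0; have [r [q [r0 qh qz qE]]] := VE z0.
  have [Pz|Pz] := eqVneq (P z0) 0.
    have [|d dE] := qh z0; first by rewrite subrr cmod0 ltW.
    exists d; apply: cdiff_local dE; exists r => // w wr.
    have [->|wz] := eqVneq w z0; first by rewrite /H Pz eqxx.
    by have [Pw ->] := qE w wz (ltW wr); rewrite HN.
  have [d dE] := ke z0 Pz; exists d; apply: cdiff_local dE; exists r => // w wr.
  have [->|wz] := eqVneq w z0; first by rewrite HN.
  by have [Pw _] := qE w wz (ltW wr); rewrite HN.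
(* At a zero of P the bound comes by continuity from nearby points, where P does not vanish. *)
have Hb z : N (H z) <= K.
  have [Pz|Pz] := eqVneq (P z) 0; last by rewrite HN// kb'.
  have [r [q [r0 _ _ qE]]] := VE z.
  apply/ler_addgt0Pr => e e0.
  have [d d0 dE] := cdiff_cont (ent_cdiff z He) e0.
  have [t [t0 tr td]] : exists t : R, [/\ 0 < t, t <= r & t < d].
    exists (Num.min r (d / 2)); rewrite lt_min r0 divr_gt0// ge_min lexx; split => //.
    by rewrite gt_min; apply/orP; right; lra.
  have tz : N (z + rc t - z) = t by rewrite [z + _]addrC addrK cmod_rc gtr0_norm.
  have zt : z + rc t != z by rewrite -subr_eq0 -cmod_eq0 tz gt_eqF.
  have [|Pw _] := qE _ zt; first by rewrite tz.
  have := kb' _ Pw; rewrite -HN//; have := dE (z + rc t); rewrite tz => /(_ td).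
  by have := cmod_leB (H z) (H (z + rc t)); rewrite cmodBC; lra.
have Hc := liouville He Hb.
have P0 : P 0 != 0 by apply: contra g0 => /P_eq0[j] /ram ->.
have H0 : 0 < N (H 0).
  by rewrite cmod_gt0 HN// /k mulf_neq0 ?invr_eq0 ?expf_neq0.
pose A := \sum_j N (a j).
(* H is a nonzero constant and |H| (1 + |g|) <= K off the zeros of P, where g is some a_j otherwise.
   So g is bounded, hence constant, against g'(0) <> 0. *)
have gb z : N (g z) <= K / N (H 0) + A.
  have A0 : 0 <= A by apply: sumr_ge0 => j _; exact: cmod_ge0.
  have K1 : 0 <= K / N (H 0) by rewrite divr_ge0// ltW.
  have [/eqP/P_eq0[j ->]|Pz] := eqVneq (P z) 0.
    apply: (@le_trans _ _ A); last by rewrite lerDr.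
    by rewrite /A (bigD1 j)//= lerDl sumr_ge0// => i _; exact: cmod_ge0.
  have := kb z Pz; rewrite -HN// Hc mulrC -ler_pdivlMr//; lra.
have gc := liouville ge gb.
move: g0; rewrite (cdiff_cder (d := 0)) ?eqxx//.
have -> : g = fun=> g 0 by apply/funext.
exact: cdiff_cst.
Qed.

End Ramified.

(** * Repelling fixed points near a point of non-normality *)

Section Repelling.
Variable R : realType.
Local Notation C := (cplx R).
Local Notation N := (@cmod R).
Implicit Types (f g : C -> C) (z w : C).

Lemma ucvg_harmonic (u : nat -> C) l (k : R) :
  (forall n, N (u n - l) <= k / n.+1%:R) -> ucvg u l.
Proof.
move=> H e e0; apply: filterS (ultra_big (k / e)) => n ne; apply: le_trans (H n) _.
by rewrite ler_pdivrMr// mulrC -ler_pdivrMr.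
Qed.

Lemma repelling_near (F : set (C -> C)) w0 f (a : 'I_5 -> C) :
  (forall phi, F phi -> ent phi) -> ~ normal_at F w0 -> ent f -> injective a ->
  (forall j, f (a j) = w0) -> (forall j, cder f (a j) != 0) ->
  forall e : R, 0 < e -> exists phi w, [/\ F phi, N (w - w0) <= e, f (phi w) = w &
    1 < N (cder (fun z => f (phi z)) w)].
Proof.
move=> Fe nF fe a_inj fa fa' e e0.
have [phi [p [rho [Fphi pE rhoE sphE derE]]]] := zalcman Fe nF.
have phie n : ent (phi n) := Fe _ (Fphi n).
pose h n z := phi n (p n + rc (rho n) * z).
have hd n z : cdiff (h n) z (cder (phi n) (p n + rc (rho n) * z) * rc (rho n)).
  by apply: cdiff_affine; exact: ent_cdiff.
have he n : ent (h n) by move=> z; eexists; exact: hd.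
have [hub ge gs g0] := zalcman_limit he sphE derE.
set g := ulimf h in ge gs g0.
have [j [z0 [gz0 gz0']]] : exists j z0, g z0 = a j /\ cder g z0 != 0.
  apply: contrapT => K.
  have : cder g 0 = 0.
    apply: (ramified_flat ge gs a_inj) => j z gz; apply/eqP/negPn/negP => gz'.
    by apply: K; exists j, z.
  by move=> g00; move: g0; rewrite g00 cmod0 ler10.
have [M [s [s0 hM]]] := hub z0.
have [_ hcv hcv'] := ubdd_cdiff (hub z0).
have [M' M'0 fM'] := hol_bounded (@ent_hol R f 0 M fe).
have rho_small (d : R) : 0 < d -> \forall n \near ultra, 0 < rho n <= d.
  move=> d0; apply: filterS (ultra_big (4 / d)) => n nd.
  have /andP[-> /= r4] := rhoE n; apply: le_trans r4 _.
  by rewrite ler_pdivrMr// mulrC -ler_pdivrMr.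
have rhocv : ucvg (fun n => rc (rho n)) 0.
  move=> d /rho_small; apply: filterS => n /andP[r0 rd].
  by rewrite subr0 cmod_rc gtr0_norm.
have pcv : ucvg p w0 := ucvg_harmonic pE.
(* A zero of [Psi n] is a fixed point of f o phi_n in rescaled coordinates. [Psi n] tends to f o g -
   w0, which has a simple zero at z0. *)
pose Psi n z := f (h n z) - (p n + rc (rho n) * z).
have Psid n z : cdiff (Psi n) z (cder f (h n z) * cder (h n) z - rc (rho n)).
  apply: cdiffB; first exact: (cdiff_comp (ent_cdiff z (he n)) (ent_cdiff _ fe)).
  have := cdiff_affine (f := id) (cdiff_id (p n + rc (rho n) * z)).
  by rewrite mul1r.
have Psi0 : ucvg (fun n => Psi n z0) 0.
  have -> : 0 = f (g z0) - (w0 + 0 * z0) :> C by rewrite gz0 fa mul0r addr0 subrr.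
  apply: ucvgD; first exact: (ucvg_comp (cdiff_cont (ent_cdiff _ fe)) hcv).
  by apply: ucvgN; apply: ucvgD => //; exact: ucvgMr.
pose D := cder f (a j) * cder g z0 - 0.
have PsiD : ucvg (fun n => cder (Psi n) z0) D.
  have : ucvg (fun n => cder f (h n z0) * cder (h n) z0 - rc (rho n)) D.
    apply: ucvgD; last exact: ucvgN.
    apply: ucvgM => //; rewrite -gz0.
    have fh : ccont (cder f) (g z0).
      have [d dE] := @cder_hol _ f (g z0) 1 ltr01 (@ent_hol R f _ _ fe).
      exact: cdiff_cont dE.
    exact: (ucvg_comp fh hcv).
  by apply: ucvg_eq; apply: nearW => n; rewrite (cdiff_cder (Psid n z0)).
have be0 : 0 < N D by rewrite cmod_gt0 /D subr0 mulf_neq0.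
(* Bounds [Psi n] on the disc of radius s: f o h_n by M', |p n| by |w0| + 2, and rho n |z| by 4
   (|z0| + s). *)
pose M1 := M' + (N w0 + 2) + 4 * (N z0 + s).
have w00 := cmod_ge0 w0; have z00 := cmod_ge0 z0.
have M10 : 0 < M1 by rewrite /M1; lra.
pose k := N z0 + s; have k0 : 0 < k by rewrite /k; lra.
(* The smallness that [simple_zero] asks of |Psi n z0| when the derivative there is at least
   |D|/2. *)
pose eta := (N D / 2 * s) ^+ 2 / (64 * M1).
have eta0 : 0 < eta by rewrite divr_gt0 ?mulr_gt0// exprn_gt0// mulr_gt0// divr_gt0.
have D2 : 0 < N D / 2 by rewrite divr_gt0.
have D16 : 0 < N D / 16 by rewrite divr_gt0.
have ek : 0 < e / 2 / k by rewrite !divr_gt0.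
have e2 : 0 < e / 2 by rewrite divr_gt0.
have [n _ [[[A1 A2] [B1 B2]] [[r1 r2] p1]]] := ultra_ex 0 (filterI
  (filterI hM (filterI (Psi0 _ eta0) (PsiD _ D2)))
  (filterI (filterI (rho_small _ D16) (rho_small _ ek)) (pcv _ e2))).
move: r1 r2 => /andP[r0 r1] /andP[_ r2].
rewrite subr0 in B1.
have r4 : rho n <= 4.
  have /andP[_ h4] := rhoE n; apply: le_trans h4 _; rewrite ler_pdivrMr// ler_peMr// ler1n//.
have pn : N (p n) <= N w0 + 2.
  have h2 : 2 / n.+1%:R <= 2 :> R by rewrite ler_pdivrMr// ler_peMr// ler1n.
  have := le_trans (pE n) h2; have := cmod_leB (p n) w0; lra.
have PM z : N (z - z0) <= s -> N (Psi n z) <= M1.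
  move=> zs; apply: le_trans (cmodB _ _) _; rewrite /M1 -addrA; apply: lerD.
    by apply: fM'; rewrite subr0; exact: A2.
  apply: le_trans (cmodD _ _) _; apply: lerD => //.
  rewrite cmodM cmod_rc gtr0_norm//; apply: ler_pM; rewrite ?cmod_ge0 ?(ltW r0)//.
  by have := cmod_leB z z0; lra.
have Ph : hol_disc (Psi n) z0 s by move=> z _; eexists; exact: Psid.
have bD : N D / 2 <= N (cder (Psi n) z0).
  by have := cmod_leB D (cder (Psi n) z0); rewrite cmodBC; lra.
have b0 : 0 < N (cder (Psi n) z0) by apply: lt_le_trans bD.
have [|z [zs Pz Pz']] := simple_zero s0 Ph M10 PM b0.
  rewrite -ler_pdivlMl ?mulr_gt0// mulrC; apply: le_trans B1 _.
  rewrite /eta ler_pM2r ?invr_gt0 ?mulr_gt0//.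
  by rewrite lerXn2r ?nnegrE ?mulr_ge0 ?cmod_ge0 ?(ltW s0) ?(ltW D2)// ler_wpM2r// ltW.
have zs' : N (z - z0) <= s.
  apply: le_trans zs _; rewrite ler_pdivrMr ?mulr_gt0//.
  have : N (cder (Psi n) z0) * s <= M1.
    rewrite -ler_pdivlMr//; apply: (cauchy_est1 s0 Ph) => w ws; apply: PM.
    by rewrite ws.
  by rewrite expr2 mulrA => h1; rewrite [s * _]mulrC; apply: ler_wpM2r; [exact: ltW|lra].
pose w := p n + rc (rho n) * z.
have fw : f (phi n w) = w by apply/eqP; rewrite -subr_eq0; apply/eqP.
exists (phi n), w; split => //.
  rewrite /w addrAC; apply: le_trans (cmodD _ _) _.
  have : N (rc (rho n) * z) <= e / 2.
    rewrite cmodM cmod_rc gtr0_norm//.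
    apply: (@le_trans _ _ (e / 2 / k * k)); last by rewrite divfK// gt_eqF.
    apply: ler_pM; rewrite ?cmod_ge0 ?(ltW r0)//.
    by rewrite /k; have := cmod_leB z z0; lra.
  lra.
have fphi : cdiff (fun z => f (phi n z)) w (cder f (phi n w) * cder (phi n) w).
  exact: (cdiff_comp (ent_cdiff w (phie n)) (ent_cdiff _ fe)).
rewrite (cdiff_cder fphi).
move: Pz'; rewrite (cdiff_cder (Psid n z)) (cdiff_cder (hd n z)) -/(h n z) -/w.
rewrite mulrA => Pz'.
(* As rho <= |D|/16, the derivative of f o phi_n times rho is at least |D|/4 - rho >= 3 |D|/16 >
   rho. *)
have Pz1 : N D / 4 <= N (cder f (phi n w) * cder (phi n) w * rc (rho n) - rc (rho n)).
  by apply: le_trans Pz'; lra.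
have := cmodB (cder f (phi n w) * cder (phi n) w * rc (rho n)) (rc (rho n)).
rewrite [in X in _ <= X -> _]cmodM cmod_rc gtr0_norm// => h2.
rewrite -(ltr_pM2r r0) mul1r; lra.
Qed.

End Repelling.

(** * Jensen's inequality *)

Section LogPlus.
Variable R : realType.
Implicit Types x y : R.

Lemma log_plusE x : log_plus x = ln (Num.max 1 x).
Proof.
rewrite /log_plus; have [x1|x1] := leP 1 x; first by apply/max_idPr; exact: ln_ge0.
by rewrite ln1; apply/max_idPl; apply: ln_le0; exact: ltW.
Qed.

Lemma max1_gt0 x : 0 < Num.max 1 x.
Proof. by rewrite lt_max ltr01. Qed.

Lemma log_plus_le x y : x <= y -> log_plus x <= log_plus y.
Proof.
move=> xy; rewrite !log_plusE ler_ln ?posrE ?max1_gt0//.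
by rewrite ge_max !le_max lexx xy orbT.
Qed.

Lemma log_plus_exp x : x <= expR (log_plus x).
Proof. by rewrite log_plusE lnK ?posrE ?max1_gt0// le_max lexx orbT. Qed.

Lemma log_plusD x y : 0 <= x -> 0 <= y ->
  log_plus (x + y) <= log_plus x + log_plus y + ln 2.
Proof.
move=> x0 y0; rewrite !log_plusE -!lnM ?posrE ?mulr_gt0 ?max1_gt0//.
rewrite ler_ln ?posrE ?mulr_gt0 ?max1_gt0//.
have [hx hx'] : 1 <= Num.max 1 x /\ x <= Num.max 1 x by rewrite !le_max !lexx orbT.
have [hy hy'] : 1 <= Num.max 1 y /\ y <= Num.max 1 y by rewrite !le_max !lexx orbT.
move: (Num.max 1 x) (Num.max 1 y) hx hx' hy hy' => X Y hx hx' hy hy'.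
have h1 : X <= X * Y by rewrite ler_peMr//; lra.
have h2 : Y <= X * Y by rewrite ler_peMl//; lra.
by rewrite ge_max; apply/andP; split; lra.
Qed.

Lemma log_plus_lip x y : 0 <= x -> 0 <= y -> `|log_plus x - log_plus y| <= `|x - y|.
Proof.
have H (a b : R) : 0 <= a -> a <= b -> log_plus b - log_plus a <= b - a.
  move=> a0 ab; rewrite !log_plusE; set A := Num.max 1 a; set B := Num.max 1 b.
  have A1 : 1 <= A by rewrite le_max lexx.
  have A0 : 0 < A := max1_gt0 a; have B0 : 0 < B := max1_gt0 b.
  have AB : 0 <= B - A <= b - a.
    by rewrite /A /B; case: (leP 1 a) => ?; case: (leP 1 b) => ?; lra.
  rewrite -ln_div ?posrE//.
  have -> : B / A = 1 + (B - A) / A by field; rewrite gt_eqF.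
  move: AB => /andP[h0 h1].
  have h2 : 0 <= (B - A) / A by rewrite divr_ge0// ltW.
  apply: le_trans (le_ln1Dx _) _; first lra.
  by apply: le_trans h1; rewrite ler_pdivrMr// ler_peMr.
move=> x0 y0; wlog xy : x y x0 y0 / x <= y.
  move=> hw; have [xy|/ltW yx] := leP x y; first exact: hw.
  by rewrite distrC [leRHS]distrC; exact: hw.
rewrite distrC [leRHS]distrC !ger0_norm ?subr_ge0 ?log_plus_le//; exact: H.
Qed.

End LogPlus.

Section Riemann.
Variable R : realType.
Local Notation mu := (@lebesgue_measure R).
Local Notation tau := (2 * pi : R).
Variables (u : R -> R) (n : nat) (e : R).
Hypothesis u_cont : continuous u.
Hypothesis u_per : forall t, u (t + tau) = u t.
Hypothesis u_osc : forall s t, `|s - t| <= tau / n.+1%:R -> `|u s - u t| <= e.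
Let h := tau / n.+1%:R.

Lemma step_gt0 : 0 < h.
Proof. by rewrite divr_gt0// tau_gt0. Qed.

Lemma riemann_lower m : \sum_(i < m) h * (u (i%:R * h) - e) <= \int[mu]_(t in `[0, m%:R * h]) u t.
Proof.
have h0 := step_gt0; elim: m => [|m IH].
  by rewrite big_ord0 mul0r set_itv1 Rintegral_set1.
have mh : m%:R * h <= m.+1%:R * h by rewrite ler_pM2r// ler_nat.
have mh0 : 0 <= m%:R * h by rewrite mulr_ge0// ltW.
rewrite big_ord_recr /= (@Rintegral_chasles _ u 0 (m%:R * h) (m.+1%:R * h))//; last exact: cont_integrable.
apply: lerD => //.
have E : m.+1%:R * h - m%:R * h = h by rewrite -mulrBl -natr1 addrAC subrr add0r mul1r.
have -> : h * (u (m%:R * h) - e) =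
    \int[mu]_(t in `[m%:R * h, m.+1%:R * h]) (u (m%:R * h) - e).
  by rewrite Rint_cst// E mulrC.
apply: le_Rintegral => //; [by apply: cont_integrable; exact: cst_continuous|exact: cont_integrable|].
move=> t; rewrite /= in_itv /= => /andP[t1 t2].
have : `|u t - u (m%:R * h)| <= e.
  apply: u_osc; rewrite ger0_norm ?subr_ge0// -/h; rewrite -E; lra.
by rewrite ler_norml => /andP[? ?]; lra.
Qed.

Lemma cyclic_sum (f : nat -> R) j : (forall k, f (k + n.+1)%N = f k) ->
  \sum_(k < n.+1) f (j + k)%N = \sum_(k < n.+1) f k.
Proof.
move=> fp; elim: j => [|j IH]; first by [].
rewrite -IH big_ord_recr big_ord_recl /= addn0 addrC; congr (_ + _).
  by rewrite addSn -addnS fp.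
by apply: eq_bigr => k _; rewrite /bump /= addSn -addnS.
Qed.

(** Moving the sample points from t + k h to the grid costs e per term, the cyclic shift by j costs
    nothing by periodicity, and comparing the grid sum with the integral costs another e. *)
Lemma riemann_mean t : 0 <= t ->
  \sum_(k < n.+1) u (t + k%:R * h) <= n.+1%:R * (tau^-1 * \int[mu]_(t in `[0, tau]) u t + 2 * e).
Proof.
move=> t0; have h0 := step_gt0.
have hE : n.+1%:R * h = tau by rewrite /h mulrC divfK.
pose j := Num.truncn (t / h).
have [jt tj] : j%:R * h <= t /\ t <= j%:R * h + h.
  have /andP[A B] := @truncn_itv _ (t / h) (divr_ge0 t0 (ltW h0)).
  rewrite -ler_pdivlMr//; split => //.
  rewrite -[X in _ + X]mul1r -mulrDl -ler_pdivrMr// natr1; exact: ltW.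
apply: (@le_trans _ _ (\sum_(k < n.+1) (u ((j + k)%:R * h) + e))).
  apply: ler_sum => k _.
  have : `|u (t + k%:R * h) - u ((j + k)%:R * h)| <= e.
    apply: u_osc; rewrite natrD mulrDl opprD addrACA subrr addr0 -/h ger0_norm; lra.
  by rewrite ler_norml => /andP[? ?]; lra.
rewrite big_split /= (cyclic_sum (f := fun i => u (i%:R * h))); last first.
  by move=> k; rewrite natrD mulrDl hE u_per.
have := riemann_lower n.+1; rewrite hE.
have -> : \sum_(i < n.+1) h * (u (i%:R * h) - e) = h * (\sum_(i < n.+1) u (i%:R * h) - n.+1%:R * e).
  by rewrite -mulr_sumr sumrB sumr_const card_ord mulr_natl.
move=> H.
have H2 : \sum_(i < n.+1) u (i%:R * h) - n.+1%:R * e <= h^-1 * \int[mu]_(t in `[0, tau]) u t.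
  by rewrite -ler_pdivrMl ?invr_gt0// invrK.
have h1 : h^-1 = n.+1%:R * tau^-1 by rewrite /h invf_div.
rewrite h1 in H2.
have -> : n.+1%:R * (tau^-1 * \int[mu]_(t in `[0, tau]) u t + 2 * e) =
   n.+1%:R * tau^-1 * \int[mu]_(t in `[0, tau]) u t + n.+1%:R * e + n.+1%:R * e by ring.
rewrite sumr_const card_ord mulr_natl.
rewrite mulr_natl in H2; lra.
Qed.

End Riemann.

Section Jensen.
Variable R : realType.
Local Notation C := (cplx R).
Local Notation N := (@cmod R).
Local Notation mu := (@lebesgue_measure R).
Local Notation tau := (2 * pi : R).
Implicit Types (f B H : C -> C) (z w : C) (r t x y e : R).

Definition log_mean B r : R := tau^-1 * \int[mu]_(t in `[0, tau]) log_plus (N (B (polar r t))).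

Lemma nevanlinna_TE r f : nevanlinna_T r f = log_mean f r.
Proof. by []. Qed.

Lemma polar_lip_t r x y : N (polar r x - polar r y) = `|r| * N (polar 1 (x - y) - polar 1 0).
Proof.
have -> : polar r x - polar r y = polar r y * (polar 1 (x - y) - polar 1 0).
  by rewrite mulrBr !polarM mulr1 addr0 [y + _]addrC subrK.
by rewrite cmodM cmod_polar.
Qed.

Lemma polar_tau r t : polar r (t + tau) = polar r t.
Proof.
have -> : polar r (t + tau) = polar r t * polar 1 tau by rewrite polarM mulr1.
by rewrite polar_2pi polarM mulr1 addr0.
Qed.

Lemma log_circle_osc f r e : ent f -> 0 < r -> 0 < e -> exists2 d, 0 < d & forall s t, `|s - t| < d ->
  `|log_plus (N (f (polar r s))) - log_plus (N (f (polar r t)))| <= e.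
Proof.
move=> fe r0 e0.
have [s s0 sE] : exists2 s, 0 < s & forall z w, N (z - 0) <= r -> N (w - 0) <= r ->
   N (z - w) <= s -> N (f z - f w) <= e.
  by apply: disc_unif_cont => // z _; exact: cdiff_cont (ent_cdiff z fe).
have [d d0 dE] := @rcont_polar R 1 0 (s / r) (divr_gt0 s0 r0).
exists d => // x y xy; apply: le_trans (log_plus_lip (cmod_ge0 _) (cmod_ge0 _)) _.
have : N (f (polar r x) - f (polar r y)) <= e.
  apply: sE; rewrite ?subr0 ?cmod_polar ?gtr0_norm//.
  rewrite polar_lip_t gtr0_norm// mulrC -ler_pdivlMr//.
  by apply: dE; rewrite subr0.
apply: le_trans; rewrite ler_norml; have := cmod_leB (f (polar r x)) (f (polar r y)).
have := cmod_leB (f (polar r y)) (f (polar r x)).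
by rewrite cmodBC => h1 h2; apply/andP; split; lra.
Qed.

Lemma log_circle_cont f r : ent f -> 0 < r -> continuous (fun t => log_plus (N (f (polar r t)))).
Proof.
move=> fe r0 t; apply/cvgrPdist_le => e e0.
have [d d0 dE] := log_circle_osc fe r0 e0.
by apply/nbhs_ballP; exists d => //= s; rewrite /ball /= => ts; exact: dE.
Qed.

(* Subharmonicity of [log+ |B|]: apply the maximum modulus principle to the product of
   [B] over the rotations by the [n]-th roots of unity; as [n] grows its modulus on the
   circle is governed by Riemann sums of [log+ |B|]. *)
Lemma log_le_mean B r : 0 < r -> ent B -> B 0 != 0 -> ln (N (B 0)) <= log_mean B r.
Proof.
move=> r0 Be B0; apply/ler_addgt0Pr => e e0.
have e2 : 0 < e / 2 by rewrite divr_gt0.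
pose u t := log_plus (N (B (polar r t))).
have [d d0 dE] := log_circle_osc Be r0 e2.
pose n := Num.bound (tau / d).
have nd : tau / n.+1%:R < d.
  rewrite ltr_pdivrMr// [d * _]mulrC -ltr_pdivrMr//.
  have hb := archi_boundP (divr_ge0 (ltW (tau_gt0 R)) (ltW d0)).
  by apply: lt_le_trans hb _; rewrite ler_nat.
have u_osc s t : `|s - t| <= tau / n.+1%:R -> `|u s - u t| <= e / 2.
  by move=> st; apply: dE; exact: le_lt_trans nd.
have u_per t : u (t + tau) = u t by rewrite /u polar_tau.
pose h := tau / n.+1%:R.
pose Bn z := \prod_(k < n.+1) B (polar 1 (k%:R * h) * z).
have Bnh : hol_disc Bn 0 r.
  move=> z _; rewrite /Bn; elim: (index_enum _) => [|i s [c cE]].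
    have -> : (fun z => \prod_(k <- [::] : seq 'I_n.+1) B (polar 1 (k%:R * h) * z)) = fun=> 1.
      by apply/funext => w; rewrite big_nil.
    by exists 0; exact: cdiff_cst.
  have -> : (fun z => \prod_(k <- i :: s) B (polar 1 (k%:R * h) * z)) =
      fun z => B (0 + polar 1 (i%:R * h) * z) * \prod_(k <- s) B (polar 1 (k%:R * h) * z).
    by apply/funext => w; rewrite big_cons add0r.
  by eexists; apply: (cdiffM (cdiff_affine (ent_cdiff _ Be)) cE).
have := max_modulus (M := expR (n.+1%:R * (log_mean B r + 2 * (e / 2)))) r0 Bnh.
have -> : Bn 0 = B 0 ^+ n.+1.
  by rewrite /Bn; under eq_bigr do rewrite mulr0; rewrite prodr_const card_ord.
move=> H; have {}H : N (B 0 ^+ n.+1) <= expR (n.+1%:R * (log_mean B r + 2 * (e / 2))).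
  apply: H => t /andP[t0 t1]; rewrite add0r.
  rewrite /Bn (big_morph N (@cmodM R) (@cmod1 R)).
  apply: (@le_trans _ _ (\prod_(k < n.+1) expR (u (t + k%:R * h)))).
    apply: ler_prod => k _; rewrite cmod_ge0 /=.
    rewrite polarM mul1r [_ + t]addrC; exact: log_plus_exp.
  rewrite -expR_sum ler_expR.
  exact: (riemann_mean (log_circle_cont Be r0) u_per u_osc).
rewrite cmodX expRM_natl in H.
have {}H : N (B 0) <= expR (log_mean B r + 2 * (e / 2)).
  by rewrite -(@ler_pXn2r _ n.+1) ?nnegrE ?cmod_ge0 ?expR_ge0.
rewrite -ler_expR lnK ?posrE ?cmod_gt0//; apply: le_trans H _.
by rewrite ler_expR; lra.
Qed.

Lemma eq_log_mean f B r : 0 < r -> (forall z, N z = r -> N (f z) = N (B z)) ->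
  log_mean f r = log_mean B r.
Proof.
move=> r0 fB; rewrite /log_mean; congr (_ * _); apply: eq_Rintegral => t _.
by rewrite fB// cmod_polar gtr0_norm.
Qed.

Lemma le_log_mean f B r (c : R) : ent f -> ent B -> 0 < r ->
  (forall z, N z = r -> log_plus (N (f z)) <= log_plus (N (B z)) + c) ->
  log_mean f r <= log_mean B r + c.
Proof.
move=> fe Be r0 fB; rewrite /log_mean.
have t0 : 0 < tau := tau_gt0 R.
have -> : c = tau^-1 * (c * (tau - 0)) by rewrite subr0 mulrC mulfK// gt_eqF.
rewrite -mulrDr ler_pM2l ?invr_gt0// -Rint_cst; last exact: ltW.
rewrite -RintegralD//; last 2 first.
- by apply: cont_integrable; exact: log_circle_cont.
- by apply: cont_integrable; exact: cst_continuous.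
apply: le_Rintegral => //.
- by apply: cont_integrable; exact: log_circle_cont.
- have := @integrableD _ _ _ mu `[0, tau] (measurable_itv _)
    (EFin \o (fun t => log_plus (N (B (polar r t))))) (EFin \o (fun=> c)).
  apply; first by apply: cont_integrable; exact: log_circle_cont.
  by apply: cont_integrable; exact: cst_continuous.
- by move=> t _; apply: fB; rewrite cmod_polar gtr0_norm.
Qed.

(** Each factor z - a is replaced by its reflection, of equal modulus on the circle and of modulus r
    in place of |a| at the origin: log |f(0)| gains log r - log |a|, while the mean is unchanged.
    [log_le_mean] ends the induction. *)
Lemma jensen f H (s : seq C) r : 0 < r -> ent H ->
  (forall z, f z = (\prod_(a <- s) (z - a)) * H z) -> f 0 != 0 ->
  ln (N (f 0)) + \sum_(a <- s) (ln r - ln (N a)) <= log_mean f r.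
Proof.
move=> r0; elim: s f H => [|a s IH] f H He fE f0.
  rewrite big_nil addr0; apply: log_le_mean => //.
  by move=> z; have [d dE] := He z; exists d; apply: cdiff_local dE;
     exists 1 => // w _; rewrite fE big_nil mul1r.
have [c cE] := circle_reflection a r0.
pose B z := (polar r 0 - c * z) * H z.
have Be : ent B.
  move=> z; eexists; apply: cdiffM (ent_cdiff z He).
  by apply: cdiffB; [exact: cdiff_cst|apply: cdiffM; [exact: cdiff_cst|exact: cdiff_id]].
pose g z := (\prod_(a <- s) (z - a)) * B z.
have fg z : N z = r -> N (f z) = N (g z).
  by move=> zr; rewrite fE /g /B big_cons !cmodM cE// mulrCA mulrA.
have f0E : f 0 = - a * \prod_(a <- s) (0 - a) * H 0 by rewrite fE big_cons sub0r.
have g0E : g 0 = \prod_(a <- s) (0 - a) * (polar r 0 * H 0) by rewrite /g /B mulr0 subr0.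
have a0 : a != 0.
  by apply: contraNneq f0 => a0; rewrite f0E a0 oppr0 !mul0r.
have gN : N (f 0) * r = N a * N (g 0).
  by rewrite f0E g0E !cmodM cmodN cmod_polar gtr0_norm//; ring.
have f00 : 0 < N (f 0) by rewrite cmod_gt0.
have a00 : 0 < N a by rewrite cmod_gt0.
have g00 : 0 < N (g 0).
  by rewrite -(pmulr_rgt0 _ a00) -gN mulr_gt0.
have := IH g B Be (fun z => erefl) _; rewrite -cmod_gt0 => /(_ g00).
rewrite (eq_log_mean r0 fg) big_cons.
have : ln (N (f 0)) + ln r = ln (N a) + ln (N (g 0)) by rewrite -!lnM ?posrE// gN.
lra.
Qed.

End Jensen.

(** * Zeros and growth of entire functions *)

Section Entire.
Variable R : realType.
Local Notation C := (cplx R).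
Local Notation N := (@cmod R).
Implicit Types (f g q : C -> C) (z w a : C).

Lemma cdiff_exp a m z : exists d, cdiff (fun z => (z - a) ^+ m) z d.
Proof.
elim: m => [|m [d dE]]; first by exists 0; exact: cdiff_cst.
have -> : (fun z => (z - a) ^+ m.+1) = fun z => (z - a) * (z - a) ^+ m.
  by apply/funext => w; rewrite exprS.
eexists; apply: (cdiffM _ dE).
by apply: cdiffB; [exact: cdiff_id|exact: cdiff_cst].
Qed.

Lemma ent_factor f g a m (r : R) : 0 < r -> ent f -> hol_disc g a r ->
  (forall z, f z = (z - a) ^+ m * g z) -> ent g.
Proof.
move=> r0 fe gh fE z; have [->|za] := eqVneq z a.
  by apply: gh; rewrite subrr cmod0 ltW.
have [d1 d1E] := fe z; have [d2 d2E] := cdiff_exp a m z.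
have zm : (z - a) ^+ m != 0 by rewrite expf_neq0// subr_eq0.
have h := cdiffM d1E (@cdiffV R (fun z => (z - a) ^+ m) z d2 zm d2E).
eexists; apply: cdiff_local h; exists (N (z - a)); first by rewrite cmod_gt0 subr_eq0.
move=> w wz; have wa : w != a by apply: contraTneq wz => ->; rewrite cmodBC ltxx.
by rewrite fE mulrAC mulfV ?mul1r// expf_neq0// subr_eq0.
Qed.

Lemma ent_division f a : ent f -> exists q, [/\ ent q,
  (forall z, f z = f a + (z - a) * q z) & q a = cder f a].
Proof.
move=> fe; have [q [qh qE qa]] := division ltr01 (@ent_hol R f a 1 fe).
exists q; split=> //; apply: (@ent_factor (fun z => f z - f a) q a 1 1) => //.
  by move=> z; eexists; apply: cdiffB (ent_cdiff z fe) (cdiff_cst _ _).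
by move=> z; rewrite expr1 qE addrC addKr.
Qed.

Lemma zero_order_ent f a : ent f -> (exists z, f z != 0) ->
  exists m g, [/\ ent g, g a != 0 & forall z, f z = (z - a) ^+ m * g z].
Proof.
move=> fe [z fz]; have r0 : 0 < 2 * N (z - a) + 1 by rewrite ltr_wpDl// mulr_ge0// cmod_ge0.
have [|m [g [gh ga gE]]] := zero_order r0 (@ent_hol R f a _ fe).
  by exists z => //; lra.
by exists m, g; split=> //; exact: ent_factor r0 fe gh gE.
Qed.

Lemma cont_neq0 g a : ent g -> g a != 0 -> exists2 d : R, 0 < d &
  forall z, N (z - a) < d -> N (g a) / 2 <= N (g z).
Proof.
move=> ge ga; have g2 : 0 < N (g a) / 2 by rewrite divr_gt0// cmod_gt0.
have [d d0 dE] := cdiff_cont (ent_cdiff a ge) g2; exists d => // z /dE.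
by have := cmod_leB (g a) (g z); rewrite cmodBC; lra.
Qed.

Lemma zeros_isolated f a : ent f -> (exists z, f z != 0) -> exists2 d : R, 0 < d &
  forall z, z != a -> N (z - a) < d -> f z != 0.
Proof.
move=> fe fn; have [m [g [ge ga gE]]] := zero_order_ent a fe fn.
have [d d0 dE] := cont_neq0 ge ga; exists d => // z za /dE h.
rewrite gE mulf_neq0 ?expf_neq0 ?subr_eq0// -cmod_gt0.
have : 0 < N (g a) by rewrite cmod_gt0.
lra.
Qed.

(** Induction on m: the quotient (f z - f 0) / z has growth of order m, bounded directly for |z| <=
    1 and by division beyond; the case m = 0 is Liouville's theorem. *)
Lemma poly_growth f (A : R) m : ent f -> (forall z, N (f z) <= A * (1 + N z) ^+ m) ->
  exists p : {poly C}, forall z, f z = p.[z].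
Proof.
elim: m f A => [|m IH] f A fe fA.
  exists (f 0)%:P => z; rewrite hornerC; apply: (liouville fe (M := A)) => w.
  by have := fA w; rewrite expr0 mulr1.
have [q [qe qE _]] := ent_division 0 fe.
have A0 : 0 <= A.
  by have := fA 0; rewrite cmod0 addr0 expr1n mulr1; apply: le_trans; exact: cmod_ge0.
have [B B0 BE] := hol_bounded (@ent_hol R q 0 1 qe).
have [|p pE] := IH q (4 * A + B) qe.
  move=> z; have z0 := cmod_ge0 z.
  have X1 : 1 <= (1 + N z) ^+ m by apply: exprn_ege1; lra.
  have [z1|z1] := leP (N z) 1.
    apply: (@le_trans _ _ B); first by apply: BE; rewrite subr0.
    have h1 : B <= B * (1 + N z) ^+ m by rewrite ler_peMr// ltW.
    have h2 : 0 <= 4 * A * (1 + N z) ^+ m by rewrite !mulr_ge0//; lra.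
    lra.
  have h1 : N (f z - f 0) = N z * N (q z) by rewrite (qE z) addrC addKr subr0 cmodM.
  have h2 := cmodB (f z) (f 0).
  have h3 : N (f 0) <= A by have := fA 0; rewrite cmod0 addr0 expr1n mulr1.
  have h4 := fA z; rewrite exprS in h4.
  have zp : 0 < N z by lra.
  rewrite -(ler_pM2l zp) -h1; apply: le_trans h2 _.
  have h5 : A <= A * ((1 + N z) ^+ m * N z).
    by rewrite ler_peMr//; apply: mulr_ege1 => //; exact: ltW.
  have h6 : A * ((1 + N z) * (1 + N z) ^+ m) <= A * (2 * ((1 + N z) ^+ m * N z)).
    apply: ler_wpM2l => //; rewrite [(1 + N z) ^+ m * _]mulrC mulrA ler_wpM2r//; lra.
  have h7 : 0 <= B * ((1 + N z) ^+ m * N z).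
    by apply: mulr_ge0; [exact: ltW|apply: mulr_ge0 => //; lra].
  lra.
exists ((f 0)%:P + 'X * p) => z.
by rewrite hornerD hornerC hornerM hornerX -pE qE subr0.
Qed.

(** The Casorati-Weierstrass theorem at infinity. If f stayed d away from b there, 1/(f(1/z) - b)
    would extend over 0 with a zero of some finite order m, so |f - b| would be O(|z|^m) and f a
    polynomial. *)
Lemma casorati f (r d : R) b : ent f -> ~ (exists p : {poly C}, forall z, f z = p.[z]) ->
  0 < d -> exists z, r < N z /\ N (f z - b) < d.
Proof.
move=> fe fnp d0; apply: contrapT => K; apply: fnp.
have {}K z : r < N z -> d <= N (f z - b).
  by move=> rz; rewrite leNgt; apply/negP => h; apply: K; exists z.
pose r1 : R := 1 + `|r|; have r10 : 0 < r1 by rewrite ltr_pwDl.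
have rr1 : r < r1 by rewrite /r1; have := ler_norm r; lra.
pose s := (2 * r1)^-1; have s0 : 0 < s by rewrite invr_gt0 mulr_gt0.
have inv_big z : z != 0 -> N z <= s -> r < N z^-1.
  move=> z0 zs; apply: lt_trans rr1 _; rewrite cmodV.
  have z00 : 0 < N z by rewrite cmod_gt0.
  rewrite -[r1]invrK ltf_pV2 ?posrE ?invr_gt0//; apply: le_lt_trans zs _.
  by rewrite /s ltf_pV2 ?posrE ?mulr_gt0//; lra.
pose u z := (f z^-1 - b)^-1.
have fb z : z != 0 -> N z <= s -> f z^-1 - b != 0.
  by move=> z0 zs; rewrite -cmod_gt0; apply: lt_le_trans d0 _; apply: K; exact: inv_big.
have [|q qh qE] := @removable R u 0 s d^-1 s0.
  move=> z z0; rewrite subr0 => zs; split.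
    eexists; apply: cdiffV; first exact: fb.
    apply: cdiffB; last exact: cdiff_cst.
    by apply: (cdiff_comp (cdiffV z0 (cdiff_id z))); exact: ent_cdiff.
  by rewrite cmodV lef_pV2 ?posrE ?K ?inv_big// cmod_gt0 fb.
have s2 : N (rc (s / 2)) = s / 2 by rewrite cmod_rc gtr0_norm// divr_gt0.
have s20 : rc (s / 2) != 0 by rewrite -cmod_gt0 s2 divr_gt0.
have [|m [g [gh g0 gE]]] := zero_order s0 qh.
  exists (rc (s / 2)); first by rewrite subr0 s2.
  by rewrite qE// invr_eq0 fb// s2; lra.
have g2 : 0 < N (g 0) / 2 by rewrite divr_gt0// cmod_gt0.
have [e e0 eE] : exists2 e : R, 0 < e & forall w, N (w - 0) < e -> N (g w - g 0) <= N (g 0) / 2.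
  by apply: (hol_disc_cont gh) g2; rewrite subrr cmod0 ltW.
pose t := Num.min s (e / 2); have t0 : 0 < t by rewrite lt_min s0 divr_gt0.
have ts : t <= s by rewrite ge_min lexx.
have te : t < e by rewrite gt_min; apply/orP; right; lra.
have [B B0 BE] := hol_bounded (@ent_hol R f 0 t^-1 fe).
(* Covers both ranges: |f| <= B for |z| <= 1/t, and |f z - b| <= |z|^m / (|g 0| / 2) beyond. *)
pose A := B + N b + (N (g 0) / 2)^-1.
apply: (@poly_growth f A m) => // z; have z0 := cmod_ge0 z.
have b0 := cmod_ge0 b.
have g2i : 0 < (N (g 0) / 2)^-1 by rewrite invr_gt0.
have X1 : 1 <= (1 + N z) ^+ m by apply: exprn_ege1; lra.
have A0 : 0 <= A by rewrite /A; lra.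
have [zt|zt] := leP (N z) t^-1.
  apply: (@le_trans _ _ A); last by rewrite ler_peMr.
  have := BE z; rewrite subr0 => /(_ zt); rewrite /A; lra.
have zn0 : z != 0 by rewrite -cmod_gt0; apply: lt_trans zt; rewrite invr_gt0.
have zv0 : z^-1 != 0 by rewrite invr_eq0.
have zvt : N z^-1 <= t.
  by rewrite cmodV -[t]invrK lef_pV2 ?posrE ?invr_gt0 ?cmod_gt0// ltW.
have := gE z^-1; rewrite subr0 qE// /u invrK => uE.
have gz : N (g 0) / 2 <= N (g z^-1).
  have := eE z^-1; rewrite subr0 => /(_ (le_lt_trans zvt te)).
  by have := cmod_leB (g 0) (g z^-1); rewrite cmodBC; lra.
have gz0 : 0 < N (g z^-1) by lra.
have fz : N (f z - b) <= N z ^+ m * (N (g 0) / 2)^-1.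
  rewrite -[f z - b]invrK uE cmodV cmodM cmodX cmodV exprVn invfM invrK.
  apply: ler_wpM2l; first by rewrite exprn_ge0.
  by rewrite lef_pV2 ?posrE.
have h1 : N z ^+ m <= (1 + N z) ^+ m by rewrite lerXn2r ?nnegrE//; lra.
have h2 : N z ^+ m * (N (g 0) / 2)^-1 <= (1 + N z) ^+ m * (N (g 0) / 2)^-1.
  by rewrite ler_pM2r.
have h3 : N b <= N b * (1 + N z) ^+ m by rewrite ler_peMr.
have h4 : 0 <= B * (1 + N z) ^+ m by rewrite mulr_ge0 ?(ltW B0)//; lra.
have h5 : N (f z) <= N (f z - b) + N b by rewrite -{1}(subrK b (f z)) cmodD.
rewrite /A; lra.
Qed.

(** On a small circle |f - f a| >= eta; for |w - f a| <= eta/4, f - w is larger on the circle than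
    at the centre, and [min_modulus] gives a solution. *)
Lemma open_map f a (r : R) : 0 < r -> ent f -> (exists z, f z != f a) ->
  exists2 e : R, 0 < e & forall w, N (w - f a) <= e -> exists2 z, N (z - a) <= r & f z = w.
Proof.
move=> r0 fe [z0 fz0].
have Fe w : ent (fun z => f z - w).
  by move=> z; eexists; apply: cdiffB (ent_cdiff z fe) (cdiff_cst _ _).
have [|m [g [ge ga gE]]] := zero_order_ent a (Fe (f a)).
  by exists z0; rewrite subr_eq0.
have [d d0 dE] := cont_neq0 ge ga.
have [s [s0 sd sr]] : exists s : R, [/\ 0 < s, s < d & s <= r].
  exists (Num.min r (d / 2)); rewrite lt_min r0 divr_gt0// ge_min lexx; split => //.
  by rewrite gt_min; apply/orP; right; lra.
pose eta := s ^+ m * (N (g a) / 2).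
have eta0 : 0 < eta by rewrite mulr_gt0 ?exprn_gt0// divr_gt0// cmod_gt0.
exists (eta / 4); first by rewrite divr_gt0.
move=> w wf.
have [||z zs zE] := @min_modulus R (fun z => f z - w) a s (eta / 2) s0 (@ent_hol R _ a s (Fe w)).
- move=> z zs; have h1 : eta <= N (f z - f a).
    by rewrite gE cmodM cmodX zs /eta ler_wpM2l ?exprn_ge0 ?(ltW s0)// dE ?zs.
  by have := cmodB_tri w (f z) (f a); lra.
- by rewrite cmodBC; lra.
exists z; first exact: le_trans sr.
by apply/eqP; rewrite -subr_eq0; apply/eqP.
Qed.

(** A substitute for Picard's theorem: a whole disc of values, each taken n times. [casorati]
    supplies a far point whose value lies in the previous disc, and openness of f there gives the
    next, smaller disc. *)
Lemma many_preimages f n : ent f -> ~ (exists p : {poly C}, forall z, f z = p.[z]) ->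
  exists b (d r : R), 0 < d /\ forall w, N (w - b) <= d ->
   exists s : seq C, [/\ uniq s, size s = n & forall z, z \in s -> [/\ 1 < N z, N z <= r & f z = w]].
Proof.
move=> fe fnp.
have fn a : exists z, f z != f a.
  apply: contrapT => K; apply: fnp; exists (f a)%:P => z; rewrite hornerC.
  by apply/eqP/negPn/negP => fz; apply: K; exists z.
elim: n => [|n [b [d [r [d0 H]]]]].
  by exists 0, 1, 0; split=> // w _; exists [::].
(* Modulus above 2 + |r| keeps every preimage within distance 1 of z beyond 1 + |r|, hence distinct
   from the n earlier ones. *)
have [z [rz fz]] := @casorati f (2 + `|r|) (d / 2) b fe fnp (divr_gt0 d0 (ltr0n _ 2)).
have [e e0 eE] := open_map ltr01 fe (fn z).
exists (f z), (Num.min e (d / 2)), (N z + 1 + `|r|); split; first by rewrite lt_min e0 divr_gt0.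
move=> w; rewrite le_min => /andP[w1 w2].
have [|s [us ss sE]] := H w; first by have := cmodB_tri (f z) w b; lra.
have [x xz fx] := eE w w1.
have rn := ler_norm r; have rn0 := normr_ge0 r.
have xr : 1 + `|r| < N x by have := cmod_leB z x; rewrite cmodBC; lra.
exists (x :: s); split => /=.
- rewrite us andbT; apply/negP => /sE[_ h _]; lra.
- by rewrite ss.
- move=> y; rewrite inE => /orP[/eqP ->|/sE[y1 y2 y3]].
    by split=> //; [lra|have := cmod_leB x z; lra].
  by split=> //; have := cmod_ge0 z; lra.
Qed.

Lemma prod_division f (s : seq C) : ent f -> uniq s -> (forall a, a \in s -> f a = 0) ->
  exists2 q, ent q & forall z, f z = (\prod_(a <- s) (z - a)) * q z.
Proof.
elim: s f => [|a s IH] f fe.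
  by move=> _ _; exists f => // z; rewrite big_nil mul1r.
move=> /= /andP[as_ us] fs; have [q [qe qE _]] := ent_division a fe.
have fa : f a = 0 by apply: fs; rewrite mem_head.
have [|p pe pE] := IH q qe us.
  move=> c cs; have ca : c != a by apply: contraNneq as_ => <-.
  have := qE c; rewrite fa fs ?inE ?cs ?orbT// add0r => /esym/eqP.
  by rewrite mulf_eq0 subr_eq0 (negbTE ca) => /eqP.
by exists p => // z; rewrite qE fa add0r pE big_cons mulrA.
Qed.

End Entire.

(** * Counting functions and the truncated defect *)

Section Counting.
Variable R : realType.
Local Notation C := (cplx R).
Local Notation N := (@cmod R).
Local Notation mu := (@lebesgue_measure R).
Implicit Types (f g q p : C -> C) (z w a c : C).

(** The contribution of a single point of modulus rho to the integrated counting function; the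
    integrand vanishes below rho, so the pole of 1/t is harmless. *)
Lemma int_inv (rho r : R) : 0 < rho -> rho <= r ->
  mu.-integrable `[0, r] (EFin \o (fun t => (rho <= t)%R%:R / t)) /\
  \int[mu]_(t in `[0, r]) ((rho <= t)%R%:R / t) = ln r - ln rho.
Proof.
move=> rho0 rhor.
have inv_cont (x : R) : rho <= x -> {for x, continuous (@GRing.inv R)}.
  by move=> rx; apply: inv_continuous; rewrite gt_eqF//; exact: lt_le_trans rx.
have icont : {within `[rho, r], continuous (@GRing.inv R)}.
  apply: continuous_in_subspaceT => x /set_mem; rewrite /= in_itv /= => /andP[rx _].
  exact: inv_cont.
have iint : mu.-integrable `[rho, r] (EFin \o (@GRing.inv R)).
  by apply: continuous_compact_integrable; [exact: segment_compact|exact: icont].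
have patchE : (fun t : R => (rho <= t)%R%:R / t) = (@GRing.inv R) \_ (`[rho, +oo[).
  apply/funext => t; rewrite /patch; case: ifPn => [/set_mem|/negP tr].
    by rewrite /= in_itv /= andbT => ->; rewrite mul1r.
  have /negbTE -> : ~~ (rho <= t); last by rewrite mul0r.
  by apply/negP => rt; apply: tr; apply/mem_set; rewrite /= in_itv /= rt.
have capE : [set` `[0, r]] `&` [set` `[rho, +oo[] = [set` `[rho, r]].
  apply/seteqP; split=> t /=; rewrite !in_itv /= ?andbT.
    by move=> [/andP[_ ->] ->].
  by move=> /andP[h1 h2]; split; rewrite ?h2 ?andbT//; lra.
rewrite patchE; split.
  have i1 := (integrable_mkcond (mu := mu) _ (measurable_itv `[rho, r])).1 iint.
  have i2 D : measurable D -> mu.-integrable D _ := fun mD => integrableS measurableT mD (@subsetT _ _) i1.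
  apply: (eq_integrable _ _ _ _ (i2 `[0, r]%classic (measurable_itv _))); first exact: measurable_itv.
  move=> t /set_mem; rewrite /= in_itv /= => /andP[t0 tr].
  by rewrite /patch !mem_setE /= !in_itv /= tr !andbT; case: ifP.
rewrite -Rintegral_mkcondr capE.
have [<-|rlt] := eqVneq rho r; first by rewrite set_itv1 Rintegral_set1 subrr.
have {}rlt : rho < r by rewrite lt_neqAle rlt.
rewrite /Rintegral (@continuous_FTC2 R _ (@ln R)) //.
- split.
  + move=> x; rewrite in_itv /= => /andP[rx _].
    by have [] := is_derive1_ln (lt_trans rho0 rx).
  + by apply: cvg_at_right_filter; apply: continuous_ln.
  + by apply: cvg_at_left_filter; apply: continuous_ln; exact: lt_trans rlt.
- move=> x; rewrite in_itv /= => /andP[rx _].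
  by rewrite derive1E; have [_ ->] := is_derive1_ln (lt_trans rho0 rx).
Qed.

Lemma int_inv_sum (s : seq C) (r : R) : (forall z, z \in s -> 0 < N z /\ N z <= r) ->
  mu.-integrable `[0, r] (EFin \o (fun t => \sum_(z <- s) ((N z <= t)%R%:R / t))) /\
  \int[mu]_(t in `[0, r]) (\sum_(z <- s) ((N z <= t)%R%:R / t)) = \sum_(z <- s) (ln r - ln (N z)).
Proof.
elim: s => [|z s IH] sE.
  have -> : (fun t : R => \sum_(z <- [::] : seq C) ((N z <= t)%R%:R / t)) = fun=> 0.
    by apply/funext => t; rewrite big_nil.
  split; first by apply: cont_integrable; exact: cst_continuous.
  by rewrite big_nil /Rintegral integral0.
have [z0 zr] := sE z (mem_head _ _).
have [i1 e1] := int_inv z0 zr.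
have [|i2 e2] := IH; first by move=> w ws; apply: sE; rewrite inE ws orbT.
have -> : (fun t : R => \sum_(z <- z :: s) ((N z <= t)%R%:R / t)) =
    fun t => (N z <= t)%R%:R / t + \sum_(z <- s) ((N z <= t)%R%:R / t).
  by apply/funext => t; rewrite big_cons.
split; last by rewrite RintegralD// e1 e2 big_cons.
have := @integrableD _ _ _ mu `[0, r] (measurable_itv _) _ _ i1 i2.
by exact: eq_integrable.
Qed.

(** An infinite zero set contains an injective sequence in the disc. Zeros being isolated, it equals
    its ultralimit for ultra-many indices, so two of its terms coincide. *)
Lemma zeros_finite f (r : R) : ent f -> (exists z, f z != 0) ->
  finite_set [set z : C | N z <= r /\ f z = 0].
Proof.
move=> fe fn; apply: contrapT => /infiniteP /pcard_leP[u].
have uE n : N (u n - 0) <= r /\ f (u n) = 0.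
  by rewrite subr0; apply: (@funS _ _ _ _ u).
have [l ul lr] := disc_ulim (fun n => (uE n).1).
have [d d0 dE] := zeros_isolated l fe fn.
have d2 : 0 < d / 2 by rewrite divr_gt0.
have H : \forall n \near ultra, u n = l.
  apply: filterS (ul _ d2) => n nd; apply/eqP/negPn/negP => nl.
  by have := dE _ nl; rewrite (uE n).2 eqxx => h; have := h (_ : N (u n - l) < d); lra.
have [n _ nE] := ultra_ex 0 H; have [m nm mE] := ultra_ex n.+1 H.
have : n = m.
  by apply: (@inj _ _ _ u); rewrite ?inE//; exact: etrans nE (esym mE).
by move=> nmE; rewrite nmE ltnn in nm.
Qed.

Lemma nbarE f w0 (r t : R) : finite_set [set z : C | N z <= r /\ f z = w0] -> t <= r ->
  (nbar t w0 f)%:R = \sum_(z <- fset_set [set z : C | N z <= r /\ f z = w0]) (N z <= t)%R%:R :> R.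
Proof.
move=> fin tr; set A := fset_set _.
have fint : finite_set [set z : C | N z <= t /\ f z = w0].
  by apply: sub_finite_set fin => z [zt fz]; split=> //; exact: le_trans tr.
have -> : nbar t w0 f = size [seq z <- A | N z <= t].
  apply: perm_size; apply: uniq_perm; [exact: fset_uniq|by rewrite filter_uniq// fset_uniq|].
  move=> z; rewrite mem_filter in_fset_set// in_fset_set//.
  apply/idP/idP => [/set_mem[zt fz]|/andP[zt /set_mem[zr fz]]].
    by rewrite zt /=; apply/mem_set; split=> //; exact: le_trans tr.
  by apply/mem_set.
by rewrite size_filter -sum1_count natr_sum big_mkcond; apply: eq_bigr => z _; case: ifP.
Qed.

(** A w0-point at the origin is counted by both [nbar t] and [nbar 0], so it cancels in the
    integrand and enters only through the ln r term. *)
Lemma NbarE f w0 (r : R) : 0 < r -> finite_set [set z : C | N z <= r /\ f z = w0] ->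
  Nbar r w0 f =
  \sum_(z <- fset_set [set z : C | N z <= r /\ f z = w0] | 0 < N z) (ln r - ln (N z)) +
  (nbar 0 w0 f)%:R * ln r.
Proof.
move=> r0 fin; rewrite /Nbar; congr (_ + _).
rewrite -big_filter; set s := [seq _ <- _ | _].
have sE z : z \in s -> 0 < N z /\ N z <= r.
  by rewrite mem_filter in_fset_set// => /andP[-> /set_mem[]].
have [_ <-] := int_inv_sum sE.
apply: eq_Rintegral => t /set_mem; rewrite /= in_itv /= => /andP[t0 tr].
rewrite (nbarE fin tr) (nbarE fin (ltW r0)) -sumrB mulr_suml /s big_filter [RHS]big_mkcond.
apply: eq_bigr => z _; case: ltP => z0; last by rewrite (le_trans z0 t0) subrr mul0r.
by rewrite subr0.
Qed.

Lemma nbar0_le1 f w0 : (nbar 0 w0 f <= 1)%N.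
Proof.
rewrite /nbar; set s := fset_set _.
have fin : finite_set [set z : C | N z <= 0 /\ f z = w0].
  apply: (@sub_finite_set _ _ [set 0]); last exact: finite_set1.
  by move=> z [z0 _] /=; apply/eqP; rewrite -cmod_eq0 eq_le z0 cmod_ge0.
have : {subset s <= [:: 0]}.
  move=> z; rewrite in_fset_set// => /set_mem[z0 _]; rewrite inE -cmod_eq0 eq_le z0 cmod_ge0//.
exact: (uniq_leq_size (fset_uniq s)).
Qed.

Lemma factor_double f p q c : ent p -> ent q -> (forall z, f z = p z * q z) -> p c != 0 ->
  f c = 0 -> cder f c = 0 -> q c = 0 /\ cder q c = 0.
Proof.
move=> pe qe fE pc fc f'c.
have qc : q c = 0.
  by move: fc; rewrite fE => /eqP; rewrite mulf_eq0 (negbTE pc) => /eqP.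
split=> //; have := cdiffM (ent_cdiff c pe) (ent_cdiff c qe).
have -> : (fun z => p z * q z) = f by apply/funext => z; rewrite fE.
move=> /cdiff_cder; rewrite f'c qc mulr0 add0r => /esym/eqP.
by rewrite mulf_eq0 (negbTE pc) => /eqP.
Qed.

Lemma ent_exp a m : ent (fun z => (z - a) ^+ m).
Proof. by move=> z; exact: cdiff_exp. Qed.

(** The list [s ++ s] presents each double zero twice, which is how [jensen] counts multiplicity. *)
Lemma double_division f (s : seq C) : ent f -> uniq s ->
  (forall a, a \in s -> f a = 0 /\ cder f a = 0) ->
  exists2 q, ent q & forall z, f z = (\prod_(a <- s ++ s) (z - a)) * q z.
Proof.
elim: s f => [|a s IH] f fe.
  by move=> _ _; exists f => // z; rewrite big_nil mul1r.
move=> /= /andP[as_ us] fs.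
have [fa f'a] := fs a (mem_head _ _).
have [q1 [q1e q1E q1a]] := ent_division a fe.
have [q2 [q2e q2E _]] := ent_division a q1e.
have fE z : f z = (z - a) ^+ 2 * q2 z.
  by rewrite q1E fa add0r q2E q1a f'a add0r expr2 mulrA.
have [|q qe qE] := IH q2 q2e us.
  move=> c cs; have ca : c != a by apply: contraNneq as_ => <-.
  have [|fc f'c] := fs c; first by rewrite inE cs orbT.
  by apply: (factor_double (ent_exp a 2) q2e fE _ fc f'c); rewrite expf_neq0// subr_eq0.
exists q => // z; rewrite fE qE /= big_cons !big_cat /= big_cons.
by move: (\prod_(j <- s) (z - j)) (q z) => x y; ring.
Qed.

(** [jensen] needs a nonzero value at the origin, hence the passage from f - w0 to g. For r >= 1 the
    removed power of z has modulus at least 1 on the circle, so |g| <= |f| + |w0| there. *)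
Lemma reduced_mean f w0 m g (r : R) : ent f -> ent g -> 1 <= r ->
  (forall z, f z - w0 = (z - 0) ^+ m * g z) ->
  log_mean g r <= log_mean f r + (log_plus (N w0) + ln 2).
Proof.
move=> fe ge r1 fE; have r0 : 0 < r by apply: lt_le_trans r1.
apply: le_log_mean => // z zr; rewrite addrA.
apply: le_trans (log_plusD (cmod_ge0 _) (cmod_ge0 _)).
apply: log_plus_le; apply: le_trans (cmodB _ _).
by rewrite fE subr0 cmodM cmodX zr ler_peMl ?cmod_ge0// exprn_ege1.
Qed.

Lemma sum_log_ge (s : seq C) (r r1 : R) : (forall z, z \in s -> 0 < N z <= r1) ->
  (size s)%:R * (ln r - ln r1) <= \sum_(z <- s) (ln r - ln (N z)).
Proof.
elim: s => [|z s IH] sr; first by rewrite big_nil mul0r.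
have /andP[z0 zr] := sr z (mem_head _ _).
rewrite big_cons /= -natr1 mulrDl mul1r addrC lerD//.
  by rewrite lerD2l lerN2 ler_ln ?posrE//; exact: lt_le_trans zr.
by apply: IH => w ws; apply: sr; rewrite inE ws orbT.
Qed.

Lemma sum_log_le (s : seq C) (r d : R) : 0 < d -> (forall z, z \in s -> d <= N z) ->
  \sum_(z <- s) (ln r - ln (N z)) <= (size s)%:R * (ln r - ln d).
Proof.
move=> d0; elim: s => [|z s IH] sd; first by rewrite big_nil mul0r.
have zd := sd z (mem_head _ _).
rewrite big_cons /= -natr1 mulrDl mul1r [leRHS]addrC lerD//.
  by rewrite lerD2l lerN2 ler_ln ?posrE//; exact: lt_le_trans zd.
by apply: IH => w ws; apply: sd; rewrite inE ws orbT.
Qed.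

(** Jensen's inequality with n prescribed zeros of f - b gives T >= n log r - O(1); the choice n >=
    1 + K leaves one log r to absorb the constant. *)
Lemma mean_superlog f (K : R) : ent f -> ~ (exists p : {poly C}, forall z, f z = p.[z]) ->
  exists2 r0 : R, 1 <= r0 & forall r, r0 <= r -> K * ln r <= log_mean f r.
Proof.
move=> fe fnp.
pose n := Num.bound (1 + `|K|).
have nK : 1 + K <= n%:R.
  apply/ltW; apply: le_lt_trans (archi_boundP _); last by rewrite addr_ge0.
  by rewrite lerD2l ler_norm.
have [b [d [r1 [d0 H]]]] := many_preimages n fe fnp.
have [|s [us sn sE]] := H b; first by rewrite subrr cmod0 ltW.
have Fe : ent (fun z => f z - b).
  by move=> z; eexists; apply: cdiffB (ent_cdiff z fe) (cdiff_cst _ _).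
have [|m [g [ge g0 gE]]] := zero_order_ent 0 Fe.
  apply: contrapT => K'; apply: fnp; exists b%:P => z; rewrite hornerC; apply/eqP.
  by rewrite -subr_eq0; apply/negPn/negP => fz; apply: K'; exists z.
have [|q qe qE] := prod_division ge us.
  move=> a /sE[a1 _ fa]; have := gE a; rewrite fa subrr subr0 => /esym/eqP.
  have a0 : a != 0 by rewrite -cmod_gt0; lra.
  by rewrite mulf_eq0 expf_eq0 (negbTE a0) andbF => /eqP.
pose c := log_plus (N b) + ln 2 - ln (N (g 0)) + n%:R * ln r1.
exists (expR `|c|); first by rewrite -expR0 ler_expR.
move=> r re.
have r1' : 1 <= r by apply: le_trans re; rewrite -expR0 ler_expR.
have r0 : 0 < r by apply: lt_le_trans r1'.
have cr : c <= ln r.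
  by apply: le_trans (ler_norm _) _; rewrite -[leLHS]expRK ler_ln ?posrE ?expR_gt0.
have J := jensen r0 qe qE g0.
have M := reduced_mean fe ge r1' gE.
have S : n%:R * (ln r - ln r1) <= \sum_(a <- s) (ln r - ln (N a)).
  by rewrite -sn; apply: sum_log_ge => a /sE[a1 ar _]; rewrite (lt_trans ltr01 a1).
have lr : 0 <= ln r by rewrite ln_ge0.
have nr : (1 + K) * ln r <= n%:R * ln r by rewrite ler_wpM2r.
rewrite mulrBr in S.
rewrite /c in cr.
move: (n%:R * ln r) (n%:R * ln r1) nr S cr => x y nr S cr.
rewrite mulrDl mul1r in nr.
move: (K * ln r) nr => k nr.
lra.
Qed.

(** Multiple w0-points enter Jensen's inequality twice, so they contribute at most T/2 + O(1). The
    at most four simple ones away from the origin and the origin itself contribute the 5 log r. *)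
Lemma Nbar_le f w0 : ent f -> ~ (exists p : {poly C}, forall z, f z = p.[z]) ->
  ~ (exists a : 'I_5 -> C, injective a /\ forall j, f (a j) = w0 /\ cder f (a j) != 0) ->
  exists c : R, forall r, 1 <= r -> Nbar r w0 f <= log_mean f r / 2 + 5 * ln r + c.
Proof.
move=> fe fnp few.
have Fe : ent (fun z => f z - w0).
  by move=> z; eexists; apply: cdiffB (ent_cdiff z fe) (cdiff_cst _ _).
have Fn : exists z, f z - w0 != 0.
  apply: contrapT => K'; apply: fnp; exists w0%:P => z; rewrite hornerC; apply/eqP.
  by rewrite -subr_eq0; apply/negPn/negP => fz; apply: K'; exists z.
have [m [g [ge g0 gE]]] := zero_order_ent 0 Fe Fn.
have [d d0 dE] := cont_neq0 ge g0.
(* Nonzero w0-points have modulus at least d, since g has no zero closer to the origin. The cap at 1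
   makes ln r - ln e nonnegative, so bounding the number of simple points by 4 is legitimate. *)
pose e := Num.min d 1.
have [e0 e1 ed] : [/\ 0 < e, e <= 1 & e <= d] by rewrite /e lt_min ge_min d0 ltr01 lexx orbT ge_min lexx.
have le0 : ln e <= 0 by exact: ln_le0.
move: e e0 e1 ed le0 => e e0 e1 ed le0.
exists ((log_plus (N w0) + ln 2 - ln (N (g 0))) / 2 - 4 * ln e) => r r1.
have r0 : 0 < r := lt_le_trans ltr01 r1.
have fin : finite_set [set z : C | N z <= r /\ f z = w0].
  apply: sub_finite_set (zeros_finite r Fe Fn) => z [zr /= ->]; split=> //; exact: subrr.
rewrite (NbarE r0 fin) -big_filter; set A := [seq _ <- _ | _].
have AU : uniq A by rewrite filter_uniq// fset_uniq.
have AE z : z \in A -> 0 < N z /\ f z = w0.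
  by rewrite mem_filter in_fset_set// => /andP[-> /set_mem[]].
have Ag z : z \in A -> g z = 0.
  move=> /AE[z0 fz]; have := gE z; rewrite fz !subrr => /esym/eqP.
  by rewrite subr0 mulf_eq0 expf_eq0 -cmod_eq0 (gt_eqF z0) andbF => /eqP.
have Ae z : z \in A -> e <= N z.
  move=> zA; apply: le_trans ed _; rewrite leNgt; apply/negP => zd.
  have := dE z; rewrite subr0 => /(_ zd); rewrite (Ag z zA) cmod0.
  by have : 0 < N (g 0); [rewrite cmod_gt0|lra].
clearbody A; rewrite (bigID (fun z => cder f z == 0)) /=.
rewrite -(big_filter A (fun z => cder f z == 0)) -(big_filter A (fun z => cder f z != 0)).
set D := [seq _ <- _ | _]; set S := [seq z <- A | _ != 0].
have lr : 0 <= ln r by rewrite ln_ge0.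
have S4 : (size S <= 4)%N.
  rewrite leqNgt; apply/negP => S5; apply: few.
  have jS (j : 'I_5) : (j < size S)%N by exact: leq_trans S5.
  exists (fun j : 'I_5 => nth 0 S j); split=> [i j /eqP|j].
    by rewrite nth_uniq ?filter_uniq// => /eqP/val_inj.
  have := mem_nth 0 (jS j); rewrite mem_filter => /andP[h /AE[_ fz]].
  by split.
have hS : \sum_(z <- S) (ln r - ln (N z)) <= 4 * (ln r - ln e).
  apply: le_trans (sum_log_le r e0 _) _.
    by move=> z; rewrite mem_filter => /andP[_ /Ae].
  rewrite ler_wpM2r//; first lra.
  by rewrite (ler_nat R _ 4).
have [|q qe qE] := double_division ge (filter_uniq (fun z => cder f z == 0) AU).
  move=> z; rewrite mem_filter => /andP[/eqP f'z zA].
  have [z0 fz] := AE z zA.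
  apply: (factor_double (ent_exp 0 m) ge gE).
  - by rewrite expf_neq0// subr0 -cmod_gt0.
  - by rewrite fz subrr.
  - have := cdiffB (ent_cdiff z fe) (cdiff_cst w0 z); rewrite subr0 => /cdiff_cder ->.
    exact: f'z.
have J := jensen r0 qe qE g0.
rewrite big_cat /= in J.
have M := reduced_mean fe ge r1 gE.
have n1 : (nbar 0 w0 f)%:R * ln r <= ln r.
  by rewrite ler_piMl// (ler_nat R _ 1) nbar0_le1.
move: J M; rewrite -/D.
move: (\sum_(z <- D) _) (\sum_(z <- S) _) hS (_%:R * ln r) n1 (log_mean f r) (log_mean g r).
move=> x y h u n1 v w J M.
lra.
Qed.

End Counting.

Section Defect.
Variable R : realType.
Local Notation C := (cplx R).
Implicit Types (f g : C -> C) (z w : C).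

Lemma entire_ent f : entire f -> ent f.
Proof. by move=> fe z; exists (cder f z); apply: derivable_cdiff; exact: fe. Qed.

(** By contraposition: with fewer than five such points, [Nbar_le] and [mean_superlog] bound the
    limsup by 1/2 + e for every e > 0. *)
Lemma simple_points f w0 : transcendental_entire f ->
  (truncated_defect w0 f < (2^-1)%:E)%E ->
  exists a : 'I_5 -> C, injective a /\ forall j, f (a j) = w0 /\ cder f (a j) != 0.
Proof.
move=> [/entire_ent fe fnp]; apply: contraPP => few; apply/negP; rewrite -leNgt.
rewrite /truncated_defect; set L := limf_esup _ _.
have [c cE] := Nbar_le fe fnp few.
suff H : forall e : R, 0 < e -> (L <= (2^-1 + e)%:E)%E.
  have : (L <= (2^-1)%:E)%E by apply/lee_addgt0Pr => e e0; rewrite -EFinD; exact: H.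
  case: (L) => [l||] //; rewrite !lee_fin => ?; lra.
move=> e e0.
(* This coefficient gives (6 + |c|) log r <= e T, which dominates 5 log r + c as soon as log r >= 1;
   hence the bound expR 1 in r1. *)
have [r0 r01 r0E] := mean_superlog ((6 + `|c|) / e) fe fnp.
pose r1 := Num.max r0 (expR 1).
have r10 : r0 <= r1 by rewrite le_max lexx.
have r1e : expR 1 <= r1 by rewrite le_max lexx orbT.
apply: (@le_trans _ _
  (ereal_sup ((fun r => (Nbar r w0 f / nevanlinna_T r f)%:E) @` `]r1, +oo[%classic))).
  apply: ereal_inf_lbound; exists `]r1, +oo[%classic => //.
  by exists r1; split; [exact: num_real|move=> x rx; rewrite /= in_itv /= rx].
apply: ge_ereal_sup => y [r /=]; rewrite in_itv /= andbT => rr <- {y}.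
rewrite lee_fin nevanlinna_TE.
have h1 := r0E r (ltW (le_lt_trans r10 rr)).
have h2 : 1 <= ln r.
  rewrite -[leLHS]expRK ler_ln ?posrE ?expR_gt0//; first by lra.
  by apply: lt_trans rr; apply: lt_le_trans r1e; exact: expR_gt0.
have h3 := cE r (le_trans r01 (ltW (le_lt_trans r10 rr))).
have nc := ler_norm c; have nc0 := normr_ge0 c.
have h4 : (6 + `|c|) * ln r <= e * log_mean f r.
  by rewrite -ler_pdivrMl// mulrA [e^-1 * _]mulrC.
have T0 : 0 < log_mean f r.
  by rewrite -(pmulr_rgt0 _ e0); apply: lt_le_trans h4; rewrite mulr_gt0//; lra.
rewrite ler_pdivrMr//; apply: le_trans h3 _.
have : c <= `|c| * ln r by apply: le_trans nc _; rewrite ler_peMr.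
lra.
Qed.

End Defect.

Theorem theorem1p5 (R : realType) (F : set (cplx R -> cplx R))
    (F_transcendental : forall f, F f -> transcendental_entire f)
    (julia_ge3 : exists z1 z2 z3 : cplx R,
       [/\ z1 <> z2, z1 <> z3 & z2 <> z3] /\
       [/\ julia_set F z1, julia_set F z2 & julia_set F z3])
    (w0 : cplx R) (w0_julia : julia_set F w0)
    (f : cplx R -> cplx R) (Ff : F f)
    (defect_lt : (truncated_defect w0 f < (2^-1)%:E)%E) :
  exists (w : nat -> cplx R) (f_ : nat -> cplx R -> cplx R),
    [/\ w n @[n --> \oo] --> w0,
        forall n, F (f_ n) &
        forall n, repelling_fixed_point (f \o f_ n) (w n)].
Proof.
have Fe phi : F phi -> ent phi by move=> /F_transcendental[/entire_ent].
have [a [a_inj aE]] := simple_points (F_transcendental f Ff) defect_lt.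
have invr_n n : 0 < n.+1%:R^-1 :> R by rewrite invr_gt0.
have H n : exists u : (cplx R -> cplx R) * cplx R,
    [/\ F u.1, cmod (u.2 - w0) <= n.+1%:R^-1 & repelling_fixed_point (f \o u.1) u.2].
  have [phi [w [Fphi ww fw dw]]] := repelling_near Fe w0_julia (Fe f Ff) a_inj
    (fun j => (aE j).1) (fun j => (aE j).2) (invr_n n).
  exists (phi, w); split=> //; split=> //.
  by rewrite norm_gt1 -cderE.
have [u uE] := choice H.
exists (fun n => (u n).2), (fun n => (u n).1); split=> [|n|n]; [|by have [] := uE n|by have [] := uE n].
apply/(cvg_cmodP eventually_filter) => e e0.
apply: filterS (near_infty_natSinv_lt (PosNum e0)) => n /= ne.
have [_ h _] := uE n; rewrite cmodBC; apply: le_trans h _; exact: ltW.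
Qed.
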